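(* For a real operator system $\mathcal{S}$ the following are equivalent: (a) $\mathcal{S}$ has the real CPFP; (b) the complexification $\mathcal{S}_c$ has the complex CPFP; (c) $\mathcal{S}\otimes_{\min}\mathcal{T}=\mathcal{S}\otimes_{\max}\mathcal{T}$ for all real operator systems $\mathcal{T}$; (d) $\mathcal{S}\otimes_{\min}\mathcal{T}=\mathcal{S}\otimes_{\max}\mathcal{T}$ for all finite dimensional real operator systems $\mathcal{T}$.
   Context: A real (resp. complex) operator system is a unital selfadjoint real (resp. complex) subspace of $B(H)$, $H$ a real (resp. complex) Hilbert space, with matrix cones $M_n(V)^+$. The complexification of a real operator system $V$ is the complex operator system $V_c=V+iV$ with $(x+iy)^*=x^*-iy^*$, the same unit, and $M_n(V_c)^+=\{x+iy:x=x^*,\,y=-y^*\in M_n(V),\ \begin{bmatrix} x & -y \\ y & x \end{bmatrix}\in M_{2n}(V)^+\}$. A ucp map is a linear unital completely positive map. An operator system $\mathcal{S}$ over $\mathbb{F}=\mathbb{R}$ (resp. $\mathbb{C}$) has the real (resp. complex) CPFP (completely positive factorization property) if there are a net of integers $(n_t)$ and ucp maps $u_t:\mathcal{S}\to M_{n_t}(\mathbb{F})$, $v_t:M_{n_t}(\mathbb{F})\to\mathcal{S}$ with $v_t(u_t(x))\to x$ for all $x\in\mathcal{S}$. For real operator systems $V,W$ with units $e,f$: $x\in M_n(V\otimes_{\min}W)^+$ iff $(\varphi\otimes\psi)^{(n)}(x)\ge0$ for all ucp $\varphi:V\to M_m(\mathbb{R})$, $\psi:W\to M_k(\mathbb{R})$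 and all $m,k$; a selfadjoint $x$ is in $M_n(V\otimes_{\max}W)^+$ iff for every $\epsilon>0$ there are finitely many $A_i\in M_{n_i}(V)^+$, $B_i\in M_{m_i}(W)^+$ and a real scalar matrix $\alpha$ with $x+\epsilon I_n\otimes e\otimes f=\alpha^T{\rm diag}(A_1\otimes B_1,\dots,A_k\otimes B_k)\alpha$. Equality of tensor products means equality of all the matrix cones on $V\otimes W$. *)

(* Defs.v *)
From HB Require Import structures.
From mathcomp Require Import all_boot all_order all_algebra.
From mathcomp Require Import ring lra.
From mathcomp Require Import generic_quotient complex mxtens.
From mathcomp Require Import boolp classical_sets reals topology normedtype.

Set Implicit Arguments.
Unset Strict Implicit.
Unset Printing Implicit Defensive.

Import Order.TTheory GRing.Theory Num.Theory.
Import numFieldNormedType.Exports.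

Local Open Scope ring_scope.
Local Open Scope complex_scope.
Local Open Scope quotient_scope.

Section ScalarCompleteness.
Variable R : realType.

Lemma real_normE (a : R) : `|a| ^+ 2 = a * idfun a.
Proof. by rewrite real_normK ?num_real // expr2. Qed.

Lemma real_complete (u : nat -> R) :
  (forall e, 0 < e -> exists N, forall m n, (N <= m)%N -> (N <= n)%N ->
     `|u m - u n| < e) ->
  exists l, forall e, 0 < e -> exists N, forall n, (N <= n)%N -> `|u n - l| < e.
Proof.
move=> cu.
have /cauchy_cvgP cvu : cauchy (u @ \oo)%classic.
  apply/cauchy_exP => e e0; have [N hN] := cu e e0.
  exists (u N); exists N => // n /= Nn; rewrite /ball /=.
  exact: hN.
exists (lim (u @ \oo)%classic) => e e0.
move/cvgrPdist_lt: cvu => /(_ e e0) [N _ hN].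
by exists N => n Nn; rewrite distrC; exact: hN.
Qed.

Lemma complex_normE (a : R[i]) : `|a| ^+ 2 = a * conjc a.
Proof. exact: sqr_normc. Qed.

Lemma complex_complete (u : nat -> R[i]) :
  (forall e, 0 < e -> exists N, forall m n, (N <= m)%N -> (N <= n)%N ->
     `|u m - u n| < e) ->
  exists l, forall e, 0 < e -> exists N, forall n, (N <= n)%N -> `|u n - l| < e.
Proof.
move=> cu.
have le_Re (z : R[i]) : `|complex.Re z|%:C <= `|z| by exact: normc_ge_Re.
have le_Im (z : R[i]) : `|complex.Im z|%:C <= `|z|.
  case: z => a b; rewrite normc_def lecR -sqrtr_sqr ler_wsqrtr //=.
  by rewrite lerDr sqr_ge0.
have [a ha] : exists l, forall e, 0 < e -> exists N, forall n, (N <= n)%N ->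
    `|complex.Re (u n) - l| < e.
  apply: real_complete => e e0; have [|N hN] := cu e%:C; first by rewrite ltcR.
  exists N => m n mN nN; rewrite -ltcR; apply: le_lt_trans (hN _ _ mN nN).
  by apply: le_trans (le_Re _); case: (u m) (u n) => [? ?] [? ?].
have [b hb] : exists l, forall e, 0 < e -> exists N, forall n, (N <= n)%N ->
    `|complex.Im (u n) - l| < e.
  apply: real_complete => e e0; have [|N hN] := cu e%:C; first by rewrite ltcR.
  exists N => m n mN nN; rewrite -ltcR; apply: le_lt_trans (hN _ _ mN nN).
  by apply: le_trans (le_Im _); case: (u m) (u n) => [? ?] [? ?].
exists (a +i* b) => -[e e']; rewrite ltcE /= => /andP[/eqP -> e0].
have e20 : 0 < e / 2 by rewrite divr_gt0.
have [N1 h1] := ha _ e20; have [N2 h2] := hb _ e20.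
exists (maxn N1 N2) => n; rewrite geq_max => /andP[/h1 k1 /h2 k2].
case: (u n) k1 k2 => x y /= k1 k2.
have -> : (x +i* y) - (a +i* b) = (x - a)%:C + 'i * (y - b)%:C.
  by simpc.
apply: le_lt_trans (ler_normD _ _) _.
rewrite normrM.
have -> : `|'i : R[i]| = 1 by rewrite normc_def /= expr0n /= expr1n add0r sqrtr1.
rewrite mul1r !normc_def /= !expr0n /= !addr0 !sqrtr_sqr -rmorphD /= ltcR.
by rewrite [e]splitr ltrD.
Qed.
End ScalarCompleteness.

(* Only used for F = R (trivial conjugation) and F = R[i]. Since 0 <= z in a    *)
(* numFieldType entails that z is real, dot products, positivity and norm       *)
(* bounds can be written uniformly for both scalar fields.                      *)
Record scalars := Scalars {
  scalar_field :> numFieldType;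
  scalar_conj : involutive_rmorphism scalar_field;
  scalar_normE : forall a : scalar_field, `|a| ^+ 2 = a * scalar_conj a;
  scalar_complete : forall u : nat -> scalar_field,
    (forall e, 0 < e -> exists N, forall m n, (N <= m)%N -> (N <= n)%N ->
       `|u m - u n| < e) ->
    exists l, forall e, 0 < e -> exists N, forall n, (N <= n)%N ->
       `|u n - l| < e
}.

HB.instance Definition _ (R : rcfType) :=
  isInvolutive.Build R[i] conjc (@conjcK R).

Definition realScalars (R : realType) : scalars :=
  @Scalars R idfun (@real_normE R) (@real_complete R).

Definition complexScalars (R : realType) : scalars :=
  @Scalars R[i] conjc (@complex_normE R) (@complex_complete R).

(* dotp is linear in its first argument; ||x||^2 is dotp x x.                   *)
Record hilbert (F : scalars) := Hilbert {
  hilbert_sort :> lmodType F;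
  dotp : {dot hilbert_sort for scalar_conj F};
  hilbert_complete : forall u : nat -> hilbert_sort,
    (forall e, 0 < e -> exists N, forall m n, (N <= m)%N -> (N <= n)%N ->
       dotp (u m - u n) (u m - u n) < e) ->
    exists l, forall e, 0 < e -> exists N, forall n, (N <= n)%N ->
       dotp (u n - l) (u n - l) < e
}.
Arguments dotp {F} h.

(* ||T|| <= c, for c >= 0. *)
Definition opnorm_le (F : scalars) (H : hilbert F) (T : H -> H) (c : F) : Prop :=
  forall h, dotp H (T h) (T h) <= c ^+ 2 * dotp H h h.

(* A unital selfadjoint subspace of B(H), given as an F-space opsys_sort with   *)
(* an injective linear map x |-> opsys_op x into the bounded operators on       *)
(* H = opsys_space; unit and involution are those of B(H).                      *)
Record opsys (F : scalars) := OpSys {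
  opsys_sort :> lmodType F;
  opsys_space : hilbert F;
  opsys_op : {bilinear opsys_sort -> opsys_space -> opsys_space};
  opsys_op_inj : forall x y, opsys_op x =1 opsys_op y -> x = y;
  opsys_op_bounded : forall x, exists2 c, 0 <= c & opnorm_le (opsys_op x) c;
  opsys_unit : opsys_sort;
  opsys_unitE : forall h, opsys_op opsys_unit h = h;
  opsys_star : opsys_sort -> opsys_sort;
  opsys_starE : forall x h k,
    dotp opsys_space (opsys_op x h) k =
    dotp opsys_space h (opsys_op (opsys_star x) k)
}.
Arguments opsys_space {F} V : rename.
Arguments opsys_op {F} V : rename.
Arguments opsys_unit {F} V : rename.
Arguments opsys_star {F V} x : rename.

Section OperatorSystems.
Variable F : scalars.
Implicit Types V W : opsys F.

Definition selfadjoint_mx V n (x : 'M[V]_n) : Prop :=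
  forall i j, opsys_star (x i j) = x j i.

(* M_n(V)^+ : the matrices acting as positive operators on H^n. Over the reals  *)
(* selfadjointness does not follow from the quadratic form being nonnegative.   *)
Definition poscone V n (x : 'M[V]_n) : Prop :=
  selfadjoint_mx x /\
  forall h : 'I_n -> opsys_space V,
    0 <= \sum_(i < n) \sum_(j < n)
           dotp (opsys_space V) (opsys_op V (x i j) (h j)) (h i).

Definition ucp V W (f : {linear V -> W}) : Prop :=
  f (opsys_unit V) = opsys_unit W /\
  forall n (x : 'M[V]_n), poscone x -> poscone (map_mx f x).

Definition finite_dim V : Prop :=
  exists n (b : 'I_n -> V), forall x, exists c : 'I_n -> F,
    x = \sum_(i < n) c i *: b i.

End OperatorSystems.

Section EuclideanSpace.
Variables (F : scalars) (n : nat).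
Local Notation conj := (scalar_conj F).

Definition cV_dot (x y : 'cV[F]_n) : F := \sum_i x i 0 * conj (y i 0).

Let cV_dot_is_zmodl y : zmod_morphism (cV_dot ^~ y).
Proof.
move=> u v; rewrite /cV_dot -sumrB; apply: eq_bigr => i _.
by rewrite !mxE mulrBl.
Qed.

Let cV_dot_is_zmodr x : zmod_morphism (cV_dot x).
Proof.
move=> u v; rewrite /cV_dot -sumrB; apply: eq_bigr => i _.
by rewrite !mxE rmorphB mulrBr.
Qed.

Let cV_dot_is_scalel y : scalable_for *%R (cV_dot ^~ y).
Proof.
move=> a u; rewrite /cV_dot /= mulr_sumr; apply: eq_bigr => i _.
by rewrite !mxE mulrA.
Qed.

Let cV_dot_is_scaler x : scalable_for (conj \; *%R) (cV_dot x).
Proof.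
move=> a u; rewrite /cV_dot /= mulr_sumr; apply: eq_bigr => i _.
by rewrite !mxE rmorphM mulrCA.
Qed.

HB.instance Definition _ :=
  isBilinear.Build F 'cV[F]_n 'cV[F]_n F *%R (conj \; *%R) cV_dot
    cV_dot_is_zmodl cV_dot_is_zmodr cV_dot_is_scalel cV_dot_is_scaler.

Let cV_dot_herm x y : cV_dot x y = (-1) ^+ false * conj (cV_dot y x).
Proof.
rewrite expr0 mul1r rmorph_sum; apply: eq_bigr => i _.
by rewrite rmorphM /= rmorphK mulrC.
Qed.

HB.instance Definition _ :=
  isHermitianSesquilinear.Build F 'cV[F]_n false conj cV_dot cV_dot_herm.

Lemma cV_dotE x : cV_dot x x = \sum_i `|x i 0| ^+ 2.
Proof. by apply: eq_bigr => i _; rewrite scalar_normE. Qed.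

Let cV_dot_gt0 x : x != 0 -> 0 < cV_dot x x.
Proof.
have ge0 i : true -> 0 <= `|x i 0| ^+ 2 by rewrite exprn_ge0.
move=> x0; rewrite cV_dotE lt_neqAle sumr_ge0 // andbT.
apply: contra x0; rewrite eq_sym psumr_eq0 // => /allP h.
apply/eqP/matrixP => i j; rewrite ord1 mxE.
by have := h i (mem_index_enum _); rewrite sqrf_eq0 normr_eq0 => /eqP.
Qed.

HB.instance Definition _ := isDotProduct.Build F 'cV[F]_n cV_dot cV_dot_gt0.

Lemma cV_complete (u : nat -> 'cV[F]_n) :
  (forall e, 0 < e -> exists N, forall m n, (N <= m)%N -> (N <= n)%N ->
     cV_dot (u m - u n) (u m - u n) < e) ->
  exists l, forall e, 0 < e -> exists N, forall n, (N <= n)%N ->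
     cV_dot (u n - l) (u n - l) < e.
Proof.
move=> cu.
have /choice[l hl] (i : 'I_n) : exists l, forall e, 0 < e -> exists N,
    forall k, (N <= k)%N -> `|u k i 0 - l| < e.
  apply: scalar_complete => e e0.
  have [|N hN] := cu (e ^+ 2); first by rewrite exprn_gt0.
  exists N => k k' Nk Nk'.
  rewrite -(@ltr_pXn2r _ 2) ?nnegrE ?normr_ge0 ?(ltW e0) //.
  apply: le_lt_trans (hN _ _ Nk Nk').
  rewrite cV_dotE (bigD1 i) //= !mxE lerDl sumr_ge0 // => j _.
  by rewrite exprn_ge0.
exists (\col_i l i) => e e0.
have e1 : 0 < 1 + e by rewrite ltr_wpDl.
have n1 : 0 < n.+1%:R :> F by rewrite ltr0n.
pose d := e / (1 + e) / n.+1%:R.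
have d0 : 0 < d by rewrite !divr_gt0.
have d1 : d <= 1.
  rewrite ler_pdivrMr // mul1r; apply: (@le_trans _ _ 1); last by rewrite ler1n.
  by rewrite ler_pdivrMr // mul1r lerDr ler01.
have /choice[N hN] (i : 'I_n) := hl i d d0.
exists (\max_i N i) => k Nk; rewrite cV_dotE.
have le i : `|(u k - \col_i l i) i 0| ^+ 2 <= d.
  rewrite !mxE; apply: (@le_trans _ _ (d ^+ 2)).
    rewrite ler_pXn2r ?nnegrE ?normr_ge0 ?(ltW d0) //.
    apply/ltW/hN; apply: leq_trans Nk; exact: leq_bigmax.
  by rewrite expr2; apply: ler_piMr => //; exact: ltW.
apply: (@le_lt_trans _ _ (\sum_(i < n) d)); first exact: ler_sum.
rewrite sumr_const card_ord -mulr_natr.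
apply: (@lt_le_trans _ _ (d * n.+1%:R)).
  by rewrite ltr_pM2l // ltr_nat.
rewrite /d divfK ?gt_eqF // ler_pdivrMr //.
by apply: ler_peMr; rewrite ?lerDl ltW.
Qed.

Definition cV_hilbert : hilbert F := @Hilbert F 'cV[F]_n cV_dot cV_complete.

Definition mx_op (A : 'M[F]_n) (h : 'cV[F]_n) : 'cV[F]_n := A *m h.

Let mx_op_bilinear : bilinear_for *:%R *:%R mx_op.
Proof.
split=> [h|A] a x y; first by rewrite /mx_op mulmxDl -scalemxAl.
by rewrite /mx_op mulmxDr -scalemxAr.
Qed.

HB.instance Definition _ := bilinear_isBilinear.Build F 'M[F]_n 'cV[F]_n 'cV[F]_n
  *:%R *:%R mx_op mx_op_bilinear.

Lemma mx_op_inj A B : mx_op A =1 mx_op B -> A = B.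
Proof.
move=> AB; apply/matrixP => i j.
by have /matrixP/(_ i 0) := AB (delta_mx j 0); rewrite /mx_op -!colE !mxE.
Qed.

Lemma mx_op_bounded A : exists2 c, 0 <= c & @opnorm_le F cV_hilbert (mx_op A) c.
Proof.
pose s i := \sum_j `|A i j|.
have s0 i : 0 <= s i by rewrite sumr_ge0.
pose S := \sum_i s i ^+ 2.
have S0 : 0 <= S by rewrite sumr_ge0 // => i _; rewrite exprn_ge0.
exists (1 + S *+ 2); first by rewrite addr_ge0 // mulrn_wge0.
move=> h; rewrite /= !cV_dotE.
set D := \sum_i `|h i 0| ^+ 2.
have D0 : 0 <= D by rewrite sumr_ge0 // => i _; rewrite exprn_ge0.
have hD i : `|h i 0| ^+ 2 <= D.
  by rewrite /D (bigD1 i) //= lerDl sumr_ge0 // => j _; rewrite exprn_ge0.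
have hhD i j : `|h i 0| * `|h j 0| <= D *+ 2.
  have [ij|/ltW ij] := real_leP (normr_real (h i 0)) (normr_real (h j 0)).
    apply: (@le_trans _ _ (`|h j 0| ^+ 2)); first by rewrite expr2 ler_wpM2r.
    by apply: le_trans (hD j) _; rewrite mulr2n lerDl.
  apply: (@le_trans _ _ (`|h i 0| ^+ 2)); first by rewrite expr2 ler_wpM2l.
  by apply: le_trans (hD i) _; rewrite mulr2n lerDl.
apply: (@le_trans _ _ (S *+ 2 * D)); last first.
  rewrite ler_wpM2r //; have : 0 <= S *+ 2 by rewrite mulrn_wge0.
  move: (S *+ 2) => t t0; rewrite expr2 mulrDl mul1r -addrA mulrDr mulr1.
  by rewrite ler_wpDl // lerDl addr_ge0 // mulr_ge0.
rewrite mulrnAl -mulrnAr mulr_suml; apply: ler_sum => i _.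
rewrite mxE; apply: (@le_trans _ _ ((\sum_j `|A i j| * `|h j 0|) ^+ 2)).
  rewrite ler_pXn2r ?nnegrE ?normr_ge0 ?sumr_ge0 // => [|j _].
    apply: le_trans (ler_norm_sum _ _ _) _; apply: ler_sum => j _.
    by rewrite normrM.
  by rewrite mulr_ge0.
rewrite expr2 expr2 /s !mulr_suml; apply: ler_sum => j _.
rewrite !mulr_sumr mulr_suml; apply: ler_sum => k _.
by rewrite mulrACA ler_wpM2l ?mulr_ge0.
Qed.

Lemma mx_op_star (A : 'M[F]_n) (h k : 'cV[F]_n) :
  cV_dot (mx_op A h) k = cV_dot h (mx_op (map_mx conj A^T) k).
Proof.
rewrite /cV_dot /mx_op.
under eq_bigr do rewrite mxE mulr_suml.
under [RHS]eq_bigr do rewrite mxE rmorph_sum mulr_sumr.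
rewrite exchange_big; apply: eq_bigr => j _; apply: eq_bigr => i _.
by rewrite !mxE rmorphM /= rmorphK mulrCA mulrA.
Qed.

(* M_n(F) = B(F^n). *)
Definition mx_opsys : opsys F :=
  @OpSys F 'M[F]_n cV_hilbert mx_op mx_op_inj mx_op_bounded
    1%:M (@mul1mx _ _ _) (fun A => map_mx conj A^T) mx_op_star.

End EuclideanSpace.

(* The pair (x, y) stands for x + iy. *)
Definition cplx (V : Type) : Type := (V * V)%type.

Section ComplexVectors.
Variables (R : realType) (V : lmodType R).

HB.instance Definition _ := GRing.Zmodule.on (cplx V).

Definition cplx_scale (a : R[i]) (x : cplx V) : cplx V :=
  (complex.Re a *: x.1 - complex.Im a *: x.2,
   complex.Re a *: x.2 + complex.Im a *: x.1).

Let cplx_scaleA a b x : cplx_scale a (cplx_scale b x) = cplx_scale (a * b) x.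
Proof.
case: a b x => [a a'] [b b'] [x x']; congr pair => /=;
  rewrite !(scalerDl, scalerDr, scalerN, scaleNr, opprD, scalerA, addrA);
  by rewrite [LHS]addrAC; congr (_ + _); exact: addrAC.
Qed.

Let cplx_scale1 x : cplx_scale 1 x = x.
Proof. by case: x => x x'; rewrite /cplx_scale /= !scale1r !scale0r subr0 addr0. Qed.

Let cplx_scaleDr : right_distributive cplx_scale +%R.
Proof.
move=> a [x x'] [y y']; congr pair => /=; rewrite !scalerDr ?opprD;
  by rewrite addrACA.
Qed.

Let cplx_scaleDl x : {morph cplx_scale^~ x : a b / a + b}.
Proof.
move=> [a a'] [b b']; case: x => x x'; congr pair => /=;
  by rewrite !scalerDl ?opprD addrACA.
Qed.

HB.instance Definition _ := GRing.Zmodule_isLmodule.Build R[i] (cplx V)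
  cplx_scaleA cplx_scale1 cplx_scaleDr cplx_scaleDl.

End ComplexVectors.

Section ComplexHilbert.
Variables (R : realType) (H : hilbert (realScalars R)).
Local Notation ip := (dotp H : H -> H -> R).

Definition cplx_dot (x y : cplx H) : R[i] :=
  (ip x.1 y.1 + ip x.2 y.2) +i* (ip x.2 y.1 - ip x.1 y.2).

Lemma ipC (x y : H) : ip x y = ip y x.
Proof. by rewrite (@hermitian_subproof _ _ _ _ (dotp H)) expr0 mul1r. Qed.

Lemma ipDl (x y z : H) : ip (x + y) z = ip x z + ip y z.
Proof. exact: linearDl. Qed.

Lemma ipDr (x y z : H) : ip z (x + y) = ip z x + ip z y.
Proof. exact: linearDr. Qed.

Lemma ipNl (x y : H) : ip (- x) y = - ip x y.
Proof. exact: linearNl. Qed.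

Lemma ipNr (x y : H) : ip x (- y) = - ip x y.
Proof. exact: linearNr. Qed.

Lemma ipZl a (x y : H) : ip (a *: x) y = a * ip x y.
Proof. exact: linearZl_LR. Qed.

Lemma ipZr a (x y : H) : ip x (a *: y) = a * ip x y.
Proof. by rewrite ipC ipZl ipC. Qed.

Lemma ip_ge0 (x : H) : 0 <= ip x x.
Proof.
have [->|/(@neq0_dnorm_gt0 _ _ _ (dotp H))/ltW //] := eqVneq x 0.
by have := ipZl 0 0 0; rewrite scale0r mul0r => ->.
Qed.

Definition ipE := (ipDl, ipDr, ipNl, ipNr, ipZl, ipZr).

Lemma ip_parallelogram (x y : H) : ip (x + y) (x + y) <= (ip x x + ip y y) *+ 2.
Proof.
have := ip_ge0 (x - y); rewrite !ipE (ipC y x).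
move: (ip x x) (ip y y) (ip x y) => a b c; lra.
Qed.


Let zmodl y : zmod_morphism (cplx_dot ^~ y).
Proof.
move=> [u u'] [v v']; rewrite /cplx_dot /= !ipE; simpc.
by congr (_ +i* _); ring.
Qed.

Let zmodr x : zmod_morphism (cplx_dot x).
Proof.
move=> [u u'] [v v']; rewrite /cplx_dot /= !ipE; simpc.
by congr (_ +i* _); ring.
Qed.

Let scalel y : scalable_for *%R (cplx_dot ^~ y : cplx H -> R[i]).
Proof.
move=> [a a'] [u u']; rewrite /cplx_dot /= !ipE; simpc.
by congr (_ +i* _); ring.
Qed.

Let scaler x : scalable_for (conjc \; *%R) (cplx_dot x : cplx H -> R[i]).
Proof.
move=> [a a'] [u u']; rewrite /cplx_dot /= !ipE; simpc.
by congr (_ +i* _); ring.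
Qed.

HB.instance Definition _ :=
  isBilinear.Build R[i] (cplx H) (cplx H) R[i] *%R (conjc \; *%R)
    cplx_dot zmodl zmodr scalel scaler.

Let herm (x y : cplx H) : cplx_dot x y = (-1) ^+ false * conjc (cplx_dot y x).
Proof.
rewrite expr0 mul1r /cplx_dot /= opprB.
by rewrite (ipC y.1) (ipC y.2) (ipC y.2 x.1) (ipC y.1 x.2).
Qed.

HB.instance Definition _ :=
  isHermitianSesquilinear.Build R[i] (cplx H) false conjc cplx_dot herm.

Lemma cplx_dotE (x : cplx H) : cplx_dot x x = (ip x.1 x.1 + ip x.2 x.2)%:C.
Proof. by rewrite /cplx_dot [ip x.2 x.1]ipC subrr. Qed.

Let gt0 (x : cplx H) : x != 0 -> 0 < cplx_dot x x.
Proof.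
move=> x0; rewrite cplx_dotE ltcR.
have [x1|x1] := eqVneq x.1 0.
  have x2 : x.2 != 0 by apply: contra x0 => /eqP x2; case: x x1 x2 => ? ? /= -> ->.
  by rewrite ltr_wpDl ?ip_ge0 //; exact: (@neq0_dnorm_gt0 _ _ _ (dotp H)).
by rewrite ltr_pwDl ?ip_ge0 //; exact: (@neq0_dnorm_gt0 _ _ _ (dotp H)).
Qed.

HB.instance Definition _ :=
  isDotProduct.Build R[i] (cplx H) cplx_dot gt0.

Lemma cplx_complete (u : nat -> cplx H) :
  (forall e, 0 < e -> exists N, forall m n, (N <= m)%N -> (N <= n)%N ->
     cplx_dot (u m - u n) (u m - u n) < e) ->
  exists l, forall e, 0 < e -> exists N, forall n, (N <= n)%N ->
     cplx_dot (u n - l) (u n - l) < e.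
Proof.
move=> cu.
have [a ha] : exists l, forall e : R, 0 < e -> exists N, forall n, (N <= n)%N ->
    ip ((u n).1 - l) ((u n).1 - l) < e.
  apply: (@hilbert_complete _ H) => e e0; have [|N hN] := cu e%:C.
    by rewrite ltcR.
  exists N => m n mN nN; have := hN m n mN nN; rewrite cplx_dotE ltcR.
  by apply: le_lt_trans; rewrite lerDl ip_ge0.
have [b hb] : exists l, forall e : R, 0 < e -> exists N, forall n, (N <= n)%N ->
    ip ((u n).2 - l) ((u n).2 - l) < e.
  apply: (@hilbert_complete _ H) => e e0; have [|N hN] := cu e%:C.
    by rewrite ltcR.
  exists N => m n mN nN; have := hN m n mN nN; rewrite cplx_dotE ltcR.
  by apply: le_lt_trans; rewrite lerDr ip_ge0.
exists ((a, b) : cplx H) => -[e e']; rewrite ltcE /= => /andP[/eqP -> e0].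
have e20 : 0 < e / 2 by rewrite divr_gt0.
have [N1 h1] := ha _ e20; have [N2 h2] := hb _ e20.
exists (maxn N1 N2) => n; rewrite geq_max => /andP[/h1 k1 /h2 k2].
by rewrite cplx_dotE ltcR [e]splitr ltrD.
Qed.

Definition cplx_hilbert : hilbert (complexScalars R) :=
  @Hilbert (complexScalars R) (cplx H) cplx_dot cplx_complete.

End ComplexHilbert.

Section Complexification.
Variables (R : realType) (V : opsys (realScalars R)).
Local Notation H := (opsys_space V).
Local Notation ip := (dotp H : H -> H -> R).
Local Notation op := (opsys_op V).

Definition cplx_op (x : cplx V) (h : cplx H) : cplx H :=
  (op x.1 h.1 - op x.2 h.2, op x.1 h.2 + op x.2 h.1).

Definition cplx_star (x : cplx V) : cplx V :=
  (opsys_star x.1, - opsys_star x.2).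

Let opDl x y h : op (x + y) h = op x h + op y h. Proof. exact: linearDl. Qed.
Let opDr x h k : op x (h + k) = op x h + op x k. Proof. exact: linearDr. Qed.
Let opNl x h : op (- x) h = - op x h. Proof. exact: linearNl. Qed.
Let opNr x h : op x (- h) = - op x h. Proof. exact: linearNr. Qed.
Let opZl a x h : op (a *: x) h = a *: op x h. Proof. exact: linearZl_LR. Qed.
Let opZr a x h : op x (a *: h) = a *: op x h. Proof. exact: linearZr_LR. Qed.
Let opE := (opDl, opDr, opNl, opNr, opZl, opZr).

Let cplx_op_is_zmodl h : zmod_morphism (cplx_op ^~ h).
Proof.
by move=> [x x'] [y y']; congr pair => /=; rewrite !opE ?opprD addrACA ?opprK.
Qed.

Let cplx_op_is_zmodr x : zmod_morphism (cplx_op x).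
Proof.
by move=> [h h'] [k k']; congr pair => /=; rewrite !opE ?opprD addrACA ?opprK.
Qed.

Let cplx_op_is_scalel h :
  @scalable_for R[i] (cplx V) (cplx H) *:%R (cplx_op ^~ h).
Proof.
move=> [a a'] [x x']; congr pair => /=;
  rewrite !opE !(scalerDr, scalerN, opprD, addrA).
  by rewrite [LHS](ACl (1 * 3 * 4 * 2)%AC).
by rewrite [LHS](ACl (1 * 3 * 4 * 2)%AC).
Qed.

Let cplx_op_is_scaler x :
  @scalable_for R[i] (cplx H) (cplx H) *:%R (cplx_op x).
Proof.
move=> [a a'] [h h']; congr pair => /=;
  rewrite !opE !(scalerDr, scalerN, opprD, addrA).
  by rewrite [LHS](ACl (1 * 3 * 2 * 4)%AC).
by rewrite [LHS](ACl (1 * 3 * 2 * 4)%AC).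
Qed.

HB.instance Definition _ :=
  isBilinear.Build R[i] (cplx V) (cplx H) (cplx H) *:%R *:%R cplx_op
    cplx_op_is_zmodl cplx_op_is_zmodr cplx_op_is_scalel cplx_op_is_scaler.

Lemma cplx_op_inj x y : cplx_op x =1 cplx_op y -> x = y.
Proof.
case: x y => x x' [y y'] xy.
suff h0 h : op x h = op y h /\ op x' h = op y' h.
  by congr pair; apply: opsys_op_inj => h; have [] := h0 h.
have e : cplx_op (x, x') (h, 0) = cplx_op (y, y') (h, 0) := xy (h, 0).
have := congr1 fst e; have := congr1 snd e.
by rewrite /= !linear0r !subr0 !add0r.
Qed.

Lemma cplx_op_bounded x :
  exists2 c, 0 <= c & @opnorm_le (complexScalars R) (cplx_hilbert H) (cplx_op x) c.
Proof.
have [c1 c10 h1] := opsys_op_bounded x.1.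
have [c2 c20 h2] := opsys_op_bounded x.2.
pose d : R := (c1 ^+ 2 + c2 ^+ 2) *+ 2.
have d0 : 0 <= d by rewrite mulrn_wge0 // addr_ge0 // exprn_ge0.
exists (1 + d)%:C; first by rewrite lecR addr_ge0.
case=> a b; rewrite /= !cplx_dotE -rmorphXn -rmorphM lecR /=.
apply: (@le_trans _ _ (d * (ip a a + ip b b))); last first.
  by rewrite ler_wpM2r ?addr_ge0 ?ip_ge0 //; nra.
have := ip_parallelogram (op x.1 a) (- op x.2 b).
have := ip_parallelogram (op x.1 b) (op x.2 a).
have := h1 a; have := h1 b; have := h2 a; have := h2 b.
rewrite ![ip (- _) (- _)]ipNl ![ip _ (- op x.2 b)]ipNr opprK /d /=.
move=> e1 e2 e3 e4 e5 e6; lra.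
Qed.

Definition cplx_unit : cplx V := (opsys_unit V, 0).

Lemma cplx_unitE h : cplx_op cplx_unit h = h.
Proof.
by case: h => a b; rewrite /cplx_op /= !linear0l !opsys_unitE subr0 addr0.
Qed.

Lemma cplx_starE x h k :
  cplx_dot (cplx_op x h) k = cplx_dot h (cplx_op (cplx_star x) k).
Proof.
case: x h k => [x x'] [h h'] [k k']; rewrite /cplx_dot /= !opE !ipE.
have st (y : V) (a b : H) : ip (op y a) b = ip a (op (opsys_star y) b) by exact (opsys_starE y a b).
by rewrite !st; congr (_ +i* _); ring.
Qed.

(* V + iV inside B(H + iH); its cones are computed in complexification_poscone. *)
Definition complexification : opsys (complexScalars R) :=
  @OpSys (complexScalars R) (cplx V) (cplx_hilbert H) cplx_op cplx_op_inj
    cplx_op_bounded cplx_unit cplx_unitE cplx_star cplx_starE.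

End Complexification.

Section ComplexificationCone.
Variables (R : realType) (V : opsys (realScalars R)) (n : nat).
Local Notation H := (opsys_space V).
Local Notation ip := (dotp H : H -> H -> R).
Local Notation op := (opsys_op V).
Local Notation Vc := (complexification V).

Lemma complexification_poscone (z : 'M[Vc]_n) :
  let x : 'M[V]_n := map_mx fst z in
  let y : 'M[V]_n := map_mx snd z in
  poscone z <->
  [/\ forall i j, opsys_star (x i j) = x j i,
      forall i j, opsys_star (y i j) = - y j i
    & poscone (block_mx x (- y) y x)].
Proof.
move=> x y.
have opNl (v : V) (h : H) : op (- v) h = - op v h by exact: linearNl.
have starN (v : V) : opsys_star (- v) = - opsys_star v.
  apply: opsys_op_inj => h; apply/eqP; rewrite -subr_eq0; apply/eqP.
  set k := _ - _; suff: ip k k = 0.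
    have [//|/(@neq0_dnorm_gt0 _ _ _ (dotp H)) k0 e] := eqVneq k 0.
    by move: k0; rewrite [X in 0 < X]e ltxx.
  have st u a b : ip (op u a) b = ip a (op (opsys_star u) b) := opsys_starE u a b.
  rewrite {2}/k opNl opprK ipDr -!st opNl ipNl; exact: addNr.
have yN i j : (- y) i j = - y i j by rewrite [LHS]mxE.
pose glue (h : 'I_n -> cplx H) (k : 'I_(n + n)) : H :=
  match split k with inl i => (h i).1 | inr i => (h i).2 end.
have quadE (h : 'I_n -> cplx H) :
    complex.Re (\sum_i \sum_j cplx_dot (cplx_op (z i j) (h j)) (h i)) =
    \sum_i \sum_j ip (op (block_mx x (- y) y x i j) (glue h j)) (glue h i).
  have ReD : {morph @complex.Re R : a b / a + b} by case=> ? ? [].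
  rewrite (big_morph _ ReD (erefl _)) big_split_ord /= -big_split /=.
  apply: eq_bigr => i _.
  rewrite (big_morph _ ReD (erefl _)) !big_split_ord /= -!big_split /=.
  apply: eq_bigr => j _.
  rewrite /glue (unsplitK (inl i)) (unsplitK (inl j)).
  rewrite (unsplitK (inr i)) (unsplitK (inr j)).
  rewrite !(block_mxEul, block_mxEur, block_mxEdl, block_mxEdr) !mxE /=.
  rewrite opNl !ipE; ring.
have starE : selfadjoint_mx z <->
    (forall i j, opsys_star (x i j) = x j i) /\
    (forall i j, opsys_star (y i j) = - y j i).
  split=> [sz|[sx sy] i j].
    by split=> i j; have := sz i j; rewrite !mxE /= => <-; rewrite ?opprK.
  by have := sx i j; have := sy i j; rewrite !mxE /= /cplx_star => -> ->;
    rewrite opprK -surjective_pairing.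
have ImE (h : 'I_n -> cplx H) : selfadjoint_mx z ->
    complex.Im (\sum_i \sum_j cplx_dot (cplx_op (z i j) (h j)) (h i)) = 0.
  move=> sz; set Q := \sum_i _.
  suff : conjc Q = Q by case: Q => a b [] /= ?; lra.
  rewrite /Q rmorph_sum; under eq_bigr do rewrite rmorph_sum.
  rewrite exchange_big; apply: eq_bigr => i _; apply: eq_bigr => j _.
  have herm a b : conjc (@cplx_dot _ H a b) = cplx_dot b a.
    rewrite [RHS](@hermitian_subproof _ _ _ _ (dotp (cplx_hilbert H))).
    by rewrite expr0 mul1r.
  apply: etrans (herm _ _) _.
  by rewrite cplx_starE (sz i j : cplx_star (z i j) = z j i).
split=> [[sz pz]|[sx sy [sb pb]]].
  have [sx sy] := starE.1 sz; split=> //; split.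
    move=> i j; rewrite -(splitK i) -(splitK j).
    case: (split i) (split j) => i' [] j' /=;
      rewrite !(block_mxEul, block_mxEur, block_mxEdl, block_mxEdr).
    + exact: sx.
    + by rewrite yN starN sy opprK.
    + by rewrite yN sy.
    + exact: sx.
  move=> g; pose h i : cplx H := (g (lshift n i), g (rshift n i)).
  have := pz h; rewrite lecE /= => /andP[_]; rewrite quadE.
  suff glueE k : glue h k = g k.
    by congr (_ <= _); apply: eq_bigr => i _; apply: eq_bigr => j _; rewrite !glueE.
  by rewrite /glue; case: (splitP k) => k' e; congr (g _); apply: val_inj.
have sz := starE.2 (conj sx sy); split=> // h.
by rewrite lecE /= ImE // eqxx /= quadE.
Qed.
End ComplexificationCone.

(* Algebraic tensor product: formal sums of pairs, two of them being identified *)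
(* when all bilinear maps agree on them.                                        *)
Section TensorProduct.
Variables (K : fieldType) (V W : lmodType K).

Definition formal_eval (U : lmodType K) (f : V -> W -> U) (s : seq (V * W)) : U :=
  \sum_(p <- s) f p.1 p.2.

Definition tensor_rel : rel (seq (V * W)) := fun s t =>
  `[< forall (U : lmodType K) (f : {bilinear V -> W -> U}),
        formal_eval f s = formal_eval f t >].

Lemma tensor_rel_equiv : equiv_class_of tensor_rel.
Proof.
split=> [s|s t|t s r]; first exact/asboolP.
  by apply/asboolP/asboolP => h U f; rewrite h.
by move=> /asboolP st /asboolP tr; apply/asboolP => U f; rewrite st tr.
Qed.
Canonical tensor_equiv := EquivRelPack tensor_rel_equiv.
Canonical tensor_encModRel := defaultEncModRel tensor_rel.

Definition tensor : Type := {eq_quot tensor_rel}.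
HB.instance Definition _ : EqQuotient _ tensor_rel tensor := EqQuotient.on tensor.
HB.instance Definition _ := Choice.on tensor.

Definition tens (v : V) (w : W) : tensor := \pi_tensor [:: (v, w)].

(* The linear map induced by f; only meaningful for bilinear f, see             *)
(* tensor_liftP, tensor_lift_tens and tensor_lift_unique.                       *)
Definition tensor_lift (U : lmodType K) (f : V -> W -> U) (x : tensor) : U :=
  formal_eval f (repr x).

Lemma tensor_eqP (s t : seq (V * W)) :
  (forall (U : lmodType K) (f : {bilinear V -> W -> U}),
     formal_eval f s = formal_eval f t) -> \pi_tensor s = \pi_tensor t.
Proof. by move=> h; apply/eqmodP/asboolP. Qed.

Lemma tensor_lift_pi (U : lmodType K) (f : {bilinear V -> W -> U}) s :
  tensor_lift f (\pi_tensor s) = formal_eval f s.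
Proof.
have /eqmodP/asboolP : repr (\pi_tensor s) = s %[mod tensor] by rewrite reprK.
exact.
Qed.

Let scale_formal (a : K) (s : seq (V * W)) := [seq (a *: p.1, p.2) | p <- s].

Lemma formal_eval_cat (U : lmodType K) (f : V -> W -> U) s t :
  formal_eval f (s ++ t) = formal_eval f s + formal_eval f t.
Proof. exact: big_cat. Qed.

Lemma formal_eval_scale (U : lmodType K) (f : {bilinear V -> W -> U}) a s :
  formal_eval f (scale_formal a s) = a *: formal_eval f s.
Proof.
rewrite /formal_eval big_map scaler_sumr; apply: eq_bigr => p _.
exact: linearZl_LR.
Qed.

Definition tensor_zero : tensor := \pi_tensor [::].
Definition tensor_add (x y : tensor) : tensor := \pi_tensor (repr x ++ repr y).
Definition tensor_scale a (x : tensor) : tensor :=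
  \pi_tensor (scale_formal a (repr x)).
Definition tensor_opp (x : tensor) : tensor := tensor_scale (-1) x.

Lemma tensor_ext (x y : tensor) :
  (forall (U : lmodType K) (f : {bilinear V -> W -> U}),
     tensor_lift f x = tensor_lift f y) -> x = y.
Proof. by move=> h; rewrite -[x]reprK -[y]reprK; apply: tensor_eqP. Qed.

Let lift0 (U : lmodType K) (f : {bilinear V -> W -> U}) :
  tensor_lift f tensor_zero = 0.
Proof. by rewrite tensor_lift_pi /formal_eval big_nil. Qed.

Let liftD (U : lmodType K) (f : {bilinear V -> W -> U}) x y :
  tensor_lift f (tensor_add x y) = tensor_lift f x + tensor_lift f y.
Proof. by rewrite tensor_lift_pi formal_eval_cat. Qed.

Let liftZ (U : lmodType K) (f : {bilinear V -> W -> U}) a x :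
  tensor_lift f (tensor_scale a x) = a *: tensor_lift f x.
Proof. by rewrite tensor_lift_pi formal_eval_scale. Qed.

Let tensor_addA : associative tensor_add.
Proof. by move=> x y z; apply: tensor_ext => U f; rewrite !liftD addrA. Qed.
Let tensor_addC : commutative tensor_add.
Proof. by move=> x y; apply: tensor_ext => U f; rewrite !liftD addrC. Qed.
Let tensor_add0 : left_id tensor_zero tensor_add.
Proof. by move=> x; apply: tensor_ext => U f; rewrite liftD lift0 add0r. Qed.
Let tensor_addN : left_inverse tensor_zero tensor_opp tensor_add.
Proof.
by move=> x; apply: tensor_ext => U f; rewrite liftD liftZ lift0 scaleN1r addNr.
Qed.
HB.instance Definition _ :=
  GRing.isZmodule.Build tensor tensor_addA tensor_addC tensor_add0 tensor_addN.

Let tensor_scaleA a b x : tensor_scale a (tensor_scale b x) = tensor_scale (a * b) x.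
Proof. by apply: tensor_ext => U f; rewrite !liftZ scalerA. Qed.
Let tensor_scale1 x : tensor_scale 1 x = x.
Proof. by apply: tensor_ext => U f; rewrite liftZ scale1r. Qed.
Let tensor_scaleDr : right_distributive tensor_scale +%R.
Proof.
by move=> a x y; apply: tensor_ext => U f; rewrite !(liftD, liftZ) scalerDr.
Qed.
Let tensor_scaleDl x : {morph tensor_scale^~ x : a b / a + b}.
Proof.
by move=> a b; apply: tensor_ext => U f; rewrite !(liftD, liftZ) scalerDl.
Qed.
HB.instance Definition _ := GRing.Zmodule_isLmodule.Build K tensor
  tensor_scaleA tensor_scale1 tensor_scaleDr tensor_scaleDl.

Lemma tens_bilinear : bilinear_for *:%R *:%R tens.
Proof.
by split=> [w|v] a x y; apply: tensor_ext => U f;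
  rewrite liftD liftZ !tensor_lift_pi /formal_eval !big_seq1 /= ?linearPl ?linearPr.
Qed.
HB.instance Definition _ := bilinear_isBilinear.Build K V W tensor *:%R *:%R
  tens tens_bilinear.

Section UniversalProperty.
Variables (U : lmodType K) (f : {bilinear V -> W -> U}).

Lemma tensor_liftP : linear (tensor_lift f).
Proof. by move=> a x y; rewrite liftD liftZ. Qed.

Lemma tensor_lift_tens v w : tensor_lift f (tens v w) = f v w.
Proof. by rewrite tensor_lift_pi /formal_eval big_seq1. Qed.

Lemma tensor_lift_unique (g : {linear tensor -> U}) :
  (forall v w, g (tens v w) = f v w) -> g =1 tensor_lift f.
Proof.
move=> gf x; rewrite -[x]reprK tensor_lift_pi.
elim: (repr x) => [|[v w] s ih].
  have -> : \pi_tensor [::] = 0 :> tensor by [].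
  by rewrite linear0 /formal_eval big_nil.
have -> : \pi_tensor ((v, w) :: s) = tens v w + \pi_tensor s.
  apply: tensor_ext => U' f'.
  by rewrite liftD !tensor_lift_pi -formal_eval_cat.
by rewrite linearD gf ih /formal_eval big_cons.
Qed.

End UniversalProperty.
End TensorProduct.

Section Factorization.
Variable F : scalars.

Definition directed (I : Type) (le : I -> I -> Prop) : Prop :=
  [/\ inhabited I,
      forall i, le i i,
      forall i j k, le i j -> le j k -> le i k
    & forall i j, exists2 k, le i k & le j k].

(* The norm on S is the operator norm inherited from B(H). The size 0 is      *)
(* allowed; as v_t is unital this only matters for S = 0.                     *)
Definition CPFP (S : opsys F) : Prop :=
  exists (I : Type) (le : I -> I -> Prop) (n : I -> nat)
         (u : forall t, {linear S -> mx_opsys F (n t)})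
         (v : forall t, {linear mx_opsys F (n t) -> S}),
    [/\ directed le,
        forall t, ucp (u t),
        forall t, ucp (v t)
      & forall (x : S) (e : F), 0 < e ->
          exists t0, forall t, le t0 t ->
            opnorm_le (opsys_op S (v t (u t x) - x)) e].

End Factorization.

Lemma opsys_star_uniq (F : scalars) (V : opsys F) (x y : V) :
  (forall h k, dotp (opsys_space V) (opsys_op V x h) k =
               dotp (opsys_space V) h (opsys_op V y k)) ->
  opsys_star x = y.
Proof.
move=> xy; apply: opsys_op_inj => k; apply/eqP; rewrite -subr_eq0.
set d := _ - _; apply: contraT => /(@neq0_dnorm_gt0 _ _ _ (dotp _)).
have -> : dotp _ d d = dotp _ d (opsys_op V (opsys_star x) k) -
                       dotp _ d (opsys_op V y k) by exact: linearBr.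
by rewrite -opsys_starE xy subrr ltxx.
Qed.

Lemma real_star_linear (R : realType) (V : opsys (realScalars R)) :
  linear (@opsys_star _ V).
Proof.
move=> a x y; apply: opsys_star_uniq => h k.
rewrite [opsys_op _ (a *: x + y) h]linearPl.
rewrite [opsys_op _ (a *: opsys_star x + _) k]linearPl !ipE.
by congr (_ * _ + _); exact: opsys_starE.
Qed.

Section TensorCones.
Variables (R : realType) (V W : opsys (realScalars R)).
Local Notation "V *o W" := (tensor V W) (at level 40).

Definition tensor_unit : V *o W := tens (opsys_unit V) (opsys_unit W).

Definition tensor_star : V *o W -> V *o W :=
  tensor_lift (fun v w => tens (opsys_star v) (opsys_star w)).

(* phi (x) psi, with M_m(R) (x) M_k(R) identified with M_{mk}(R) by the       *)
(* Kronecker product.                                                         *)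
Definition tensor_map m k (phi : V -> 'M[R]_m) (psi : W -> 'M[R]_k) :
    V *o W -> 'M[R]_(m * k) :=
  tensor_lift (fun v w => phi v *t psi w).

Lemma tensor_star_tens v w :
  tensor_star (tens v w) = tens (opsys_star v) (opsys_star w).
Proof.
pose f (v : V) (w : W) : V *o W := tens (opsys_star v) (opsys_star w).
have f_bilinear : bilinear_for *:%R *:%R f.
  by split=> [w'|v'] a x y; rewrite /f real_star_linear ?linearPl ?linearPr.
pose fM := bilinear_isBilinear.Build R V W (V *o W) *:%R *:%R f f_bilinear.
pose fB : {bilinear V -> W -> V *o W} := HB.pack f fM.
exact: (tensor_lift_tens fB).
Qed.

Lemma tensor_map_tens m k (phi : {linear V -> 'M[R]_m})
    (psi : {linear W -> 'M[R]_k}) v w :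
  tensor_map phi psi (tens v w) = phi v *t psi w.
Proof.
pose f (v : V) (w : W) : 'M[R]_(m * k) := phi v *t psi w.
have f_bilinear : bilinear_for *:%R *:%R f.
  by split=> [w'|v'] a x y; rewrite /f linearP; apply/matrixP => i j;
    rewrite !mxE; ring.
pose fM := bilinear_isBilinear.Build R V W 'M[R]_(m * k) *:%R *:%R f f_bilinear.
pose fB : {bilinear V -> W -> 'M[R]_(m * k)} := HB.pack f fM.
exact: (tensor_lift_tens fB).
Qed.

Definition tens_mx p q (A : 'M[V]_p) (B : 'M[W]_q) : 'M[V *o W]_(p * q) :=
  \matrix_(i, j) tens (A (mxtens_unindex i).1 (mxtens_unindex j).1)
                      (B (mxtens_unindex i).2 (mxtens_unindex j).2).

(* alpha^T X alpha *)
Definition compress N n (alpha : 'M[R]_(N, n)) (X : 'M[V *o W]_N) :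
    'M[V *o W]_n :=
  \matrix_(i, j) \sum_k \sum_l (alpha k i * alpha l j) *: X k l.

Definition min_cone n (x : 'M[V *o W]_n) : Prop :=
  forall m k (phi : {linear V -> mx_opsys (realScalars R) m})
             (psi : {linear W -> mx_opsys (realScalars R) k}),
    ucp phi -> ucp psi ->
    @poscone _ (mx_opsys (realScalars R) (m * k)) n (map_mx (tensor_map phi psi) x).

Definition max_cone n (x : 'M[V *o W]_n) : Prop :=
  (forall i j, tensor_star (x i j) = x j i) /\
  forall e : R, 0 < e ->
    exists (r : nat) (p q : 'I_r -> nat)
           (A : forall l, 'M[V]_(p l)) (B : forall l, 'M[W]_(q l))
           (alpha : 'M[R]_(\sum_l (p l * q l), n)),
      (forall l, poscone (A l) /\ poscone (B l)) /\
      x + (e *: tensor_unit)%:M =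
        compress alpha (\mxdiag_l tens_mx (A l) (B l)).

Definition min_eq_max : Prop :=
  forall n (x : 'M[V *o W]_n), min_cone x <-> max_cone x.

End TensorCones.

(* Main.v *)
(* (a) => (b) => (a) complexify u_t and v_t, respectively view M_n(C) inside      *)
(* M_2n(R) and take real parts. (a) => (c): id - v_t u_t is small on the finitely *)
(* many elements of S occurring in a min-positive x, so x is up to a small error  *)
(* (v_t u_t (x) id)(x), which is a single term [v_t(E_ab)] (x) (u_t (x) id)(x).   *)
(* (d) => (a): a finite-dimensional subsystem E of S has a dual operator system,  *)
(* realized by letting functionals act entrywise on the positive matrices X over  *)
(* E normalized by delta(X) = 1, for a faithful vector functional delta. The      *)
(* inclusion of E in S is a positive element of S (x)_min E^*, hence approximable *)
(* by elements of the max cone, which are maps E -> M_q -> S. A positive          *)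
(* matrix over E^* is a limit of compressions x |-> (<x h_q, h_p>), which are     *)
(* defined on all of S; orthonormalizing the h_p makes them unital, and a small   *)
(* perturbation makes M_q -> S unital.                                            *)

Require Import Defs.
From HB Require Import structures.
From mathcomp Require Import all_boot all_order all_algebra.
From mathcomp Require Import ring lra.
From mathcomp Require Import complex mxtens.
From mathcomp Require Import boolp classical_sets reals.

Set Implicit Arguments.
Unset Strict Implicit.
Unset Printing Implicit Defensive.

Import Order.TTheory GRing.Theory Num.Theory.

Local Open Scope ring_scope.

(** (a) and (b). Maps [u] and [v] complexify entrywise. Conversely M_n(C) sits in M_2n(R) as the
    matrices [[x, -y], [y, x]], averaging over a rotation is a completely positive left inverse of
    this inclusion, and taking real parts is completely positive ([CPFP_complexification],
    [CPFP_of_complexification]).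

    (a) to (c). The max cone always lies in the min cone, since ucp maps carry products of positive
    matrices to Kronecker products of psd matrices ([max_cone_min_cone]). Let [x] be min-positive
    and v u close to the identity. Expanding in matrix units, (v u ⊗ id)(x) is a single product of
    the positive matrices [v(E_ab)] and (u ⊗ id)(x) ([min_cone_factor]). What is left is a
    selfadjoint tensor whose left legs are small in norm. A norm bound is positivity of the matrix
    [[c, v], [v^*, c]], and the product of two such matrices shows that a small multiple of the unit
    makes the remainder a sum of products ([max_sum_error]).

    (d) to (a). Finitely many elements lie in a finite-dimensional subsystem E. Its dual E' becomes
    an operator system by letting a functional f act as f(X), entrywise, on the Hilbert sum over all
    positive matrices X over E normalized by a sum δ of vector functionals; δ is the unit. The
    tensor in S ⊗ E' of the inclusion of E is min-positive, because a ucp map on E' into M_k(R) is a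
    positive matrix over E. By (d) it is max-positive: x + ε δ(x) 1 is a sum of terms B_pr(x) D_pr
    with B and D positive over E' and S ([identity_approximable]). The functionals B_pr live on E
    only. A separation argument shows that B is a limit of sums of matrices (<x h_r, h_p>), which
    make sense on all of S ([dual_kernel_approx]); this takes the place of an extension theorem.
    Orthonormalizing the h_p makes the map into matrices ucp, and adding a small positive element to
    the Choi matrix of the map back, followed by a rescaling, makes that one ucp ([sub_state_ucp]).
    Finite sets and tolerances index the net ([CPFP_of_min_eq_max]). *)

Lemma quad_discr (R : realFieldType) (a b c : R) :
  (forall s t, 0 <= a * s ^+ 2 + (b * s * t) *+ 2 + c * t ^+ 2) ->
  b ^+ 2 <= a * c.
Proof.
(* The value at [(c, - b)] is [c * (a * c - b ^+ 2)], which settles [0 < c]; when [c = 0], the value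
   at [(b, - (a + 1))] is [- (a + 2) * b ^+ 2], which forces [b = 0]. *)
move=> h; have a0 := h 1 0; have c0 := h 0 1; have h1 := h c (- b).
have h2 := h b (- (a + 1)).
have {}a0 : 0 <= a by lra.
have {}c0 : 0 <= c by lra.
have [c1|c1] := ltP 0 c; first by rewrite -subr_ge0 -(pmulr_rge0 _ c1); nra.
have c2 : c = 0 by apply/eqP; rewrite eq_le c1 c0.
subst c; nra.
Qed.

(** * Linear maps out of the algebraic tensor product *)

Section Linear.
Variable K : fieldType.

(** Packs a proof of linearity into a structure; the existential form lets new linear maps be
    introduced in the middle of a proof. *)
Lemma linear_witness (U V : lmodType K) (f : U -> V) :
  linear f -> exists g : {linear U -> V}, g =1 f.
Proof.
move=> lf; pose fM := GRing.isLinear.Build K U V *:%R f lf.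
by pose g : {linear U -> V} := HB.pack f fM; exists g.
Qed.

Variables (V W U : lmodType K).

Lemma tensor_lift_witness (f : V -> W -> U) :
  (forall w, linear (f^~ w)) -> (forall v, linear (f v)) ->
  exists g : {linear tensor V W -> U}, forall v w, g (tens v w) = f v w.
Proof.
move=> f1 f2; have fb : bilinear_for *:%R *:%R f by split.
pose fM := bilinear_isBilinear.Build K V W U *:%R *:%R f fb.
pose fB : {bilinear V -> W -> U} := HB.pack f fM.
have [g gE] := linear_witness (tensor_liftP fB).
by exists g => v w; rewrite gE; exact: tensor_lift_tens.
Qed.

Lemma tensor_sum (x : tensor V W) : exists s : seq (V * W),
  x = \sum_(p <- s) tens p.1 p.2.
Proof.
exists (repr x); rewrite -{1}[x]reprK.
elim: (repr x) => [|[v w] s ih]; first by rewrite big_nil.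
rewrite big_cons -ih; apply: tensor_ext => U' f'.
rewrite -[tens _ _]scale1r tensor_liftP scale1r !tensor_lift_pi.
by rewrite -formal_eval_cat.
Qed.

Lemma tensor_linear_eq (f g : {linear tensor V W -> U}) :
  (forall v w, f (tens v w) = g (tens v w)) -> f =1 g.
Proof.
move=> fg x; have [s ->] := tensor_sum x; rewrite !linear_sum.
by apply: eq_bigr.
Qed.

Lemma tensDl v v' (w : W) : tens (v + v') w = tens v w + tens v' w :> tensor V W.
Proof. exact: linearDl. Qed.
Lemma tensZl a v (w : W) : tens (a *: v) w = a *: tens v w :> tensor V W.
Proof. exact: linearZl_LR. Qed.
Lemma tensDr v (w w' : W) : tens v (w + w') = tens v w + tens v w' :> tensor V W.
Proof. exact: linearDr. Qed.
Lemma tensZr a v (w : W) : tens v (a *: w) = a *: tens v w :> tensor V W.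
Proof. exact: linearZr_LR. Qed.
Lemma tensNl v (w : W) : tens (- v) w = - tens v w :> tensor V W.
Proof. exact: linearNl. Qed.
Lemma tensNr v (w : W) : tens v (- w) = - tens v w :> tensor V W.
Proof. exact: linearNr. Qed.
Lemma tens0l (w : W) : tens 0 w = 0 :> tensor V W.
Proof. exact: linear0l. Qed.
Lemma tens_suml I (r : seq I) (P : pred I) (F : I -> V) (w : W) :
  tens (\sum_(i <- r | P i) F i) w = \sum_(i <- r | P i) tens (F i) w :> tensor V W.
Proof. exact: linear_sumlz. Qed.
Lemma tens_sumr I (r : seq I) (P : pred I) (F : I -> W) (v : V) :
  tens v (\sum_(i <- r | P i) F i) = \sum_(i <- r | P i) tens v (F i) :> tensor V W.
Proof. exact: linear_sumr. Qed.

End Linear.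

Lemma sum_pair (U : nmodType) (I J : finType) (F : I * J -> U) :
  \sum_k F k = \sum_i \sum_j F (i, j).
Proof. by rewrite (pair_bigA _ (fun i j => F (i, j))); apply: eq_bigr => -[]. Qed.

Lemma sum_delta (K : pzRingType) (U : lmodType K) (I : finType) (i : I) (F : I -> U) :
  \sum_k (k == i)%:R *: F k = F i.
Proof.
rewrite (bigD1 i) //= eqxx scale1r big1 ?addr0 // => k /negbTE->.
by rewrite scale0r.
Qed.

(** * Real Hilbert spaces and positive semidefinite kernels *)

Section RealHilbert.
Variables (R : realType) (H : hilbert (realScalars R)).
Local Notation ip := (dotp H : H -> H -> R).

Lemma ip0l (x : H) : ip 0 x = 0. Proof. exact: linear0l. Qed.
Lemma ip0r (x : H) : ip x 0 = 0. Proof. exact: linear0r. Qed.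

Lemma ip_suml I (r : seq I) (P : pred I) (F : I -> H) (x : H) :
  ip (\sum_(i <- r | P i) F i) x = \sum_(i <- r | P i) ip (F i) x.
Proof.
by elim/big_rec2: _ => [|i y z _ <-]; rewrite ?ip0l ?ipDl.
Qed.

Lemma ip_sumr I (r : seq I) (P : pred I) (F : I -> H) (x : H) :
  ip x (\sum_(i <- r | P i) F i) = \sum_(i <- r | P i) ip x (F i).
Proof.
by elim/big_rec2: _ => [|i y z _ <-]; rewrite ?ip0r ?ipDr.
Qed.

Lemma ip_eq0 (x : H) : ip x x = 0 -> x = 0.
Proof.
have [//|/(@neq0_dnorm_gt0 _ _ _ (dotp H)) h e] := eqVneq x 0.
by move: h; rewrite [X in 0 < X]e ltxx.
Qed.

Lemma ip_cauchy (x y : H) : ip x y ^+ 2 <= ip x x * ip y y.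
Proof.
apply: quad_discr => s t; have := ip_ge0 (s *: x + t *: y).
by rewrite !ipE (ipC y x); congr (_ <= _); ring.
Qed.

Definition orthonormal m (e : 'I_m -> H) := forall i j, ip (e i) (e j) = (i == j)%:R.

(** The family [h] may be dependent: a vector whose residual [g] vanishes adds no new direction,
    which is why the length [m] is existential. Orthonormality is what later makes compressions
    unital. *)
Lemma gram_schmidt n (h : 'I_n -> H) :
  exists m (e : 'I_m -> H), orthonormal e /\
    exists c : 'I_n -> 'I_m -> R, forall i, h i = \sum_j c i j *: e j.
Proof.
elim: n h => [|n ih] h.
  exists 0, (fun=> 0); split; first by case.
  by exists (fun _ _ => 0) => -[].
have [m [e [oe [c hc]]]] := ih (fun i => h (lift ord0 i)).
pose d j := ip (h ord0) (e j).
pose g := h ord0 - \sum_j d j *: e j.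
have ge j : ip g (e j) = 0.
  rewrite ipDl ipNl ip_suml (bigD1 j) //= ipZl oe eqxx mulr1 big1 ?addr0 ?subrr //.
  by move=> i ij; rewrite ipZl oe (negbTE ij) mulr0.
have [g0|g0] := eqVneq g 0.
  exists m, e; split=> //.
  exists (fun i => if unlift ord0 i is Some k then c k else d) => i.
  case: unliftP => [k ->|->]; first exact: hc.
  by apply/eqP; rewrite -subr_eq0; apply/eqP.
pose r := Num.sqrt (ip g g).
have r0 : 0 < ip g g by exact: (@neq0_dnorm_gt0 _ _ _ (dotp H)).
have rr : r ^+ 2 = ip g g by rewrite sqr_sqrtr // ltW.
have rn0 : r != 0 by rewrite gt_eqF // sqrtr_gt0.
exists m.+1, (fun i => if unlift ord0 i is Some k then e k else r^-1 *: g); split.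
  move=> i j; case: unliftP => [k ->|->]; case: unliftP => [l ->|->].
  - by rewrite oe (inj_eq lift_inj).
  - by rewrite ipZr ipC ge mulr0.
  - by rewrite ipZl ge mulr0.
  - by rewrite ipZl ipZr -rr eqxx expr2 mulKf // mulVf.
exists (fun i => if unlift ord0 i is Some k
   then fun j => if unlift ord0 j is Some l then c k l else 0
   else fun j => if unlift ord0 j is Some l then d l else r) => i.
rewrite big_ord_recl unlift_none.
case: unliftP => [k ->|->]; rewrite ?unlift_none ?scale0r ?add0r.
  by rewrite hc; apply: eq_bigr => j _; rewrite liftK.
rewrite scalerA mulfV // scale1r -[LHS](subrK (\sum_j d j *: e j)).
by congr (_ + _); apply: eq_bigr => j _; rewrite liftK.
Qed.

End RealHilbert.

Section RealPsd.
Variable R : realType.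

Definition psd (I : finType) (K : I -> I -> R) : Prop :=
  (forall i j, K i j = K j i) /\
  forall y : I -> R, 0 <= \sum_i \sum_j K i j * y j * y i.

(** Cholesky factorization: split off the first row and factor the Schur complement. Gram factors
    then reduce most closure properties of psd kernels to rearrangements of sums. *)
Lemma psd_mx_factor n (M : 'M[R]_n) :
  psd (fun i j => M i j) -> exists G : 'M[R]_n, M = G^T *m G.
Proof.
elim: n M => [|n ih] M [sM pM]; first by exists 0; apply/matrixP => -[].
rewrite -[n.+1]/(1 + n)%N in M sM pM *.
pose a := M 0 0; pose b j := M 0 (rshift 1 j).
have ordE : lshift n 0 = 0 :> 'I_(1 + n) by apply: val_inj.
pose ext s (y : 'I_n -> R) (k : 'I_(1 + n)) : R :=
  match split k with inl _ => s | inr k => y k end.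
have form s y : 0 <= a * s ^+ 2 + (\sum_j b j * y j) * s *+ 2 +
    \sum_i \sum_j M (rshift 1 i) (rshift 1 j) * y j * y i.
  have := pM (ext s y).
  rewrite big_split_ord big_ord1 /= !big_split_ord /= !big_ord1.
  rewrite /ext (unsplitK (inl 0)) ordE -/a.
  have -> : \sum_(i < n) M 0 (rshift 1 i) *
     (match split (rshift 1 i) with inl _ => s | inr k => y k end) * s =
     (\sum_j b j * y j) * s.
    by rewrite mulr_suml; apply: eq_bigr => j _; rewrite (unsplitK (inr j)).
  under [X in _ <= _ + X -> _]eq_bigr => i _ do
    rewrite big_split_ord big_ord1 /= (unsplitK (inl 0)) (unsplitK (inr i)) ordE.
  rewrite big_split /=.
  have -> : \sum_(i < n) M (rshift 1 i) 0 * s * y i = (\sum_j b j * y j) * s.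
    by rewrite mulr_suml; apply: eq_bigr => j _; rewrite sM -/(b j) mulrAC.
  have -> : \sum_(i < n) \sum_(j < n) M (rshift 1 i) (rshift 1 j) *
     (match split (rshift 1 j) with inl _ => s | inr k => y k end) * y i =
     \sum_i \sum_j M (rshift 1 i) (rshift 1 j) * y j * y i.
    by apply: eq_bigr => i _; apply: eq_bigr => j _; rewrite (unsplitK (inr j)).
  by congr (_ <= _); rewrite mulr2n; ring.
have a0 : 0 <= a.
  have := form 1 (fun=> 0); rewrite !big1 => [||j _]; last by rewrite mulr0.
    by rewrite expr1n mulr1 mul0r mul0rn !addr0.
  by move=> i _; rewrite big1 // => j _; rewrite mulr0.
(* A zero corner forces its whole row to vanish, by the discriminant bound for the form in the first
   coordinate and coordinate [j]. *)
have [ag0|] := ltP 0 a; last first.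
  move=> an0; have {a0 an0} az : a = 0 by apply/eqP; rewrite eq_le an0 a0.
  have b0 j : b j = 0.
    pose C := M (rshift 1 j) (rshift 1 j).
    have hb : b j ^+ 2 <= a * C.
      apply: quad_discr => s t; have := form s (fun k => (k == j)%:R * t).
      rewrite (bigD1 j) //= eqxx big1 ?addr0 => [|k /negbTE->]; last by rewrite mul0r mulr0.
      rewrite (bigD1 j) //= [X in _ <= _ + (_ + X)]big1 => [|i /negbTE->]; last first.
        by rewrite big1 // => k _; rewrite mul0r mulr0.
      rewrite (bigD1 j) //= eqxx big1 => [|i /negbTE->]; last by rewrite mul0r mulr0 mul0r.
      by rewrite -/C /=; congr (_ <= _); rewrite ?mulr1n mulr2n; ring.
    by apply/eqP; rewrite -sqrf_eq0 eq_le sqr_ge0 andbT (le_trans hb) // az mul0r.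
  have [|G GE] := ih (\matrix_(i, j) M (rshift 1 i) (rshift 1 j)).
    split=> [i j|y]; first by rewrite !mxE sM.
    have := form 0 y; rewrite expr0n mulr0 mulr0 mul0rn !add0r.
    by congr (_ <= _); apply: eq_bigr => i _; apply: eq_bigr => j _; rewrite mxE.
  exists (block_mx 0 0 0 G); rewrite tr_block_mx mulmx_block !trmx0.
  rewrite !mul0mx !mulmx0 !addr0 !add0r -GE.
  rewrite -[LHS]submxK; congr block_mx; apply/matrixP => i j; rewrite !mxE ?ord1 ?ordE.
  - exact: az.
  - exact: b0.
  - by rewrite sM; exact: b0.
  - by [].
pose r := Num.sqrt a; have rr : r ^+ 2 = a by rewrite sqr_sqrtr.
have r0 : r != 0 by rewrite gt_eqF // sqrtr_gt0.
have [|G GE] := ih (\matrix_(i, j) (M (rshift 1 i) (rshift 1 j) - b i * b j / a)).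
  split=> [i j|y]; first by rewrite !mxE sM [b i * _]mulrC.
  pose B := \sum_j b j * y j.
  (* This value of [s] minimizes the form in its first coordinate; the minimum is the form of the
     Schur complement. *)
  have := form (- B / a) y; rewrite -/B.
  have -> : a * (- B / a) ^+ 2 + (B * (- B / a)) *+ 2 = - (B ^+ 2 / a).
    by rewrite mulr2n; field; rewrite gt_eqF.
  have -> : B ^+ 2 / a = \sum_i \sum_j b i * b j / a * y j * y i.
    rewrite expr2 {1}/B !mulr_suml; apply: eq_bigr => i _.
    by rewrite /B mulr_sumr mulr_suml; apply: eq_bigr => j _; ring.
  congr (_ <= _); rewrite addrC -sumrB; apply: eq_bigr => i _.
  by rewrite -sumrB; apply: eq_bigr => j _; rewrite mxE; ring.
exists (block_mx r%:M (\row_j (b j / r)) 0 G).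
rewrite tr_block_mx mulmx_block !trmx0 tr_scalar_mx.
rewrite !mul0mx !mulmx0 !addr0 -GE.
rewrite -[LHS]submxK; congr block_mx; apply/matrixP => i j.
- by rewrite !mxE big_ord1 !mxE !ord1 !ordE /= !mulr1n -expr2 rr.
- by rewrite mul_scalar_mx !mxE !ord1 ordE -/(b j); field.
- by rewrite mul_mx_scalar !mxE !ord1 ordE sM -/(b i); field.
- by rewrite !mxE big_ord1 !mxE -rr; field.
Qed.

Lemma psd_factor (I : finType) (K : I -> I -> R) : psd K ->
  exists G : I -> I -> R, forall i j, K i j = \sum_k G k i * G k j.
Proof.
move=> [sK pK]; pose M := \matrix_(i < #|I|, j < #|I|) K (enum_val i) (enum_val j).
have [|G GE] := @psd_mx_factor _ M.
  split=> [i j|y]; first by rewrite !mxE.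
  have := pK (fun i => y (enum_rank i)).
  rewrite (reindex _ (onW_bij _ (@enum_val_bij I))).
  congr (_ <= _); apply: eq_bigr => i _.
  rewrite (reindex _ (onW_bij _ (@enum_val_bij I))).
  by apply: eq_bigr => j _; rewrite !mxE !enum_valK.
exists (fun i j => G (enum_rank i) (enum_rank j)) => i j.
have := congr1 (fun A : 'M_#|I| => A (enum_rank i) (enum_rank j)) GE.
rewrite !mxE !enum_rankK => ->.
rewrite [RHS](reindex _ (onW_bij _ (@enum_val_bij I))).
by apply: eq_bigr => k _; rewrite !mxE enum_valK.
Qed.

End RealPsd.

Section PsdTheory.
Variable R : realType.

Lemma psd_gram (T I : finType) (G : T -> I -> R) :
  psd (fun i j => \sum_t G t i * G t j).
Proof.
split=> [i j|y]; first by apply: eq_bigr => t _; rewrite mulrC.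
have -> : \sum_i \sum_j (\sum_t G t i * G t j) * y j * y i =
    \sum_t (\sum_i G t i * y i) ^+ 2.
  rewrite [RHS](eq_bigr (fun t => \sum_i \sum_j G t i * G t j * y j * y i)).
    rewrite [RHS]exchange_big; apply: eq_bigr => i _ /=.
    rewrite [RHS]exchange_big; apply: eq_bigr => j _ /=.
    by rewrite !mulr_suml.
  move=> t _; rewrite expr2 mulr_suml; apply: eq_bigr => i _.
  by rewrite mulr_sumr; apply: eq_bigr => j _; ring.
by apply: sumr_ge0 => t _; exact: sqr_ge0.
Qed.

Lemma eq_psd (I : finType) (K L : I -> I -> R) :
  (forall i j, K i j = L i j) -> psd K -> psd L.
Proof. by move=> KL; have -> : L = K by apply/funext=> i; apply/funext => j. Qed.

Lemma psd_reindex (I J : finType) (f : J -> I) (K : I -> I -> R) :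
  psd K -> psd (fun i j => K (f i) (f j)).
Proof.
move=> /psd_factor[G GE]; apply: eq_psd (psd_gram (fun t j => G t (f j))) => i j.
by rewrite GE.
Qed.

(** Gram factors multiply: the product kernel has the Gram factors [G t i * F u i]. *)
Lemma psd_schur (I : finType) (K L : I -> I -> R) :
  psd K -> psd L -> psd (fun i j => K i j * L i j).
Proof.
move=> /psd_factor[G GE] /psd_factor[F FE].
apply: eq_psd (psd_gram (fun (t : I * I) i => G t.1 i * F t.2 i)) => i j.
rewrite GE FE mulr_suml sum_pair.
by apply: eq_bigr => t _; rewrite mulr_sumr; apply: eq_bigr => u _ /=; ring.
Qed.

Lemma psd_compress (I J : finType) (c : I -> J -> R) (K : I -> I -> R) :
  psd K -> psd (fun i j => \sum_k \sum_l c k i * c l j * K k l).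
Proof.
move=> /psd_factor[G GE].
apply: eq_psd (psd_gram (fun t j => \sum_k c k j * G t k)) => i j.
under eq_bigr do rewrite mulr_suml.
rewrite exchange_big; apply: eq_bigr => k _ /=.
under eq_bigr do rewrite mulr_sumr.
rewrite exchange_big; apply: eq_bigr => l _ /=.
by rewrite GE mulr_sumr; apply: eq_bigr => t _; ring.
Qed.

Lemma psd_diag (I : finType) (c : I -> R) :
  (forall i, 0 <= c i) -> psd (fun i j => (i == j)%:R * c i).
Proof.
move=> c0; split=> [i j|y]; first by rewrite eq_sym; case: eqP => [->|] //; rewrite !mul0r.
apply: sumr_ge0 => i _; rewrite (bigD1 i) //= big1 ?addr0 => [|j /negbTE ij].
  by rewrite eqxx mul1r -mulrA -expr2 mulr_ge0 ?sqr_ge0.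
by rewrite eq_sym ij !mul0r.
Qed.

Lemma psd_sum (T I : finType) (K : T -> I -> I -> R) :
  (forall t, psd (K t)) -> psd (fun i j => \sum_t K t i j).
Proof.
move=> pK; split=> [i j|y]; first by apply: eq_bigr => t _; rewrite (pK t).1.
have -> : \sum_i \sum_j (\sum_t K t i j) * y j * y i =
    \sum_t \sum_i \sum_j K t i j * y j * y i.
  rewrite [RHS]exchange_big; apply: eq_bigr => i _ /=.
  rewrite [RHS]exchange_big; apply: eq_bigr => j _ /=.
  by rewrite !mulr_suml.
by apply: sumr_ge0 => t _; exact: (pK t).2.
Qed.

End PsdTheory.

(** * Positive kernels over a real operator system *)

Section RealSystem.
Variables (R : realType) (V : opsys (realScalars R)).
Local Notation H := (opsys_space V).
Local Notation ip := (dotp H : H -> H -> R).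
Local Notation op := (opsys_op V : V -> H -> H).
Local Notation star := (@opsys_star _ V : V -> V).
Local Notation unit := (opsys_unit V : V).

Lemma opDl x y h : op (x + y) h = op x h + op y h. Proof. exact: linearDl. Qed.
Lemma opDr x h k : op x (h + k) = op x h + op x k. Proof. exact: linearDr. Qed.
Lemma opNl x h : op (- x) h = - op x h. Proof. exact: linearNl. Qed.
Lemma opNr x h : op x (- h) = - op x h. Proof. exact: linearNr. Qed.
Lemma opZl (a : R) x h : op (a *: x) h = a *: op x h. Proof. exact: linearZl_LR. Qed.
Lemma opZr (a : R) x h : op x (a *: h) = a *: op x h. Proof. exact: linearZr_LR. Qed.
Lemma op0l h : op 0 h = 0. Proof. exact: linear0l. Qed.
Lemma op0r x : op x 0 = 0. Proof. exact: linear0r. Qed.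
Lemma op_suml I (r : seq I) (P : pred I) (F : I -> V) h :
  op (\sum_(i <- r | P i) F i) h = \sum_(i <- r | P i) op (F i) h.
Proof. exact: linear_sumlz. Qed.
Lemma op_sumr I (r : seq I) (P : pred I) (F : I -> H) x :
  op x (\sum_(i <- r | P i) F i) = \sum_(i <- r | P i) op x (F i).
Proof. exact: linear_sumr. Qed.
Definition opE := (opDl, opDr, opNl, opNr, opZl, opZr).

Lemma ip_star x h k : ip (op x h) k = ip h (op (star x) k).
Proof. exact (opsys_starE x h k). Qed.

Lemma starP (a : R) x y : star (a *: x + y) = a *: star x + star y.
Proof. exact: real_star_linear. Qed.
Lemma star0 : star 0 = 0.
Proof. by have := starP (-1) 0 0; rewrite scaleN1r addNr scaleN1r addNr. Qed.
Lemma starD x y : star (x + y) = star x + star y.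
Proof. by have := starP 1 x y; rewrite !scale1r. Qed.
Lemma starZ (a : R) x : star (a *: x) = a *: star x.
Proof. by have := starP a x 0; rewrite star0 !addr0. Qed.
Lemma starK x : star (star x) = x.
Proof. by apply: opsys_star_uniq => h k; rewrite ipC [RHS]ipC ip_star. Qed.
Lemma star_unit : star unit = unit.
Proof. by apply: opsys_star_uniq => h k; rewrite !opsys_unitE. Qed.
Lemma star_sum I (r : seq I) (P : pred I) (F : I -> V) :
  star (\sum_(i <- r | P i) F i) = \sum_(i <- r | P i) star (F i).
Proof. by elim/big_rec2: _ => [|i y z _ <-]; rewrite ?star0 ?starD. Qed.

Lemma op_form_inj x y : (forall h k, ip (op x h) k = ip (op y h) k) -> x = y.
Proof.
move=> xy; apply: opsys_op_inj => h; apply/eqP; rewrite -subr_eq0; apply/eqP.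
apply: (@ip_eq0 _ H); rewrite ipDl ipNl; apply/eqP; rewrite subr_eq0; apply/eqP.
exact: xy.
Qed.

Lemma op_form_sum m (e : 'I_m -> H) (c d : 'I_m -> R) x :
  ip (op x (\sum_j c j *: e j)) (\sum_i d i *: e i) =
  \sum_i \sum_j c j * d i * ip (op x (e j)) (e i).
Proof.
rewrite ip_sumr; apply: eq_bigr => i _; rewrite op_sumr ip_suml.
by apply: eq_bigr => j _; rewrite opZr ipZl ipZr; ring.
Qed.

(** [poscone] over an arbitrary finite index type, so that amplifications are kernels on product
    types, without arithmetic on ordinals. *)
Definition pos_kernel (I : finType) (X : I -> I -> V) : Prop :=
  (forall i j, star (X i j) = X j i) /\
  forall h : I -> H, 0 <= \sum_i \sum_j ip (op (X i j) (h j)) (h i).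

Lemma poscone_kernel n (X : 'M[V]_n) : poscone X <-> pos_kernel (fun i j => X i j).
Proof. by []. Qed.

Lemma eq_pos_kernel (I : finType) (X Y : I -> I -> V) :
  (forall i j, X i j = Y i j) -> pos_kernel X -> pos_kernel Y.
Proof. by move=> XY; have -> : Y = X by apply/funext=> i; apply/funext => j. Qed.

Lemma pos_kernel_compress (I J : finType) (c : I -> J -> R) (X : I -> I -> V) :
  pos_kernel X -> pos_kernel (fun i j => \sum_k \sum_l (c k i * c l j) *: X k l).
Proof.
move=> [sX pX]; split=> [i j|h].
  rewrite star_sum exchange_big; apply: eq_bigr => k _ /=.
  by rewrite star_sum; apply: eq_bigr => l _ /=; rewrite starZ sX mulrC.
have := pX (fun k => \sum_j c k j *: h j); congr (_ <= _).
rewrite [LHS](eq_bigr (fun k => \sum_i \sum_j \sum_l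
    c k i * c l j * ip (op (X k l) (h j)) (h i))).
  rewrite exchange_big; apply: eq_bigr => i _ /=.
  rewrite exchange_big; apply: eq_bigr => j _ /=.
  rewrite op_suml ip_suml; apply: eq_bigr => k _.
  by rewrite op_suml ip_suml; apply: eq_bigr => l _; rewrite opZl ipZl.
move=> k _; rewrite exchange_big /=.
under [RHS]eq_bigr do rewrite exchange_big /=.
rewrite [RHS]exchange_big /=; rewrite [RHS]exchange_big /=.
rewrite exchange_big /=; apply: eq_bigr => l _.
rewrite op_sumr ip_suml; apply: eq_bigr => j _.
rewrite ip_sumr; apply: eq_bigr => i _.
by rewrite opZr ipZl ipZr; ring.
Qed.

(** The map [f] may repeat or drop indices: reindexing is compression by a 0/1 matrix. *)
Lemma pos_kernel_reindex (I J : finType) (f : J -> I) (X : I -> I -> V) :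
  pos_kernel X -> pos_kernel (fun i j => X (f i) (f j)).
Proof.
move=> pX; apply: eq_pos_kernel (pos_kernel_compress (fun k i => (k == f i)%:R) pX).
move=> i j; rewrite (bigD1 (f i)) //= [X in _ + X]big1 ?addr0; last first.
  by move=> k /negbTE->; rewrite big1 // => l _; rewrite mul0r scale0r.
rewrite (bigD1 (f j)) //= big1 ?addr0 => [|k /negbTE->].
  by rewrite !eqxx mulr1 scale1r.
by rewrite mulr0 scale0r.
Qed.

Lemma pos_kernel_sum (T I : finType) (X : T -> I -> I -> V) :
  (forall t, pos_kernel (X t)) -> pos_kernel (fun i j => \sum_t X t i j).
Proof.
move=> pX; split=> [i j|h].
  by rewrite star_sum; apply: eq_bigr => t _; rewrite (pX t).1.
have -> : \sum_i \sum_j ip (op (\sum_t X t i j) (h j)) (h i) =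
    \sum_t \sum_i \sum_j ip (op (X t i j) (h j)) (h i).
  rewrite [RHS]exchange_big; apply: eq_bigr => i _ /=.
  rewrite [RHS]exchange_big; apply: eq_bigr => j _ /=.
  by rewrite op_suml ip_suml.
by apply: sumr_ge0 => t _; exact: (pX t).2.
Qed.

Lemma pos_kernelD (I : finType) (X Y : I -> I -> V) :
  pos_kernel X -> pos_kernel Y -> pos_kernel (fun i j => X i j + Y i j).
Proof.
move=> pX pY.
apply: eq_pos_kernel (@pos_kernel_sum bool I (fun b => if b then X else Y) _).
  by move=> i j; rewrite big_bool.
by case.
Qed.

(** Each Gram term [G t i * G t j] of [K] compresses [X] by a diagonal matrix, and positive kernels
    are closed under sums. *)
Lemma pos_kernel_schur (I : finType) (K : I -> I -> R) (X : I -> I -> V) :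
  psd K -> pos_kernel X -> pos_kernel (fun i j => K i j *: X i j).
Proof.
move=> /psd_factor[G GE] pX.
have pt t : pos_kernel (fun i j => (G t i * G t j) *: X i j).
  apply: eq_pos_kernel (pos_kernel_compress (fun k i => (k == i)%:R * G t i) pX).
  move=> i j; rewrite (bigD1 i) //= [X in _ + X]big1 ?addr0; last first.
    by move=> k /negbTE->; rewrite big1 // => l _; rewrite !mul0r scale0r.
  rewrite (bigD1 j) //= big1 ?addr0 => [|k /negbTE->].
    by rewrite !eqxx !mul1r.
  by rewrite mul0r mulr0 scale0r.
apply: eq_pos_kernel (pos_kernel_sum pt) => i j.
by rewrite GE scaler_suml.
Qed.

(* Choi: [D >= 0] makes [K |-> sum_pq K_pq D_pq] completely positive. *)
Lemma pos_kernel_choi (I J : finType) (K : I * J -> I * J -> R) (D : J -> J -> V) :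
  psd K -> pos_kernel D ->
  pos_kernel (fun i j => \sum_p \sum_q K (i, p) (j, q) *: D p q).
Proof.
move=> pK pD.
have pS := pos_kernel_schur pK (pos_kernel_reindex (@snd I J) pD).
apply: eq_pos_kernel (pos_kernel_compress (fun (k : I * J) i => (k.1 == i)%:R) pS).
move=> i j; rewrite sum_pair /=.
rewrite (bigD1 i) //= [X in _ + X]big1 ?addr0; last first.
  move=> k /negbTE->; rewrite big1 // => p _.
  by rewrite big1 // => l _; rewrite mul0r scale0r.
apply: eq_bigr => p _; rewrite eqxx sum_pair /=.
rewrite (bigD1 j) //= [X in _ + X]big1 ?addr0; last first.
  by move=> k /negbTE->; rewrite big1 // => q _; rewrite mulr0 scale0r.
by apply: eq_bigr => q _; rewrite eqxx mulr1 scale1r.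
Qed.

Lemma pos_kernel_form (I J : finType) (X : I -> I -> V) (h : J -> H) :
  pos_kernel X ->
  psd (fun a b : I * J => ip (op (X a.1 b.1) (h b.2)) (h a.2)).
Proof.
move=> [sX pX]; split=> [a b|y]; first by rewrite ip_star sX ipC.
have := pX (fun i => \sum_j y (i, j) *: h j); congr (_ <= _).
rewrite sum_pair /=; apply: eq_bigr => i _.
under [RHS]eq_bigr do rewrite sum_pair /=.
rewrite [RHS]exchange_big /=; apply: eq_bigr => j _.
rewrite op_sumr ip_suml exchange_big /=; apply: eq_bigr => q _.
rewrite ip_sumr; apply: eq_bigr => p _.
by rewrite opZr ipZl ipZr; ring.
Qed.

Lemma pos_kernel1 x : pos_kernel (fun _ _ : 'I_1 => x) <->
  star x = x /\ forall h, 0 <= ip (op x h) h.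
Proof.
split=> -[sx px]; split.
- exact: sx ord0 ord0.
- by move=> h; have := px (fun=> h); rewrite !big_ord1.
- by [].
- by move=> h; rewrite !big_ord1.
Qed.

Lemma pos_kernel_unit (I : finType) (K : I -> I -> R) :
  psd K -> pos_kernel (fun i j => K i j *: unit).
Proof.
move=> pK; apply: (pos_kernel_schur pK).
have := pos_kernel_reindex (fun _ : I => ord0 : 'I_1)
  ((pos_kernel1 unit).2 (conj star_unit _)).
by apply=> h; rewrite opsys_unitE; exact: ip_ge0.
Qed.

Definition opn (x : V) (c : R) := 0 <= c /\ forall h, ip (op x h) (op x h) <= c ^+ 2 * ip h h.

Lemma opnP x (c : R) : 0 <= c -> opn x c <-> @opnorm_le _ H (op x) c.
Proof. by move=> c0; split=> [[]|]. Qed.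

Lemma opn_ex x : exists c, opn x c.
Proof. by have [c c0 h] := opsys_op_bounded x; exists c. Qed.

Lemma opn_form x c h k : opn x c -> ip (op x h) k ^+ 2 <= c ^+ 2 * ip h h * ip k k.
Proof.
move=> [_ hx]; apply: le_trans (ip_cauchy _ _) _.
by rewrite ler_wpM2r ?ip_ge0.
Qed.

Lemma opn_le x c d : opn x c -> c <= d -> opn x d.
Proof.
move=> [c0 hx] cd; split=> [|h]; first exact: le_trans cd.
apply: le_trans (hx h) _; rewrite ler_wpM2r ?ip_ge0 // ler_sqr ?nnegrE //.
exact: le_trans cd.
Qed.

Lemma opn0 : opn 0 0.
Proof. by split=> // h; rewrite op0l ip0l expr0n mul0r. Qed.

Lemma opnD x y c d : opn x c -> opn y d -> opn (x + y) (c + d).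
Proof.
move=> hx hy; have c0 := hx.1; have d0 := hy.1.
split=> [|h]; first exact: addr_ge0.
have := hx.2 h; have := hy.2 h.
have := ip_cauchy (op x h) (op y h).
rewrite opDl !ipE (ipC (op y h)).
have := ip_ge0 (op x h); have := ip_ge0 (op y h); have := ip_ge0 h.
move: (ip (op x h) (op x h)) (ip (op y h) (op y h)) (ip (op x h) (op y h)) (ip h h).
move=> a b t n n0 b0 a0 tab bd ac.
have : t <= c * d * n.
  have cdn : 0 <= c * d * n by rewrite !mulr_ge0.
  rewrite leNgt; apply/negP => lt.
  have : (c * d * n) ^+ 2 < t ^+ 2 by rewrite ltr_sqr ?nnegrE // (le_trans cdn) // ltW.
  apply/negP; rewrite -leNgt; apply: le_trans tab _.
  apply: le_trans (ler_pM a0 b0 ac bd) _.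
  by rewrite le_eqVlt; apply/orP; left; apply/eqP; ring.
by move=> ?; nra.
Qed.

Lemma opnZ a x c : opn x c -> opn (a *: x) (`|a| * c).
Proof.
move=> hx; split=> [|h]; first by rewrite mulr_ge0 ?hx.1.
rewrite opZl ipZl ipZr mulrA -expr2 exprMn real_normK ?num_real // -[leRHS]mulrA.
by rewrite ler_wpM2l ?sqr_ge0 ?hx.2.
Qed.

Lemma opn_unit : opn unit 1.
Proof. by split=> // h; rewrite opsys_unitE expr1n mul1r. Qed.

Lemma opn_sum I (r : seq I) (F : I -> V) (c : I -> R) :
  (forall i, opn (F i) (c i)) -> opn (\sum_(i <- r) F i) (\sum_(i <- r) c i).
Proof.
move=> hF; elim: r => [|i r ih]; first by rewrite !big_nil; exact: opn0.
by rewrite !big_cons; exact: opnD.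
Qed.

(** This is the matrix [[c, x], [x^*, c]]. Every element is thus a corner of a positive matrix; this
    gives preservation of adjoints by ucp maps, the error estimate in the max cone and the
    faithfulness of the dual representation. *)
Lemma pos_kernel_norm x c : opn x c ->
  pos_kernel (fun b d : bool =>
    if b then (if d then c *: unit else x) else (if d then star x else c *: unit)).
Proof.
move=> hx; split=> [[] []|h]; rewrite ?starZ ?star_unit ?starK //.
rewrite !big_bool !opZl !opsys_unitE !ipZl.
rewrite [ip (op (star x) _) _]ip_star starK (ipC _ (op x (h false))).
have := opn_form (h false) (h true) hx; have := hx.1.
have := ip_ge0 (h true); have := ip_ge0 (h false).
move: (ip (op x _) _) (ip (h true) (h true)) (ip (h false) (h false)).
move=> t a b b0 a0 c0 tab.
(* The square of [2 * t] is at most [4 * c ^+ 2 * a * b], hence at most [(c * (a + b)) ^+ 2]. *)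
have : - t *+ 2 <= c * (a + b).
  have cab : 0 <= c * (a + b) by rewrite mulr_ge0 // addr_ge0.
  rewrite leNgt; apply/negP => lt.
  have : (c * (a + b)) ^+ 2 < (- t *+ 2) ^+ 2.
    by rewrite ltr_sqr ?nnegrE // (le_trans cab) // ltW.
  apply/negP; rewrite -leNgt.
  have := sqr_ge0 (c * (a - b)); nra.
by rewrite /= => ?; lra.
Qed.

End RealSystem.

(** * Ucp maps through kernels, vector compressions and Choi matrices *)

Section RealUcp.
Variable R : realType.
Local Notation F := (realScalars R).
Implicit Types V W : opsys F.

(** M_n(M_k(R)) is M_nk(R): at column vectors [h i], the operator form is the scalar form of the
    flattened kernel. *)
Lemma mx_kernelP k (I : finType) (X : I -> I -> mx_opsys F k) :
  pos_kernel X <->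
  psd (fun a b : I * 'I_k => (X a.1 b.1 : 'M[R]_k) a.2 b.2).
Proof.
have formE (h : I -> 'cV[R]_k) :
    \sum_i \sum_j @cV_dot F k (mx_op (X i j) (h j)) (h i) =
    \sum_(a : I * 'I_k) \sum_(b : I * 'I_k)
      (X a.1 b.1 : 'M[R]_k) a.2 b.2 * h b.1 b.2 0 * h a.1 a.2 0.
  rewrite sum_pair; apply: eq_bigr => i _.
  under [RHS]eq_bigr do rewrite sum_pair /=.
  rewrite [RHS]exchange_big /=; apply: eq_bigr => j _.
  rewrite /cV_dot; apply: eq_bigr => p _.
  by rewrite /mx_op mxE mulr_suml.
split=> -[sX pX]; split.
- by case=> i p [j q] /=; have /matrixP/(_ q p) := sX i j; rewrite !mxE.
- move=> y; have := pX (fun i => \col_p y (i, p)); rewrite formE.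
  congr (_ <= _); apply: eq_bigr => -[i p] _; apply: eq_bigr => -[j q] _ /=.
  by rewrite !mxE.
- move=> i j; apply/matrixP => p q; rewrite !mxE.
  exact: sX (i, q) (j, p).
- by move=> h; rewrite formE; exact: (pX (fun a => h a.1 a.2 0)).
Qed.

Lemma pos_kernel_poscone V (I : finType) (X : I -> I -> V) :
  pos_kernel X -> poscone (\matrix_(i < #|I|, j < #|I|) X (enum_val i) (enum_val j)).
Proof.
move=> /(pos_kernel_reindex (@enum_val I predT)) pX.
by apply/poscone_kernel; apply: eq_pos_kernel pX => i j; rewrite mxE.
Qed.

Lemma ucp_kernel V W (f : {linear V -> W}) (I : finType) (X : I -> I -> V) :
  ucp f -> pos_kernel X -> pos_kernel (fun i j => f (X i j)).
Proof.
move=> [_ cpf] /pos_kernel_poscone /cpf /poscone_kernel.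
move=> /(pos_kernel_reindex (@enum_rank I)).
by apply: eq_pos_kernel => i j; rewrite !mxE !enum_rankK.
Qed.

Lemma kernel_ucp V W (f : {linear V -> W}) :
  f (opsys_unit V) = opsys_unit W ->
  (forall n (X : 'I_n -> 'I_n -> V),
     pos_kernel X -> pos_kernel (fun i j => f (X i j))) ->
  ucp f.
Proof.
move=> f1 fp; split=> // n X /poscone_kernel/fp pX; apply/poscone_kernel.
by apply: eq_pos_kernel pX => i j; rewrite mxE.
Qed.

(** [x] and its adjoint are the off-diagonal corners of one positive matrix, whose image is
    selfadjoint. *)
Lemma ucp_star V W (f : {linear V -> W}) x :
  ucp f -> f (opsys_star x) = opsys_star (f x).
Proof.
move=> uf; have [c /pos_kernel_norm px] := opn_ex x.
by have [/(_ true false) <-] := ucp_kernel uf px.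
Qed.

(** Compression to the span of the [e i], unital by orthonormality. It provides the test maps for
    min-positivity and the map [u] of the factorizations built below. *)
Lemma vector_ucp V m (e : 'I_m -> opsys_space V) : orthonormal e ->
  exists2 f : {linear V -> mx_opsys F m}, ucp f &
    forall x i j, (f x : 'M[R]_m) i j = dotp _ (opsys_op V x (e j)) (e i).
Proof.
move=> oe.
have [|f fE] := @linear_witness R V 'M[R]_m
    (fun x => \matrix_(i, j) dotp _ (opsys_op V x (e j)) (e i)).
  by move=> a x y; apply/matrixP => i j; rewrite !mxE !opE !ipE.
have {}fE x i j : f x i j = dotp _ (opsys_op V x (e j)) (e i) by rewrite fE mxE.
exists f => //; apply: kernel_ucp => [|n X pX].
  by apply/matrixP => i j; rewrite fE opsys_unitE oe mxE eq_sym.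
apply/mx_kernelP.
by apply: eq_psd (pos_kernel_form e pX) => a b; rewrite fE.
Qed.

(** [D] is the Choi matrix of the map: the matrix unit at [(a, b)] goes to [D a b], and the trace
    condition is unitality. *)
Lemma choi_ucp V q (D : 'I_q -> 'I_q -> V) :
  pos_kernel D -> \sum_a D a a = opsys_unit V ->
  exists2 f : {linear mx_opsys F q -> V}, ucp f &
    forall M : 'M[R]_q, f M = \sum_a \sum_b M a b *: D a b.
Proof.
move=> pD D1.
have [|f fE] := @linear_witness R 'M[R]_q V
    (fun M : 'M[R]_q => \sum_a \sum_b M a b *: D a b).
  move=> c x y; rewrite scaler_sumr -big_split; apply: eq_bigr => a _ /=.
  rewrite scaler_sumr -big_split; apply: eq_bigr => b _ /=.
  by rewrite !mxE scalerDl scalerA.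
exists f => //; apply: kernel_ucp => [|n X /mx_kernelP pX].
  rewrite fE -D1; apply: eq_bigr => a _.
  rewrite -[RHS](sum_delta a (D a)); apply: eq_bigr => b _.
  by rewrite mxE eq_sym.
by apply: eq_pos_kernel (pos_kernel_choi pX pD) => i j; rewrite fE.
Qed.

End RealUcp.

(** * Tensor cones *)

Section MaxSums.
Variables (R : realType) (V W : opsys (realScalars R)).
Local Notation T := (tensor V W).

Lemma compress_mxdiag r (p : 'I_r -> nat) n (alpha : 'M[R]_(\sum_l p l, n))
    (X : forall l, 'M[T]_(p l)) :
  compress alpha (\mxdiag_l X l) =
  \sum_l \matrix_(i, j) \sum_a \sum_b
    (alpha (tagnat.Rank l a) i * alpha (tagnat.Rank l b) j) *: X l a b.
Proof.
have sumE (U : nmodType) (G : 'I_(\sum_l p l) -> U) :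
    \sum_k G k = \sum_l \sum_(a < p l) G (tagnat.Rank l a).
  rewrite sig_big_dep /= (reindex _ tagnat.sig_bij_on) /=.
  by apply: eq_bigr => k _; rewrite -[in LHS](tagnat.sigK k) tagnat.rankE.
apply/matrixP => i j; rewrite mxE sumE summxE; apply: eq_bigr => l _.
rewrite mxE; apply: eq_bigr => a _; rewrite sumE (bigD1 l) //=.
rewrite [X in _ + X]big1 ?addr0 => [|m ml].
  apply: eq_bigr => b _; congr (_ *: _).
  have := congr1 (fun A : 'M_(p l) => A a b) (mxblockK
    (fun j k => if j == k then conform_mx 0 (X j) else 0 : 'M_(p j, p k)) l l).
  by rewrite mxE eqxx conform_mx_id.
rewrite big1 // => b _.
have := congr1 (fun A : 'M_(p l, p m) => A a b) (mxblockK
    (fun j k => if j == k then conform_mx 0 (X j) else 0 : 'M_(p j, p k)) l m).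
by rewrite mxE => ->; rewrite eq_sym (negbTE ml) mxE scaler0.
Qed.

Definition tprod n (I J : finType) (A : I -> I -> V) (B : J -> J -> W)
    (c : I * J -> 'I_n -> R) : 'M[T]_n :=
  \matrix_(i, j) \sum_k \sum_l (c k i * c l j) *: tens (A k.1 l.1) (B k.2 l.2).

(** The right-hand side in [max_cone], written as a sum of compressed products instead of one
    compression of a block diagonal matrix; in this form sums and finite index types are easy to
    handle. *)
Definition max_sum n (z : 'M[T]_n) : Prop :=
  exists r (p q : 'I_r -> nat) (A : forall l, 'I_(p l) -> 'I_(p l) -> V)
      (B : forall l, 'I_(q l) -> 'I_(q l) -> W)
      (c : forall l, 'I_(p l) * 'I_(q l) -> 'I_n -> R),
    (forall l, pos_kernel (A l) /\ pos_kernel (B l)) /\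
    z = \sum_l tprod (A l) (B l) (c l).

Lemma sum_unindex m k (U : nmodType) (G : 'I_m * 'I_k -> U) :
  \sum_a G (mxtens_unindex a) = \sum_a G a.
Proof.
rewrite [RHS](reindex (@mxtens_unindex m k)) //.
by exists (@mxtens_index m k) => a _; rewrite (mxtens_indexK, mxtens_unindexK).
Qed.

Lemma max_sumP n (z : 'M[T]_n) : max_sum z <->
  exists (r : nat) (p q : 'I_r -> nat)
      (A : forall l, 'M[V]_(p l)) (B : forall l, 'M[W]_(q l))
      (alpha : 'M[R]_(\sum_l (p l * q l), n)),
    (forall l, poscone (A l) /\ poscone (B l)) /\
    z = compress alpha (\mxdiag_l tens_mx (A l) (B l)).
Proof.
have tE p q (A : 'M[V]_p) (B : 'M[W]_q) (c : 'I_(p * q) -> 'I_n -> R) :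
    \matrix_(i, j) (\sum_a \sum_b (c a i * c b j) *: tens_mx A B a b) =
    tprod (fun i j => A i j) (fun i j => B i j) (fun k => c (mxtens_index k)).
  apply/matrixP => i j; rewrite !mxE -sum_unindex; apply: eq_bigr => a _.
  rewrite -sum_unindex; apply: eq_bigr => b _.
  by rewrite mxE !mxtens_unindexK.
split=> [[r [p [q [A [B [c [pAB ->]]]]]]]|[r [p [q [A [B [al [pAB ->]]]]]]]].
  exists r, p, q, (fun l => \matrix_(i, j) A l i j),
    (fun l => \matrix_(i, j) B l i j),
    (\mxcol_l \matrix_(a, i) c l (mxtens_unindex a) i); split.
    move=> l; have [pA pB] := pAB l; split; apply/poscone_kernel.
      by apply: eq_pos_kernel pA => i j; rewrite mxE.
    by apply: eq_pos_kernel pB => i j; rewrite mxE.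
  rewrite compress_mxdiag; apply: eq_bigr => l _.
  have cE a i : (\mxcol_l \matrix_(a, i) c l (mxtens_unindex a) i)
      (tagnat.Rank l a) i = c l (mxtens_unindex a) i.
    have := congr1 (fun A : 'M_(p l * q l, n) => A a i)
      (mxcolK (fun l => \matrix_(a, i) c l (mxtens_unindex a) i) l).
    by rewrite !mxE.
  apply/matrixP => i j; rewrite !mxE -sum_unindex; apply: eq_bigr => a _.
  rewrite -sum_unindex; apply: eq_bigr => b _.
  by rewrite !cE !mxE.
exists r, p, q, (fun l i j => A l i j), (fun l i j => B l i j),
  (fun l k i => al (tagnat.Rank l (mxtens_index k)) i); split=> //.
rewrite compress_mxdiag; apply: eq_bigr => l _.
by rewrite -(tE _ _ (A l) (B l) (fun a => al (tagnat.Rank l a))).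
Qed.

Lemma max_sum_tprod n (I J : finType) (A : I -> I -> V) (B : J -> J -> W)
    (c : I * J -> 'I_n -> R) :
  pos_kernel A -> pos_kernel B -> max_sum (tprod A B c).
Proof.
move=> pA pB.
exists 1, (fun=> #|I|), (fun=> #|J|), (fun _ i j => A (enum_val i) (enum_val j)),
  (fun _ i j => B (enum_val i) (enum_val j)),
  (fun _ k => c (enum_val k.1, enum_val k.2)); split.
  by move=> _; split; apply: pos_kernel_reindex.
rewrite big_ord1; apply/matrixP => i j; rewrite !mxE !sum_pair.
rewrite (reindex _ (onW_bij _ (@enum_val_bij I))); apply: eq_bigr => a _.
rewrite (reindex _ (onW_bij _ (@enum_val_bij J))); apply: eq_bigr => b _.
rewrite !sum_pair.
rewrite (reindex _ (onW_bij _ (@enum_val_bij I))); apply: eq_bigr => a' _.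
by rewrite (reindex _ (onW_bij _ (@enum_val_bij J))); apply: eq_bigr => b' _.
Qed.

Lemma max_sum0 n : max_sum (0 : 'M[T]_n).
Proof.
exists 0, (fun=> 0), (fun=> 0), (fun _ _ _ => 0), (fun _ _ _ => 0), (fun _ _ _ => 0).
by rewrite big_ord0; split=> // -[].
Qed.

Lemma max_sumD n (y z : 'M[T]_n) : max_sum y -> max_sum z -> max_sum (y + z).
Proof.
move=> [r [p [q [A [B [c [pAB ->]]]]]]] [r' [p' [q' [A' [B' [c' [pAB' ->]]]]]]].
pose P (s : 'I_r + 'I_r') := match s with inl l => p l | inr l => p' l end.
pose Q (s : 'I_r + 'I_r') := match s with inl l => q l | inr l => q' l end.
pose AA s : 'I_(P s) -> 'I_(P s) -> V :=
  match s with inl l => A l | inr l => A' l end.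
pose BB s : 'I_(Q s) -> 'I_(Q s) -> W :=
  match s with inl l => B l | inr l => B' l end.
pose C s : 'I_(P s) * 'I_(Q s) -> 'I_n -> R :=
  match s with inl l => c l | inr l => c' l end.
exists (r + r')%N, (fun l => P (split l)), (fun l => Q (split l)),
  (fun l => AA (split l)), (fun l => BB (split l)), (fun l => C (split l)); split.
  by move=> l; case: (split l).
pose G s := tprod (AA s) (BB s) (C s).
rewrite [RHS](eq_bigr (fun l => G (split l))) // big_split_ord /=.
by congr (_ + _); apply: eq_bigr => l _;
  rewrite ?(unsplitK (inl l)) ?(unsplitK (inr l)).
Qed.

Lemma max_sum_sum n I (r : seq I) (z : I -> 'M[T]_n) :
  (forall i, max_sum (z i)) -> max_sum (\sum_(i <- r) z i).
Proof.
move=> hz; elim/big_rec: _ => [|i y _]; first exact: max_sum0.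
exact: max_sumD.
Qed.

Lemma max_sumZ n (a : R) (z : 'M[T]_n) : 0 <= a -> max_sum z ->
  max_sum (\matrix_(i, j) (a *: z i j)).
Proof.
move=> a0 [r [p [q [A [B [c [pAB ->]]]]]]].
exists r, p, q, A, B, (fun l k i => Num.sqrt a * c l k i); split=> //.
apply/matrixP => i j; rewrite mxE !summxE scaler_sumr; apply: eq_bigr => l _.
rewrite !mxE scaler_sumr; apply: eq_bigr => k _.
rewrite scaler_sumr; apply: eq_bigr => k' _.
by rewrite scalerA mulrACA -expr2 sqr_sqrtr.
Qed.

Lemma max_sum_psd n (K : 'I_n -> 'I_n -> R) : psd K ->
  max_sum (\matrix_(i, j) (K i j *: tensor_unit V W)).
Proof.
move=> pK.
have pU : pos_kernel (fun _ _ : 'I_1 => opsys_unit W).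
  apply/pos_kernel1; split=> [|h]; first exact: star_unit.
  by rewrite opsys_unitE; exact: ip_ge0.
have -> : \matrix_(i, j) (K i j *: tensor_unit V W) =
    tprod (fun i j => K i j *: opsys_unit V) (fun _ _ : 'I_1 => opsys_unit W)
      (fun k i => (k.1 == i)%:R).
  apply/matrixP => i j; rewrite !mxE !sum_pair.
  under eq_bigr do rewrite big_ord1 sum_pair.
  have E k : \sum_l \sum_(m < 1) (((k, ord0 : 'I_1).1 == i)%:R * ((l, m).1 == j)%:R)
      *: tens (K k l *: opsys_unit V) (opsys_unit W) =
      (k == i)%:R *: (K k j *: tensor_unit V W).
    under eq_bigr do rewrite big_ord1 /= -scalerA.
    by rewrite -scaler_sumr sum_delta tensZl.
  by under eq_bigr do rewrite E; rewrite sum_delta.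
by apply: max_sum_tprod pU; exact: pos_kernel_unit.
Qed.

Lemma max_coneE n (x : 'M[T]_n) : max_cone x <->
  (forall i j, tensor_star (x i j) = x j i) /\
  forall e : R, 0 < e -> max_sum (x + (e *: tensor_unit V W)%:M).
Proof.
by split=> -[sx mx]; split=> // e e0; apply/max_sumP; exact: mx.
Qed.

End MaxSums.

(** * The max cone is contained in the min cone *)

Section MaxInMin.
Variables (R : realType) (V W : opsys (realScalars R)).
Local Notation F := (realScalars R).
Local Notation T := (tensor V W).

Lemma tensor_map_linear m k (phi : {linear V -> 'M[R]_m}) (psi : {linear W -> 'M[R]_k}) :
  exists2 g : {linear T -> 'M[R]_(m * k)}, tensor_map phi psi =1 g &
    forall v w, g (tens v w) = phi v *t psi w.
Proof.
pose f (v : V) (w : W) : 'M[R]_(m * k) := phi v *t psi w.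
have f_bilinear : bilinear_for *:%R *:%R f.
  by split=> [w'|v'] a x y; rewrite /f linearP; apply/matrixP => i j;
    rewrite !mxE; ring.
pose fM := bilinear_isBilinear.Build R V W 'M[R]_(m * k) *:%R *:%R f f_bilinear.
pose fB : {bilinear V -> W -> 'M[R]_(m * k)} := HB.pack f fM.
have [g gE] := linear_witness (tensor_liftP fB).
by exists g => [x|v w]; rewrite gE //; exact: (tensor_lift_tens fB).
Qed.

Lemma tensor_star_linear :
  exists2 g : {linear T -> T}, @tensor_star _ V W =1 g &
    forall v w, g (tens v w) = tens (opsys_star v) (opsys_star w).
Proof.
pose f (v : V) (w : W) : T := tens (opsys_star v) (opsys_star w).
have f_bilinear : bilinear_for *:%R *:%R f.
  by split=> [w'|v'] a x y; rewrite /f starP !(tensDl, tensDr, tensZl, tensZr).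
pose fM := bilinear_isBilinear.Build R V W T *:%R *:%R f f_bilinear.
pose fB : {bilinear V -> W -> T} := HB.pack f fM.
have [g gE] := linear_witness (tensor_liftP fB).
by exists g => [x|v w]; rewrite gE //; exact: (tensor_lift_tens fB).
Qed.

Lemma psd_limit (I : finType) (K : I -> I -> R) :
  (forall e, 0 < e -> psd (fun i j => K i j + e * (i == j)%:R)) -> psd K.
Proof.
move=> pK; split=> [i j|y].
  by have := (pK 1 ltr01).1 i j; rewrite eq_sym => /addIr.
set S := \sum_i _; pose N := \sum_i y i ^+ 2.
have SE e : 0 < e -> 0 <= S + e * N.
  move=> e0; have := (pK e e0).2 y; congr (_ <= _).
  rewrite mulr_sumr -big_split; apply: eq_bigr => i _ /=.
  rewrite -(sum_delta (U := R^o) i (fun j => e * (y j * y i))) -big_split.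
  by apply: eq_bigr => j _ /=; rewrite -[_ *: _]/(_ * _) [i == j]eq_sym; ring.
have N0 : 0 <= N by apply: sumr_ge0 => i _; exact: sqr_ge0.
rewrite leNgt; apply/negP => S0.
(* With this epsilon the correction [e * N] is at most half of [- S], so the total would still be
   negative; [N] may vanish, whence the [+ 1]. *)
have := SE (- S / (N + 1) / 2); rewrite !divr_gt0 ?oppr_gt0 ?ltr_wpDl // => /(_ isT).
have -> : - S / (N + 1) / 2 * N = - S * (N / (N + 1)) / 2 by ring.
have : N / (N + 1) <= 1 by rewrite ler_pdivrMr ?ltr_wpDl // mul1r lerDl.
by move: (N / _) => t t1; nra.
Qed.

Lemma tensmx11 m k : (1%:M : 'M[R]_m) *t (1%:M : 'M[R]_k) = 1%:M.
Proof.
apply/matrixP => a b; case: (mxtens_indexP a) => i j; case: (mxtens_indexP b) => i' j'.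
rewrite tensmxE !mxE (inj_eq (can_inj (@mxtens_indexK m k))) xpair_eqE.
by case: (i == i'); case: (j == j'); rewrite ?mulr1 ?mulr0.
Qed.

(** Ucp maps carry [A] and [B] to psd matrices, whose Kronecker product is a Schur product of two
    reindexed kernels. Compressions and sums keep it psd, and [psd_limit] removes the epsilon. *)
Lemma max_cone_min_cone n (x : 'M[T]_n) : max_cone x -> min_cone x.
Proof.
move=> /max_coneE[_ mx] m k phi psi up uq.
have [g gE gt] := tensor_map_linear phi psi.
apply/poscone_kernel/mx_kernelP/psd_limit => e e0.
have [r [p [q [A [B [c [pAB E]]]]]]] := mx e e0.
have xE i j : g (x i j) + (e * (i == j)%:R)%:M =
    \sum_l g (tprod (A l) (B l) (c l) i j).
  have := congr1 (fun z : 'M_n => g (z i j)) E.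
  rewrite summxE linear_sum => <-; rewrite !mxE linearD; congr (_ + _).
  case: (i == j); last by rewrite mulr0n linear0 mulr0 raddf0.
  by rewrite mulr1n mulr1 linearZ_LR gt up.1 uq.1 [_ *t _]tensmx11 scale_scalar_mx mulr1.
have pg l : psd (fun a b : 'I_n * 'I_(m * k) =>
    g (tprod (A l) (B l) (c l) a.1 b.1) a.2 b.2).
  have [pA pB] := pAB l.
  have pK := psd_schur
    (psd_reindex (fun a : ('I_(p l) * 'I_(q l)) * 'I_(m * k) =>
       (a.1.1, (mxtens_unindex a.2).1)) ((mx_kernelP _).1 (ucp_kernel up pA)))
    (psd_reindex (fun a : ('I_(p l) * 'I_(q l)) * 'I_(m * k) =>
       (a.1.2, (mxtens_unindex a.2).2)) ((mx_kernelP _).1 (ucp_kernel uq pB))).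
  apply: eq_psd (psd_compress (fun a b => c l a.1 b.1 * (a.2 == b.2)%:R) pK).
  move=> [i a] [j b]; rewrite sum_pair /= mxE linear_sum summxE.
  apply: eq_bigr => s _; rewrite linear_sum summxE.
  rewrite (bigD1 a) //= [X in _ + X]big1 ?addr0; last first.
    by move=> a' /negbTE->; rewrite big1 // => t _; rewrite mulr0 !mul0r.
  rewrite sum_pair /=; apply: eq_bigr => t _.
  rewrite (bigD1 b) //= [X in _ + X]big1 ?addr0; last first.
    by move=> b' /negbTE->; rewrite !mulr0 !mul0r.
  by rewrite !eqxx !mulr1 linearZ_LR gt !mxE.
apply: eq_psd (psd_sum pg) => -[i a] [j b] /=.
rewrite !mxE gE -summxE -xE !mxE; congr (_ + _).
by rewrite xpair_eqE; case: (i == j); case: (a == b); rewrite ?mulr1 ?mulr0 ?mulr1n ?mulr0n.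
Qed.


End MaxInMin.

(** * Separation of tensors, and small tensors in the max cone *)

Section MinInMax.
Variables (R : realType) (V W : opsys (realScalars R)).
Local Notation F := (realScalars R).
Local Notation T := (tensor V W).
Local Notation HV := (opsys_space V).
Local Notation HW := (opsys_space W).
Local Notation ipV := (dotp HV : HV -> HV -> R).
Local Notation ipW := (dotp HW : HW -> HW -> R).
Local Notation opV := (opsys_op V : V -> HV -> HV).
Local Notation opW := (opsys_op W : W -> HW -> HW).

(** Induction on the number of terms. If some vector form is nonzero on the first left leg [v], the
    hypothesis solves for [w] as a combination of the other right legs; substituting leaves a
    shorter sum on which all products of forms still vanish. *)
Lemma tensor_forms_eq0 (s : seq (V * W)) :
  (forall h k h' k', \sum_(p <- s) ipV (opV p.1 h) k * ipW (opW p.2 h') k' = 0) ->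
  \sum_(p <- s) tens p.1 p.2 = 0 :> T.
Proof.
have [n] := ubnP (size s); elim: n s => // n ih [|[v w] s] /=; first by rewrite big_nil.
rewrite ltnS => sn hs.
have [[h [k n0]]|all0] := pselect (exists h k, ipV (opV v h) k != 0); last first.
  have -> : v = 0.
    apply: op_form_inj => h k; rewrite op0l ip0l; apply/eqP/negPn/negP => n0.
    by apply: all0; exists h, k.
  rewrite big_cons tens0l add0r; apply: ih => // h k h' k'.
  have := hs h k h' k'; rewrite big_cons /=.
  have -> : ipV (opV v h) k = 0 by apply/eqP/negPn/negP => n0; apply: all0; exists h, k.
  by rewrite mul0r add0r.
pose l (p : V * W) := ipV (opV p.1 h) k / ipV (opV v h) k.
have wE : w = - \sum_(p <- s) l p *: p.2.
  apply: op_form_inj => h' k'; rewrite opNl ipNl op_suml ip_suml.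
  have := hs h k h' k'; rewrite big_cons /= addrC => /eqP; rewrite addr_eq0 => /eqP E.
  apply: (mulfI n0); rewrite mulrN mulr_sumr; apply: oppr_inj; rewrite opprK -E.
  by apply: eq_bigr => p _; rewrite opZl ipZl /l; field.
have E : \sum_(p <- s) tens (p.1 - l p *: v) p.2 = 0 :> T.
  have := ih [seq (p.1 - l p *: v, p.2) | p <- s]; rewrite size_map big_map /=.
  apply=> // h1 k1 h' k'; rewrite big_map /=.
  rewrite -[RHS](hs h1 k1 h' k') big_cons /= wE opNl ipNl op_suml ip_suml.
  rewrite mulrN mulr_sumr addrC -sumrB; apply: eq_bigr => p _ /=.
  by rewrite opDl opNl opZl ipDl ipNl ipZl opZl ipZl; ring.
rewrite big_cons /= wE tensNr tens_sumr addrC -sumrB -[RHS]E.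
apply: eq_bigr => p _; rewrite tensZr tensDl -tensZl.
by congr (_ + _); rewrite tensNl.
Qed.

(** Two vectors span a finite-dimensional space, so each vector form factors through a compression
    from [vector_ucp]; pairs of ucp maps therefore see all products of vector forms. *)
Lemma tensor_separation (z : T) :
  (forall m k (phi : {linear V -> mx_opsys F m}) (psi : {linear W -> mx_opsys F k}),
     ucp phi -> ucp psi -> tensor_map phi psi z = 0) -> z = 0.
Proof.
have [s ->] := tensor_sum z => hz; apply: tensor_forms_eq0 => h k h' k'.
have frame (U : opsys F) (a b : opsys_space U) : exists m (phi : {linear U -> mx_opsys F m}),
    ucp phi /\ exists c d : 'I_m -> R, forall x,
      (dotp (opsys_space U) : _ -> _ -> R) (opsys_op U x a) b =
      \sum_i \sum_j c j * d i * (phi x : 'M[R]_m) i j.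
  have [m [e [oe [c hc]]]] := gram_schmidt (fun i : 'I_2 => if i == ord0 then a else b).
  have [phi uphi phiE] := vector_ucp oe.
  exists m, phi; split=> //; exists (c ord0), (c ord_max) => x.
  have -> : a = \sum_j c ord0 j *: e j by rewrite -hc.
  have -> : b = \sum_j c ord_max j *: e j by rewrite -hc.
  rewrite op_form_sum; apply: eq_bigr => i _. apply: eq_bigr => j _.
  by rewrite phiE.
have [m [phi [uphi [c [d cd]]]]] := frame V h k.
have [q [psi [upsi [c' [d' cd']]]]] := frame W h' k'.
have := hz _ _ _ _ uphi upsi; have [g gE gt] := tensor_map_linear phi psi.
rewrite gE linear_sum => E.
have E0 i j i' j' : \sum_(p <- s) (phi p.1 : 'M[R]_m) i j * (psi p.2 : 'M[R]_q) i' j' = 0.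
  have := congr1 (fun A : 'M_(m * q) => A (mxtens_index (i, i')) (mxtens_index (j, j'))) E.
  rewrite summxE mxE => E0; rewrite -[RHS]E0; apply: eq_bigr => p _.
  by rewrite gt tensmxE.
transitivity (\sum_(p <- s) \sum_i \sum_j \sum_i' \sum_j' (c j * d i * (c' j' * d' i')) *
   ((phi p.1 : 'M[R]_m) i j * (psi p.2 : 'M[R]_q) i' j')).
  apply: eq_bigr => p _; rewrite cd cd' mulr_suml; apply: eq_bigr => i _.
  rewrite mulr_suml; apply: eq_bigr => j _; rewrite mulr_sumr; apply: eq_bigr => i' _.
  by rewrite mulr_sumr; apply: eq_bigr => j' _; rewrite mulrACA.
do 4 ![rewrite exchange_big; apply: big1 => ? _ /=].
by rewrite -mulr_sumr E0 mulr0.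
Qed.

(** [min_cone] does not mention the involution. Symmetry holds after each pair of ucp maps, these
    preserve adjoints, and together they separate points. *)
Lemma min_cone_selfadjoint n (x : 'M[T]_n) : min_cone x ->
  forall i j, tensor_star (x i j) = x j i.
Proof.
move=> mx i j; have [st stE stt] := tensor_star_linear V W.
apply/eqP; rewrite -subr_eq0; apply/eqP; rewrite stE.
apply: tensor_separation => m k phi psi up uq.
have [g gE gt] := tensor_map_linear phi psi; rewrite gE linearB.
have /poscone_kernel/mx_kernelP[sx _] := mx _ _ _ _ up uq.
have -> : g (st (x i j)) = (g (x i j))^T.
  have [f fE] : exists f : {linear T -> 'M[R]_(m * k)}, f =1 (fun z => g (st z)).
    by apply: linear_witness => a y z; rewrite !linearP.
  have [f' fE'] : exists f : {linear T -> 'M[R]_(m * k)}, f =1 (fun z => (g z)^T).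
    by apply: linear_witness => a y z; rewrite !linearP.
  rewrite -fE -fE'; apply: tensor_linear_eq => v w; rewrite fE fE' stt !gt.
  rewrite (ucp_star v up) (ucp_star w uq) trmx_tens.
  by congr (_ *t _); apply/matrixP => a b; rewrite !mxE.
apply/eqP; rewrite subr_eq0; apply/eqP/matrixP => a b.
by have := sx (i, b) (j, a); rewrite /= !mxE !gE.
Qed.

(** Any finite family of test vectors consists of combinations of an orthonormal one, so unital
    compressions suffice to test positivity. *)
Lemma pos_kernel_orthonormal (I : finType) (Z : I -> I -> W) :
  (forall i j, opsys_star (Z i j) = Z j i) ->
  (forall m (e : 'I_m -> HW), orthonormal e ->
     psd (fun a b : I * 'I_m => ipW (opW (Z a.1 b.1) (e b.2)) (e a.2))) ->
  pos_kernel Z.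
Proof.
move=> sZ pZ; split=> // h.
have [m [e [oe [c hc]]]] := gram_schmidt (fun k : 'I_#|I| => h (enum_val k)).
have {}hc i : h i = \sum_j c (enum_rank i) j *: e j by rewrite -hc enum_rankK.
have := (pZ m e oe).2 (fun a => c (enum_rank a.1) a.2); congr (_ <= _).
rewrite sum_pair; apply: eq_bigr => i _.
under eq_bigr do rewrite sum_pair /=.
rewrite exchange_big; apply: eq_bigr => j _ /=.
rewrite (hc i) (hc j) ip_sumr; apply: eq_bigr => p _.
rewrite op_sumr ip_suml; apply: eq_bigr => q _.
by rewrite opZr ipZl ipZr; ring.
Qed.

(** Take the product of [[c, v], [v^*, c]] and [[d, w], [w^*, d]], keep the index pairs where both
    indices agree, and place them at rows [r] and [s]. This yields the two off-diagonal tensors with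
    [c * d] at [r] and at [s]; [D] fills the diagonal up to [2 * c * d], also when [r = s]. *)
Lemma max_sum_error n (r s : 'I_n) v w (c d : R) : opn v c -> opn w d ->
  max_sum (\matrix_(i, j) (((i == r) && (j == s))%:R *: tens v w +
     ((i == s) && (j == r))%:R *: tens (opsys_star v) (opsys_star w) +
     ((i == j)%:R * (c * d) *+ 2) *: tensor_unit V W)).
Proof.
move=> vc wd; have cd0 : 0 <= c * d by rewrite mulr_ge0 ?vc.1 ?wd.1.
pose t (i : 'I_n) b := if b then i == r else i == s.
have ps := max_sum_tprod (fun (k : bool * bool) i => ((k.1 == k.2) && t i k.1)%:R)
  (pos_kernel_norm vc) (pos_kernel_norm wd).
pose D (u : 'I_n) i := 1 - (i == u)%:R : R.
have pD : psd (fun i j : 'I_n => (i == j)%:R * (c * d * (D r i + D s i))).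
  by apply: psd_diag => i; rewrite mulr_ge0 // addr_ge0 // /D subr_ge0; case: eqP.
have := max_sumD ps (max_sum_psd V W pD); congr (max_sum _).
apply/matrixP => i j; rewrite !mxE.
rewrite !sum_pair !big_bool /= !sum_pair !big_bool /= /t /=.
rewrite !(mul0r, mulr0, scale0r, add0r, addr0).
rewrite !(tensZl, tensZr) -/(tensor_unit V W) -!natrM !mulnb /D.
rewrite !scalerA -!addrA.
rewrite addrC -!addrA -!scalerDl; congr (_ + (_ + _ *: _)).
have E u : ((i == u) && (j == u))%:R = (i == j)%:R * (i == u)%:R :> R.
  have [->|/negbTE ij] := eqVneq i j; first by rewrite andbb mul1r.
  by rewrite mul0r; case: eqP => // <-; rewrite eq_sym ij.
by rewrite !E; ring.
Qed.

(** As [y] is selfadjoint, twice [y] is the sum over [r] and [s] of [y r s] placed at [(r, s)] and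
    its adjoint placed at [(s, r)]; [max_sum_error] handles each such pair, and halving gives the
    constant. *)
Lemma max_sum_error_sum n (y : 'M[T]_n) (L : 'I_n -> 'I_n -> seq (V * W))
    (nu : W -> R) (eta : R) :
  (forall i j, tensor_star (y i j) = y j i) ->
  (forall i j, y i j = \sum_(p <- L i j) tens p.1 p.2) ->
  (forall w, opn w (nu w)) ->
  (forall i j, {in L i j, forall p, opn p.1 eta}) ->
  max_sum (y + ((eta * \sum_i \sum_j \sum_(p <- L i j) nu p.2) *: tensor_unit V W)%:M).
Proof.
move=> sy yE hnu hL.
pose Y r s (p : V * W) : 'M[T]_n := \matrix_(i, j) (((i == r) && (j == s))%:R *: tens p.1 p.2 +
     ((i == s) && (j == r))%:R *: tens (opsys_star p.1) (opsys_star p.2) +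
     ((i == j)%:R * (eta * nu p.2) *+ 2) *: tensor_unit V W).
have mY : max_sum (\sum_r \sum_s \sum_(p <- L r s) Y r s p).
  apply: max_sum_sum => r; apply: max_sum_sum => s.
  rewrite big_seq_cond; elim/big_rec: _ => [|p z]; first exact: max_sum0.
  rewrite andbT => pL mz; apply: max_sumD mz; apply: max_sum_error => //.
  exact: hL pL.
have := max_sumZ (_ : 0 <= 2^-1) mY; rewrite invr_ge0 ler0n => /(_ isT).
congr (max_sum _); apply/matrixP => i j; rewrite !mxE.
have [st stE stt] := tensor_star_linear V W.
have -> : (\sum_r \sum_s \sum_(p <- L r s) Y r s p) i j =
    \sum_r \sum_s (((i == r) && (j == s))%:R *: y r s +
      ((i == s) && (j == r))%:R *: st (y r s) +
      ((i == j)%:R * (eta * \sum_(p <- L r s) nu p.2) *+ 2) *: tensor_unit V W).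
  rewrite summxE; apply: eq_bigr => r _; rewrite summxE; apply: eq_bigr => s _.
  rewrite summxE; under eq_bigr do rewrite mxE; rewrite !big_split /=; congr (_ + _ + _).
  - by rewrite yE scaler_sumr.
  - by rewrite yE linear_sum scaler_sumr; apply: eq_bigr => p _; rewrite stt.
  - by rewrite -scaler_suml !mulr_sumr -sumrMnl.
have D (a b : 'I_n) (G : 'I_n -> 'I_n -> T) :
    \sum_r \sum_s ((a == r) && (b == s))%:R *: G r s = G a b.
  rewrite -[RHS](sum_delta a (fun r => G r b)); apply: eq_bigr => r _.
  rewrite -(sum_delta b (G r)) scaler_sumr; apply: eq_bigr => s _.
  by rewrite scalerA -natrM mulnb eq_sym (eq_sym b).
under eq_bigr do rewrite !big_split /=.
rewrite !big_split /= D.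
have -> : \sum_r \sum_s ((i == s) && (j == r))%:R *: st (y r s) = st (y j i).
  by rewrite -(D j i (fun r s => st (y r s))); apply: eq_bigr => r _; apply: eq_bigr => s _;
    rewrite andbC.
rewrite -stE sy -mulr2n.
under eq_bigr do rewrite -scaler_suml.
rewrite -scaler_suml.
have -> : \sum_r \sum_s (i == j)%:R * (eta * \sum_(p <- L r s) nu p.2) *+ 2 =
    ((i == j)%:R * (eta * \sum_r \sum_s \sum_(p <- L r s) nu p.2)) *+ 2.
  by rewrite !mulr_sumr -sumrMnl; apply: eq_bigr => r _; rewrite !mulr_sumr -sumrMnl.
rewrite -scaler_nat scalerDr !scalerA mulVf ?pnatr_eq0 // scale1r; congr (_ + _).
have E2 (z : R) : 2^-1 * (z *+ 2) = z by rewrite mulr2n; field.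
by rewrite E2; case: (i == j); rewrite ?mul1r ?mul0r ?scale0r ?mulr1n ?mulr0n.
Qed.

End MinInMax.

Lemma directed_seq (I : Type) (le : I -> I -> Prop) (A : Type) (s : seq A)
    (P : A -> I -> Prop) : directed le ->
  (forall a, exists i, forall j, le i j -> P a j) ->
  exists i, forall a, List.In a s -> P a i.
Proof.
move=> [[i0] lexx le_trans le_dir] hP.
suff [i hi] : exists i, forall a, List.In a s -> forall j, le i j -> P a j.
  by exists i => a /hi; apply.
elim: s => [|a s [i hi]]; first by exists i0.
have [k hk] := hP a; have [j ij kj] := le_dir i k.
exists j => b /= [<- l jl|/hi bi l jl]; first by apply: hk; apply: le_trans kj jl.
by apply: bi; apply: le_trans ij jl.
Qed.

(** * A factorization puts the min cone into the max cone *)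

Section CPFPNuclear.
Variables (R : realType) (V W : opsys (realScalars R)).
Local Notation F := (realScalars R).
Local Notation T := (tensor V W).

(** The kernel is (u ⊗ id)(x). Compressing it to orthonormal vectors gives (u ⊗ psi)(x) with psi
    ucp, which is psd by min-positivity. *)
Lemma min_cone_slice n (x : 'M[T]_n) q (u : {linear V -> mx_opsys F q})
    (G : 'I_q -> 'I_q -> {linear T -> W}) :
  ucp u -> min_cone x ->
  (forall a b v w, G a b (tens v w) = (u v : 'M[R]_q) a b *: w) ->
  pos_kernel (fun k l : 'I_n * 'I_q => G k.2 l.2 (x k.1 l.1)).
Proof.
move=> uu mx GE; apply: pos_kernel_orthonormal => [[r a] [s b]|m e oe] /=.
  have [st stE stt] := tensor_star_linear V W.
  rewrite -(min_cone_selfadjoint mx r s) stE.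
  have [f fE] : exists f : {linear T -> W}, f =1 (fun z => opsys_star (G a b z)).
    by apply: linear_witness => c y z; rewrite linearP starP.
  have [f' fE'] : exists f : {linear T -> W}, f =1 (fun z => G b a (st z)).
    by apply: linear_witness => c y z; rewrite !linearP.
  rewrite -fE -fE'; apply: tensor_linear_eq => v w.
  by rewrite fE fE' stt !GE starZ (ucp_star v uu) /= !mxE.
have [psi upsi psiE] := vector_ucp oe.
have [g gE gt] := tensor_map_linear u psi.
have /poscone_kernel/mx_kernelP := mx _ _ _ _ uu upsi.
move=> /(psd_reindex (fun c : ('I_n * 'I_q) * 'I_m =>
   (c.1.1, mxtens_index (c.1.2, c.2)))).
apply: eq_psd => -[[r a] i] [[s b] j] /=.
rewrite mxE gE.
have [f fE] : exists f : {linear T -> R^o},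
    f =1 (fun z => g z (mxtens_index (a, i)) (mxtens_index (b, j))).
  by apply: linear_witness => c y z; rewrite linearP !mxE.
have [f' fE'] : exists f : {linear T -> R^o},
    f =1 (fun z => dotp (opsys_space W) (opsys_op W (G a b z) (e j)) (e i)).
  by apply: linear_witness => c y z; rewrite linearP !opE !ipE.
rewrite -fE -[RHS]fE'; apply: (@tensor_linear_eq R V W R^o f f') => v w; rewrite fE fE' gt GE.
by rewrite tensmxE psiE opZl ipZl.
Qed.

(** Expanding u in matrix units, the result is the sum over a, b of v(E_ab) ⊗ (u_ab ⊗ id)(x): one
    product of the positive matrices [v(E_ab)] and (u ⊗ id)(x), contracted along a and b. *)
Lemma min_cone_factor n (x : 'M[T]_n) q (u : {linear V -> mx_opsys F q})
    (v : {linear mx_opsys F q -> V}) (Th : {linear T -> T}) :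
  ucp u -> ucp v -> min_cone x ->
  (forall a b, Th (tens a b) = tens (v (u a)) b) ->
  max_sum (\matrix_(i, j) Th (x i j)).
Proof.
move=> uu uv mx ThE.
have /choice[G GE] (ab : 'I_q * 'I_q) : exists g : {linear T -> W},
    forall y w, g (tens y w) = (u y : 'M[R]_q) ab.1 ab.2 *: w.
  apply: (@tensor_lift_witness _ _ _ _ (fun y w => (u y : 'M[R]_q) ab.1 ab.2 *: w)).
    by move=> w c y z; rewrite linearP !mxE scalerDl scalerA.
  by move=> y c w z; rewrite scalerDr !scalerA mulrC.
have pZ := @min_cone_slice _ x _ u (fun a b => G (a, b)) uu mx (fun a b => GE (a, b)).
have pA : pos_kernel (fun a b : 'I_q => v (delta_mx a b : 'M[R]_q)).
  apply: (ucp_kernel uv); apply/mx_kernelP.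
  apply: eq_psd (psd_gram (fun (t : 'I_1) (a : 'I_q * 'I_q) => (a.1 == a.2)%:R)).
  move=> [a i] [b j]; rewrite big_ord1 mxE /= -natrM mulnb.
  by rewrite eq_sym (eq_sym b).
have := max_sum_tprod (fun (k : 'I_q * ('I_n * 'I_q)) i =>
   ((k.1 == k.2.2) && (k.2.1 == i))%:R) pA pZ.
congr (max_sum _); apply/matrixP => i j; rewrite !mxE.
have -> : Th (x i j) = \sum_a \sum_b tens (v (delta_mx a b)) (G (a, b) (x i j)).
  have [f fE] : exists f : {linear T -> T}, f =1 (fun z =>
      \sum_a \sum_b tens (v (delta_mx a b)) (G (a, b) z)).
    apply: linear_witness => c y z; rewrite scaler_sumr -big_split; apply: eq_bigr => a _.
    rewrite scaler_sumr -big_split; apply: eq_bigr => b _.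
    by rewrite linearP tensDr tensZr.
  rewrite -fE; apply: tensor_linear_eq => y w; rewrite fE ThE.
  rewrite [u y in LHS](matrix_sum_delta (u y : 'M[R]_q)) linear_sum tens_suml.
  apply: eq_bigr => a _; rewrite linear_sum tens_suml; apply: eq_bigr => b _.
  by rewrite linearZ_LR GE tensZl tensZr.
have D (U : lmodType R) (k : 'I_n) (P : 'I_q * ('I_n * 'I_q) -> U) :
    \sum_c ((c.1 == c.2.2) && (c.2.1 == k))%:R *: P c = \sum_a P (a, (k, a)).
  rewrite sum_pair; apply: eq_bigr => a _; rewrite sum_pair /=.
  rewrite exchange_big /= -[RHS](sum_delta a (fun b => P (a, (k, b)))).
  apply: eq_bigr => b _; rewrite -(sum_delta k (fun l => P (a, (l, b)))) scaler_sumr.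
  by apply: eq_bigr => l _; rewrite scalerA -natrM mulnb eq_sym.
under eq_bigr => c _ do under eq_bigr => d _ do rewrite -scalerA.
under eq_bigr do rewrite -scaler_sumr D.
by rewrite D.
Qed.

Lemma CPFP_min_eq_max : CPFP V -> min_eq_max V W.
Proof.
move=> [I [le [nn [u [v [dir uu uv conv]]]]]] n x; split; last exact: max_cone_min_cone.
move=> mx; apply/max_coneE; split; first exact: min_cone_selfadjoint.
move=> e e0.
have /choice[L0 hL0] (ij : 'I_n * 'I_n) : exists s : seq (V * W),
  x ij.1 ij.2 = \sum_(p <- s) tens p.1 p.2 by exact: tensor_sum.
have /choice[nu hnu] (w : W) : exists c, opn w c := opn_ex w.
pose C := \sum_i \sum_j \sum_(p <- L0 (i, j)) nu p.2.
have C0 : 0 <= C.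
  by do 3 ![apply: sumr_ge0 => ? _]; exact: (hnu _).1.
pose eta := e / (C + 1).
have eta0 : 0 < eta by rewrite divr_gt0 // ltr_wpDl.
have [t ht] : exists t, forall a : V, List.In a
    (flatten [seq [seq p.1 | p <- L0 ij] | ij <- enum {: 'I_n * 'I_n}]) ->
    opn (v t (u t a) - a) eta.
  apply: (directed_seq _ dir) => a; have [t0 ht0] := conv a eta eta0.
  by exists t0 => t /ht0 ?; apply/opnP => //; exact: ltW.
have [Th ThE] : exists Th : {linear T -> T}, forall a b, Th (tens a b) = tens (v t (u t a)) b.
  apply: (@tensor_lift_witness _ _ _ _ (fun a b => tens (v t (u t a)) b)).
    by move=> w c a b; rewrite !linearP tensDl tensZl.
  by move=> a c w w'; rewrite tensDr tensZr.
have mTh := min_cone_factor (uu t) (uv t) mx ThE.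
have [st stE stt] := tensor_star_linear V W.
have ThS z : Th (st z) = st (Th z).
  have [f fE] : exists f : {linear T -> T}, f =1 (fun z => Th (st z)).
    by apply: linear_witness => c y y'; rewrite !linearP.
  have [f' fE'] : exists f : {linear T -> T}, f =1 (fun z => st (Th z)).
    by apply: linear_witness => c y y'; rewrite !linearP.
  rewrite -fE -fE'; apply: tensor_linear_eq => a b.
  by rewrite fE fE' stt !ThE stt (ucp_star a (uu t)) (ucp_star _ (uv t)).
pose y : 'M[T]_n := \matrix_(i, j) (x i j - Th (x i j)).
pose L i j := [seq (p.1 - v t (u t p.1), p.2) | p <- L0 (i, j)].
have my : max_sum (y + ((eta * C) *: tensor_unit V W)%:M).
  have -> : C = \sum_i \sum_j \sum_(p <- L i j) nu p.2.
    by apply: eq_bigr => i _; apply: eq_bigr => j _; rewrite big_map.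
  apply: max_sum_error_sum => // [i j|i j|i j p /mapP[p0 p0L ->]].
  - rewrite !mxE stE linearB -ThS -stE.
    by rewrite (min_cone_selfadjoint mx).
  - rewrite mxE (hL0 (i, j)) linear_sum -sumrB big_map; apply: eq_bigr => p _.
    by rewrite ThE tensDl tensNl.
  - suff /(opnZ (-1)) : opn (v t (u t p0.1) - p0.1) eta.
      by rewrite scaleN1r opprB normrN1 mul1r.
    apply: ht.
    have : p0.1 \in flatten [seq [seq p.1 | p <- L0 ij] | ij <- enum {: 'I_n * 'I_n}].
      apply/flatten_mapP; exists (i, j); rewrite ?mem_enum //.
      by apply/mapP; exists p0.
    move: (flatten _) p0.1 => s b; elim: s => //= c s ih.
    by rewrite in_cons => /orP[/eqP ->|/ih]; [left|right].
have pK : psd (fun i j : 'I_n => (i == j)%:R * (e - eta * C)).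
  have ec : 0 <= e - eta * C.
    rewrite subr_ge0 /eta mulrAC -mulrA; apply: ler_piMr; first exact: ltW.
    by rewrite ler_pdivrMr ?ltr_wpDl // mul1r lerDl.
  exact: psd_diag.
(* [x + e] splits as [Th x], plus [x - Th x + eta * C], plus [e - eta * C]; the choice of [eta]
   makes the last one nonnegative. *)
have := max_sumD mTh (max_sumD my (max_sum_psd V W pK)).
congr (max_sum _); apply/matrixP => i j; rewrite !mxE.
rewrite addrA addrA [Th _ + _]addrC subrK -addrA; congr (_ + _).
by case: (i == j); rewrite ?mulr1n ?mulr0n ?mul0r ?scale0r ?addr0 // mul1r -scalerDl addrC subrK.
Qed.

End CPFPNuclear.

(** * Complexification *)

Section Complexify.
Local Open Scope complex_scope.
Variable R : realType.
Local Notation F := (realScalars R).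
Local Notation C := (complexScalars R).

(* The entries of [[x, -y], [y, x]], with rows and columns indexed by booleans. *)
Definition rot_entry (U : zmodType) (a b : bool) (x y : U) : U :=
  if a then (if b then x else y) else if b then - y else x.

Lemma psdD (I : finType) (K L : I -> I -> R) :
  psd K -> psd L -> psd (fun i j => K i j + L i j).
Proof.
move=> pK pL; apply: eq_psd (@psd_sum _ bool I (fun b => if b then K else L) _).
  by move=> i j; rewrite big_bool.
by case.
Qed.

Lemma psdZ (I : finType) (a : R) (K : I -> I -> R) :
  0 <= a -> psd K -> psd (fun i j => a * K i j).
Proof.
move=> a0 [sK pK]; split=> [i j|y]; first by rewrite sK.
have := mulr_ge0 a0 (pK y); congr (_ <= _).
rewrite mulr_sumr; apply: eq_bigr => i _; rewrite mulr_sumr; apply: eq_bigr => j _.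
by rewrite !mulrA.
Qed.

Lemma sum_bool_pair (U : nmodType) (I : finType) (G : bool * I -> U) :
  \sum_a G a = \sum_i (G (true, i) + G (false, i)).
Proof. by rewrite sum_pair big_bool big_split. Qed.

(** Real and imaginary parts of the test vectors turn the real part of the hermitian form into the
    real form of [[Re, -Im], [Im, Re]], the index [true] carrying imaginary parts. The imaginary
    part of the form vanishes by selfadjointness. *)
Lemma complex_mx_kernelP q k (Z : 'M[mx_opsys C q]_k) :
  poscone Z <-> psd (fun a b : bool * ('I_k * 'I_q) =>
    let z := (Z a.2.1 b.2.1 : 'M[R[i]]_q) a.2.2 b.2.2 in
    rot_entry a.1 b.1 (complex.Re z) (complex.Im z)).
Proof.
pose z (a b : 'I_k * 'I_q) : R[i] := (Z a.1 b.1 : 'M[R[i]]_q) a.2 b.2.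
pose form (h : 'I_k -> 'cV[R[i]]_q) : R[i] :=
  \sum_i \sum_j @cV_dot C q (mx_op (Z i j) (h j)) (h i).
have formE h : form h = \sum_a \sum_b z a b * h b.1 b.2 0 * conjc (h a.1 a.2 0).
  rewrite sum_pair; apply: eq_bigr => i _.
  under [RHS]eq_bigr do rewrite sum_pair /=.
  rewrite [RHS]exchange_big /=; apply: eq_bigr => j _.
  rewrite /cV_dot; apply: eq_bigr => p _.
  by rewrite /mx_op mxE mulr_suml.
have ReD : {morph @complex.Re R : a b / a + b} by case=> ? ? [].
have ReE h : complex.Re (form h) =
    \sum_(a : bool * ('I_k * 'I_q)) \sum_(b : bool * ('I_k * 'I_q))
      rot_entry a.1 b.1 (complex.Re (z a.2 b.2)) (complex.Im (z a.2 b.2)) *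
      (if b.1 then complex.Im (h b.2.1 b.2.2 0) else complex.Re (h b.2.1 b.2.2 0)) *
      (if a.1 then complex.Im (h a.2.1 a.2.2 0) else complex.Re (h a.2.1 a.2.2 0)).
  rewrite formE (big_morph _ ReD (erefl _)) sum_bool_pair.
  apply: eq_bigr => a _; rewrite !sum_bool_pair -!big_split /=.
  rewrite (big_morph _ ReD (erefl _)); apply: eq_bigr => b _.
  case: (z a b) (h b.1 b.2 0) (h a.1 a.2 0) => [x y] [s t] [s' t'] /=.
  by rewrite /rot_entry /=; ring.
have hermE : (forall a b, conjc (z a b) = z b a) <-> selfadjoint_mx Z.
  split=> [hz i j|sZ [i p] [j q']]; last first.
    by have /matrixP/(_ q' p) := sZ i j; rewrite !mxE.
  by apply/matrixP => p q'; rewrite !mxE; exact: hz (i, q') (j, p).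
have ImE h : selfadjoint_mx Z -> complex.Im (form h) = 0.
  move=> /hermE hz; suff : conjc (form h) = form h.
    by case: (form h) => a b [] /= ?; lra.
  rewrite formE rmorph_sum; under eq_bigr do rewrite rmorph_sum.
  rewrite exchange_big; apply: eq_bigr => a _; apply: eq_bigr => b _.
  by rewrite !rmorphM /= conjcK hz mulrAC.
split=> [[sZ pZ]|[sK pK]].
  split=> [[a i] [b j] /=|y].
    rewrite -/(z i j) -/(z j i) -((hermE.2 sZ) i j); case: (z i j) => s t.
    by rewrite /rot_entry; case: a; case: b => /=; rewrite ?opprK.
  have := pZ (fun i => \col_p (y (false, (i, p)) +i* y (true, (i, p)))).
  rewrite lecE /= => /andP[_]; rewrite -/(form _) ReE.
  congr (_ <= _); apply: eq_bigr => -[a [i p]] _; apply: eq_bigr => -[b [j q']] _ /=.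
  by rewrite !mxE /=; case: a; case: b.
have sZ : selfadjoint_mx Z.
  apply/hermE => a b; have := sK (false, a) (false, b); have := sK (false, a) (true, b).
  rewrite /rot_entry /= -/(z a b) -/(z b a).
  by case: (z a b) (z b a) => [s t] [s' t'] /= <- ->.
split=> // h; rewrite lecE /= -/(form h) ImE // eqxx ReE.
exact: (pK (fun a => if a.1 then complex.Im (h a.2.1 a.2.2 0) else complex.Re (h a.2.1 a.2.2 0))).
Qed.

Definition real_index n (a : bool * 'I_n) : 'I_(n + n) :=
  if a.1 then rshift n a.2 else lshift n a.2.
Definition real_unindex n (k : 'I_(n + n)) : bool * 'I_n :=
  match split k with inl i => (false, i) | inr i => (true, i) end.

Lemma real_indexK n : cancel (@real_index n) (@real_unindex n).
Proof.
by case=> -[] i; rewrite /real_unindex /real_index /= ?(unsplitK (inr i)) ?(unsplitK (inl i)).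
Qed.

Lemma real_unindexK n : cancel (@real_unindex n) (@real_index n).
Proof.
by move=> k; rewrite /real_unindex; case: (splitP k) => j e; apply: val_inj.
Qed.

(** Symmetry of the doubled kernel contains both adjoint conditions of
    [complexification_poscone]. *)
Lemma complexification_kernelP (V : opsys F) n (z : 'M[complexification V]_n) :
  poscone z <-> pos_kernel (fun a b : bool * 'I_n =>
    rot_entry a.1 b.1 (z a.2 b.2).1 (z a.2 b.2).2).
Proof.
pose x : 'M[V]_n := map_mx fst z; pose y : 'M[V]_n := map_mx snd z.
have bE a b : block_mx x (- y) y x (real_index a) (real_index b) =
    rot_entry a.1 b.1 (z a.2 b.2).1 (z a.2 b.2).2.
  case: a b => -[] i [[] j]; rewrite /real_index /rot_entry /=;
    by rewrite ?block_mxEul ?block_mxEur ?block_mxEdl ?block_mxEdr !mxE.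
split=> [/complexification_poscone[_ _ /poscone_kernel]|pK].
  by move=> /(pos_kernel_reindex (@real_index n)); apply: eq_pos_kernel.
apply/complexification_poscone; split.
- by move=> i j; have := pK.1 (false, i) (false, j); rewrite /rot_entry /= !mxE.
- by move=> i j; have := pK.1 (true, i) (false, j); rewrite /rot_entry /= !mxE.
- apply/poscone_kernel; apply: eq_pos_kernel (pos_kernel_reindex (@real_unindex n) pK) => i j.
  by rewrite -bE !real_unindexK.
Qed.

Section RealToComplex.
Variables (V : opsys F) (n : nat).
Local Notation Vc := (complexification V).

(** Applying [u] entrywise commutes with forming the doubled real matrix, so positivity at size 2k
    over the reals gives positivity at size k over the complexes. *)
Lemma ucp_complexify_to (u : {linear V -> mx_opsys F n}) : ucp u ->
  exists2 uc : {linear Vc -> mx_opsys C n}, ucp uc &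
    forall x, uc x = \matrix_(i, j) ((u x.1 : 'M[R]_n) i j +i* (u x.2 : 'M[R]_n) i j).
Proof.
move=> uu.
have [|uc ucE] := @linear_witness C Vc (mx_opsys C n)
    (fun x => \matrix_(i, j) ((u x.1 : 'M[R]_n) i j +i* (u x.2 : 'M[R]_n) i j)).
  move=> [a b] [x x'] [y y']; apply/matrixP => i j; rewrite !mxE /=.
  rewrite !(linearD, linearB, linearZ_LR) !mxE; simpc.
  by rewrite linearN mxE mulrN.
exists uc => //; split=> [|k z /complexification_kernelP pz].
  rewrite ucE uu.1 linear0; apply/matrixP => i j; rewrite !mxE.
  by case: (i == j).
apply/complex_mx_kernelP.
apply: eq_psd (psd_reindex (fun a : bool * ('I_k * 'I_n) => ((a.1, a.2.1), a.2.2))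
  ((mx_kernelP _).1 (ucp_kernel uu pz))) => -[a [i p]] [b [j q]] /=.
by rewrite !mxE ucE mxE /rot_entry /=; case: a; case: b; rewrite ?linearN ?mxE.
Qed.

Lemma ucp_complexify_from (v : {linear mx_opsys F n -> V}) : ucp v ->
  exists2 vc : {linear mx_opsys C n -> Vc}, ucp vc &
    forall M : 'M[R[i]]_n, vc M =
      (v (map_mx (@complex.Re R) M), v (map_mx (@complex.Im R) M)).
Proof.
move=> uv.
have [|vc vcE] := @linear_witness C (mx_opsys C n) Vc
    (fun M : 'M[R[i]]_n => (v (map_mx (@complex.Re R) M), v (map_mx (@complex.Im R) M))).
  move=> [a b] x y; apply: (@injective_projections V V) => /=;
    rewrite -!linearZ_LR -?linearN -!linearD; congr (v _);
    by apply/matrixP => i j; rewrite !mxE; case: (x i j) (y i j) => [s t] [s' t'] /=; simpc.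
exists vc => //; split=> [|k Z /complex_mx_kernelP pZ].
  rewrite vcE; apply: (@injective_projections V V) => /=.
    rewrite -uv.1; congr (v _); apply/matrixP => i j; rewrite !mxE.
    by case: (i == j).
  rewrite -[RHS](linear0 v); congr (v _); apply/matrixP => i j; rewrite !mxE.
  by case: (i == j).
apply/complexification_kernelP.
have pM : pos_kernel (V := mx_opsys F n) (fun a b : bool * 'I_k =>
    rot_entry a.1 b.1 (map_mx (@complex.Re R) (Z a.2 b.2 : 'M[R[i]]_n))
                      (map_mx (@complex.Im R) (Z a.2 b.2 : 'M[R[i]]_n))).
  apply/mx_kernelP.
  apply: eq_psd (psd_reindex (fun a : (bool * 'I_k) * 'I_n => (a.1.1, (a.1.2, a.2))) pZ).
  by move=> [[a i] p] [[b j] q] /=; rewrite /rot_entry; case: a; case: b; rewrite !mxE.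
apply: eq_pos_kernel (ucp_kernel uv pM) => -[a i] [b j] /=.
by rewrite !mxE vcE /rot_entry /=; case: a; case: b; rewrite ?linearN.
Qed.

End RealToComplex.
End Complexify.

(** * Transfer of the factorization property to and from the complexification *)

Section ComplexCPFP.
Local Open Scope complex_scope.
Variables (R : realType) (V : opsys (realScalars R)).
Local Notation F := (realScalars R).
Local Notation C := (complexScalars R).
Local Notation Vc := (complexification V).
Local Notation H := (opsys_space V).
Local Notation ip := (dotp H : H -> H -> R).
Local Notation op := (opsys_op V : V -> H -> H).

Lemma opn_complexification (d : cplx V) (e : R) :
  opn d.1 (e / 2) -> opn d.2 (e / 2) ->
  @opnorm_le C (cplx_hilbert H) (cplx_op d) e%:C.
Proof.
move=> h1 h2 [a b]; rewrite /= !cplx_dotE -rmorphXn -rmorphM lecR /=.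
have := ip_parallelogram (op d.1 a) (- op d.2 b).
have := ip_parallelogram (op d.1 b) (op d.2 a).
have := h1.2 a; have := h1.2 b; have := h2.2 a; have := h2.2 b.
rewrite ![ip (- _) (- _)]ipNl ![ip _ (- op d.2 b)]ipNr opprK.
have -> : (e / 2) ^+ 2 = e ^+ 2 / 4 by field.
move: (e ^+ 2) => E.
rewrite -/(ip a a) -/(ip b b).
move: (ip a a) (ip b b) => A B; lra.
Qed.

Lemma CPFP_complexification : CPFP V -> CPFP Vc.
Proof.
move=> [I [le [n [u [v [dir uu uv conv]]]]]].
pose U t := cid2 (ucp_complexify_to (uu t)); pose W t := cid2 (ucp_complexify_from (uv t)).
exists I, le, n, (fun t => s2val (U t)), (fun t => s2val (W t)); split=> //.
- by move=> t; exact: s2valP (U t).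
- by move=> t; exact: s2valP (W t).
move=> x -[e e']; rewrite ltcE /= => /andP[/eqP -> e0].
have e20 : 0 < e / 2 by rewrite divr_gt0.
have [t1 h1] := conv x.1 _ e20; have [t2 h2] := conv x.2 _ e20.
have [_ _ ltr ldir] := dir; have [t0 t10 t20] := ldir t1 t2.
exists t0 => t t0t; apply: opn_complexification.
  apply/opnP; first exact: ltW.
  have := h1 t (ltr _ _ _ t10 t0t); congr (opnorm_le (opsys_op V _) _).
  rewrite (s2valP' (W t)) (s2valP' (U t)) /=; congr (v t _ - _).
  by apply/matrixP => i j; rewrite !mxE.
apply/opnP; first exact: ltW.
have := h2 t (ltr _ _ _ t20 t0t); congr (opnorm_le (opsys_op V _) _).
rewrite (s2valP' (W t)) (s2valP' (U t)) /=; congr (v t _ - _).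
by apply/matrixP => i j; rewrite !mxE.
Qed.

Section ComplexToReal.
Variable n : nat.

Definition realify (M : 'M[R[i]]_n) : 'M[R]_(n + n) :=
  \matrix_(p, q) rot_entry (real_unindex p).1 (real_unindex q).1
    (complex.Re (M (real_unindex p).2 (real_unindex q).2))
    (complex.Im (M (real_unindex p).2 (real_unindex q).2)).

(** The left inverse of [realify] obtained by averaging: both diagonal blocks contribute to the real
    part, both off-diagonal blocks to the imaginary part. *)
Definition complex_part (M : 'M[R]_(n + n)) : 'M[R[i]]_n :=
  let m a b p q := M (real_index (a, p)) (real_index (b, q)) in
  \matrix_(p, q) (((m false false p q + m true true p q) / 2) +i*
                  ((m true false p q - m false true p q) / 2)).

Lemma realifyK M : complex_part (realify M) = M.
Proof.
apply/matrixP => p q; rewrite !mxE !real_indexK /rot_entry /=.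
by case: (M p q) => s t /=; congr (_ +i* _); field.
Qed.

Lemma ucp_realify (u : {linear Vc -> mx_opsys C n}) : ucp u ->
  exists2 ur : {linear V -> mx_opsys F (n + n)}, ucp ur &
    forall x, ur x = realify (u (x, 0)).
Proof.
move=> uu.
have [|ur urE] := @linear_witness F V (mx_opsys F (n + n)) (fun x => realify (u (x, 0))).
  move=> a x y.
  have -> : (a *: x + y, 0) = a%:C *: ((x, 0) : cplx V) + ((y, 0) : cplx V) :> cplx V.
    by apply: (@injective_projections V V) => /=; rewrite ?scaler0 ?scale0r ?subr0 ?addr0.
  rewrite linearP; apply/matrixP => p q; rewrite !mxE.
  case: (u (x, 0) _ _) (u (y, 0) _ _) => [s t] [s' t'] /=; rewrite /rot_entry.
  by case: (real_unindex p).1; case: (real_unindex q).1; simpc => //=; ring.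
exists ur => //; apply: kernel_ucp => [|k X pX].
  rewrite urE -[(_, 0)]/(opsys_unit Vc) uu.1; apply/matrixP => p q; rewrite !mxE.
  rewrite -(inj_eq (can_inj (@real_unindexK n))) /rot_entry.
  case: (real_unindex p) (real_unindex q) => [a i] [b j] /=; rewrite xpair_eqE.
  by case: (i == j); case: a; case: b => //=; rewrite oppr0.
pose z : 'M[Vc]_k := \matrix_(i, j) (X i j, 0).
have pz : poscone z.
  apply/complexification_kernelP.
  have pb : psd (fun a b : bool * 'I_k => (a.1 == b.1)%:R : R).
    have pu : psd (fun a b : bool => (a == b)%:R : R).
      apply: eq_psd (psd_gram (fun t a : bool => (t == a)%:R : R)) => a b.
      by rewrite big_bool; case: a; case: b; rewrite /= !(mul0r, mulr0, mul1r, addr0, add0r).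
    exact: (psd_reindex fst pu).
  apply: eq_pos_kernel (pos_kernel_schur pb (pos_kernel_reindex snd pX)) => -[a i] [b j] /=.
  by rewrite !mxE /rot_entry /=; case: a; case: b; rewrite /= ?scale1r ?scale0r ?oppr0.
have /complex_mx_kernelP := uu.2 _ _ pz.
move=> /(psd_reindex (fun a : 'I_k * 'I_(n + n) =>
   ((real_unindex a.2).1, (a.1, (real_unindex a.2).2)))) pK.
by apply/mx_kernelP; apply: eq_psd pK => -[i p] [j q] /=; rewrite urE !mxE.
Qed.

Lemma ucp_real_part (v : {linear mx_opsys C n -> Vc}) : ucp v ->
  exists2 vr : {linear mx_opsys F (n + n) -> V}, ucp vr &
    forall M, vr M = (v (complex_part M)).1.
Proof.
move=> uv.
have [|vr vrE] := @linear_witness F (mx_opsys F (n + n)) V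
    (fun M => (v (complex_part M)).1).
  move=> a x y.
  have -> : complex_part (a *: x + y) = a%:C *: complex_part x + complex_part y.
    by apply/matrixP => p q; rewrite !mxE; simpc; congr (_ +i* _); ring.
  by rewrite linearP /= scale0r subr0.
exists vr => //; apply: kernel_ucp => [|k X /mx_kernelP pX].
  rewrite vrE.
  have -> : complex_part (opsys_unit (mx_opsys F (n + n))) = 1%:M.
    apply/matrixP => p q; rewrite !mxE !(inj_eq (can_inj (@real_indexK n))) !xpair_eqE /=.
    by case: (p == q); rewrite /= ?mulr0n ?mulr1n; congr (_ +i* _); field.
  by rewrite [v _]uv.1.
pose Z : 'M[mx_opsys C n]_k := \matrix_(i, j) complex_part (X i j).
have pZ : poscone Z.
  apply/complex_mx_kernelP.
  (* [g] and the signs [sg] conjugate by the rotation [[0, -1], [1, 0]]; half the sum of the matrix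
     and its conjugate is the doubled form of [complex_part]. *)
  pose f (a : bool * ('I_k * 'I_n)) := (a.2.1, real_index (a.1, a.2.2)).
  pose g (a : bool * ('I_k * 'I_n)) := (a.2.1, real_index (~~ a.1, a.2.2)).
  pose sg (a : bool) : R := if a then -1 else 1.
  have psg := psd_gram (fun (t : 'I_1) (a : bool * ('I_k * 'I_n)) => sg a.1).
  have half : 0 <= 2^-1 :> R by rewrite invr_ge0.
  have := psdZ half (psdD (psd_reindex f pX) (psd_schur psg (psd_reindex g pX))).
  apply: eq_psd => -[a [i p]] [b [j q]] /=; rewrite big_ord1 !mxE /rot_entry /sg.
  by case: a; case: b => /=; field.
have /complexification_kernelP := uv.2 _ _ pZ.
move=> /(pos_kernel_reindex (fun i : 'I_k => (false, i))).
by apply: eq_pos_kernel => i j; rewrite /rot_entry /= !mxE vrE.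
Qed.

End ComplexToReal.

(** By [realifyK] the real maps compose to the first component of [v t (u t (x, 0))], and the
    complex norm estimate at vectors [(h, 0)] bounds that component. *)
Lemma CPFP_of_complexification : CPFP Vc -> CPFP V.
Proof.
move=> [I [le [n [u [v [dir uu uv conv]]]]]].
pose U t := cid2 (ucp_realify (uu t)); pose W t := cid2 (ucp_real_part (uv t)).
exists I, le, (fun t => (n t + n t)%N), (fun t => s2val (U t)), (fun t => s2val (W t)); split=> //.
- by move=> t; exact: s2valP (U t).
- by move=> t; exact: s2valP (W t).
move=> x e e0; have [|t0 ht0] := conv (x, 0) e%:C; first by rewrite ltcR.
exists t0 => t /ht0 ht h.
rewrite (s2valP' (W t)) (s2valP' (U t)) realifyK.
have := ht (h, 0); rewrite /= !cplx_dotE -rmorphXn -rmorphM lecR /=.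
rewrite ip0l addr0; apply: le_trans.
by rewrite !op0r subr0 lerDl ip_ge0.
Qed.

End ComplexCPFP.

(** * Hilbert sums *)

Section UnorderedSums.
Variables (R : realType) (I : choiceType).
Implicit Types u v w : I -> R.

(** Duplicate-free lists stand for finite subsets. Unordered sums appear because the dual system
    below has one summand for each normalized positive matrix, a possibly uncountable family. *)
Definition fsums u : set R := fun x => exists2 s, uniq s & x = \sum_(i <- s) u i.
Definition bounded_sums u := exists B, forall s, uniq s -> \sum_(i <- s) u i <= B.
Definition nsum u : R := sup (fsums u).

Lemma fsums_nonempty u : (fsums u !=set0)%classic.
Proof. by exists 0; exists [::]; rewrite ?big_nil. Qed.

Lemma nsum_ge u s : bounded_sums u -> uniq s -> \sum_(i <- s) u i <= nsum u.
Proof.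
move=> [B hB] us; apply: (@sup_upper_bound _ (fsums u)); last by exists s.
by split; [exact: fsums_nonempty | exists B => _ [t ut ->]; exact: hB].
Qed.

Lemma nsum_le u B : (forall s, uniq s -> \sum_(i <- s) u i <= B) -> nsum u <= B.
Proof. by move=> hB; apply: ge_sup => [|_ [s us ->]]; [exact: fsums_nonempty | exact: hB]. Qed.

Lemma nsum_ge0 u : bounded_sums u -> 0 <= nsum u.
Proof. by move=> bu; have := @nsum_ge u [::] bu; rewrite big_nil; apply. Qed.

Lemma nsum_ge1 u i : bounded_sums u -> u i <= nsum u.
Proof. by move=> bu; have := @nsum_ge u [:: i] bu; rewrite big_seq1; apply. Qed.

Lemma bounded_sums_le u v : (forall i, u i <= v i) -> bounded_sums v -> bounded_sums u.
Proof.
move=> uv [B hB]; exists B => s us; apply: le_trans (hB s us).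
by apply: ler_sum.
Qed.

Lemma bounded_sumsD u v : bounded_sums u -> bounded_sums v ->
  bounded_sums (fun i => u i + v i).
Proof.
move=> [B hB] [C hC]; exists (B + C) => s us.
by rewrite big_split lerD ?hB ?hC.
Qed.

Lemma bounded_sumsZ (a : R) u : 0 <= a -> bounded_sums u ->
  bounded_sums (fun i => a * u i).
Proof.
by move=> a0 [B hB]; exists (a * B) => s us; rewrite -mulr_sumr ler_wpM2l ?hB.
Qed.

Lemma bounded_sums0 : bounded_sums (fun=> 0).
Proof. by exists 0 => s _; rewrite big1. Qed.

Lemma ler_sum_uniq u (s t : seq I) : (forall i, 0 <= u i) -> uniq s -> uniq t ->
  {subset s <= t} -> \sum_(i <- s) u i <= \sum_(i <- t) u i.
Proof.
move=> u0 us ut st; rewrite [leRHS](bigID (mem s)) /=.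
have -> : \sum_(i <- t | i \in s) u i = \sum_(i <- s) u i.
  rewrite -big_filter; apply: perm_big; apply: uniq_perm; rewrite ?filter_uniq // => i.
  by rewrite mem_filter; case: (boolP (i \in s)) => //= /st.
by rewrite lerDl sumr_ge0.
Qed.

Lemma nsumD u v : (forall i, 0 <= u i) -> (forall i, 0 <= v i) ->
  bounded_sums u -> bounded_sums v -> nsum (fun i => u i + v i) = nsum u + nsum v.
Proof.
move=> u0 v0 bu bv; have buv := bounded_sumsD bu bv.
apply/eqP; rewrite eq_le; apply/andP; split.
  by apply: nsum_le => s us; rewrite big_split lerD ?nsum_ge.
rewrite -lerBrDr; apply: nsum_le => s us.
rewrite lerBrDr addrC -lerBrDr; apply: nsum_le => t ut.
rewrite lerBrDr; apply: le_trans (nsum_ge buv (undup_uniq (s ++ t))).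
rewrite big_split addrC lerD // ler_sum_uniq ?undup_uniq // => i;
  by rewrite mem_undup mem_cat => ->; rewrite ?orbT.
Qed.

Lemma nsumZ (a : R) u : 0 <= a -> bounded_sums u ->
  nsum (fun i => a * u i) = a * nsum u.
Proof.
move=> a0 bu; have bau := bounded_sumsZ a0 bu.
have [->|an0] := eqVneq a 0.
  rewrite mul0r; apply/eqP; rewrite eq_le; apply/andP; split.
    by apply: nsum_le => s _; rewrite big1 // => i _; rewrite mul0r.
  by apply: nsum_ge0; apply: bounded_sums_le bounded_sums0 => i; rewrite mul0r.
have ag0 : 0 < a by rewrite lt_neqAle eq_sym an0.
apply/eqP; rewrite eq_le; apply/andP; split.
  by apply: nsum_le => s us; rewrite -mulr_sumr ler_wpM2l ?nsum_ge.
rewrite mulrC -ler_pdivlMr //; apply: nsum_le => s us.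
by rewrite ler_pdivlMr // mulrC mulr_sumr nsum_ge.
Qed.

Definition summable u := bounded_sums (fun i => `|u i|).
(** A signed sum as a difference of nonnegative ones. By [lsumE] every [w >= 0] with bounded sums
    and [u + w >= 0] gives the same value, and additivity rests on that freedom. *)
Definition lsum u : R := nsum (fun i => u i + `|u i|) - nsum (fun i => `|u i|).

Lemma add_norm_ge0 u i : 0 <= u i + `|u i|.
Proof. by rewrite -lerBlDl sub0r -normrN ler_norm. Qed.

Lemma bounded_add_norm u : summable u -> bounded_sums (fun i => u i + `|u i|).
Proof.
move=> su; apply: bounded_sums_le (bounded_sumsD su su) => i.
by rewrite lerD2r ler_norm.
Qed.

Lemma lsumE u w : summable u -> (forall i, 0 <= w i) -> (forall i, 0 <= u i + w i) ->
  bounded_sums w -> lsum u = nsum (fun i => u i + w i) - nsum w.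
Proof.
move=> su w0 uw0 bw; have bu := bounded_add_norm su; have u0 := add_norm_ge0 u.
have buw : bounded_sums (fun i => u i + w i).
  by apply: bounded_sums_le (bounded_sumsD su bw) => i; rewrite lerD2r ler_norm.
apply/eqP; rewrite /lsum subr_eq addrAC eq_sym subr_eq; apply/eqP.
rewrite -!nsumD //; congr nsum; apply/funext => i.
by rewrite addrAC.
Qed.

Lemma summableD u v : summable u -> summable v -> summable (fun i => u i + v i).
Proof.
by move=> su sv; apply: bounded_sums_le (bounded_sumsD su sv) => i; exact: ler_normD.
Qed.

Lemma summableZ (a : R) u : summable u -> summable (fun i => a * u i).
Proof.
move=> su; apply: bounded_sums_le (bounded_sumsZ (normr_ge0 a) su) => i.
by rewrite normrM.
Qed.

Lemma lsumD u v : summable u -> summable v ->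
  lsum (fun i => u i + v i) = lsum u + lsum v.
Proof.
move=> su sv; have u0 := add_norm_ge0 u; have v0 := add_norm_ge0 v.
rewrite (@lsumE _ (fun i => `|u i| + `|v i|)) //.
- rewrite /lsum (nsumD _ _ su sv) //.
  have -> : (fun i => u i + v i + (`|u i| + `|v i|)) =
      (fun i => (u i + `|u i|) + (v i + `|v i|)).
    by apply/funext => i; rewrite addrACA.
  rewrite nsumD //; [ring | exact: bounded_add_norm | exact: bounded_add_norm].
- exact: summableD.
- by move=> i; exact: addr_ge0.
- by move=> i; rewrite addrACA addr_ge0.
- exact: bounded_sumsD.
Qed.

Lemma lsum_nsum u : (forall i, 0 <= u i) -> bounded_sums u -> lsum u = nsum u.
Proof.
move=> u0 bu; have su : summable u.
  by apply: bounded_sums_le bu => i; rewrite ger0_norm.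
rewrite (lsumE su (w := fun=> 0)) //; last exact: bounded_sums0.
- rewrite [X in _ - X](_ : _ = 0) ?subr0.
    by congr nsum; apply/funext => i; rewrite addr0.
  apply/eqP; rewrite eq_le nsum_ge0 ?andbT; last exact: bounded_sums0.
  by apply: nsum_le => s _; rewrite big1.
- by move=> i; rewrite addr0.
Qed.

Lemma lsumZ (a : R) u : summable u -> lsum (fun i => a * u i) = a * lsum u.
Proof.
move=> su; have bu := bounded_add_norm su; have u0 := add_norm_ge0 u.
have pos b : 0 <= b -> lsum (fun i => b * u i) = b * lsum u.
  move=> b0; rewrite (@lsumE _ (fun i => b * `|u i|)).
  - rewrite /lsum mulrBr -!nsumZ //; congr (nsum _ - _).
    by apply/funext => i; rewrite mulrDr.
  - exact: summableZ.
  - by move=> i; rewrite mulr_ge0.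
  - by move=> i; rewrite -mulrDr mulr_ge0.
  - exact: bounded_sumsZ.
have [a0|a0] := leP 0 a; first exact: pos.
have sum0 : lsum (fun i => a * u i) + lsum (fun i => - a * u i) = 0.
  rewrite -lsumD; try exact: summableZ.
  rewrite lsum_nsum => [|i|]; last 2 first.
  - by rewrite mulNr subrr.
  - by apply: bounded_sums_le bounded_sums0 => i; rewrite mulNr subrr.
  apply/eqP; rewrite eq_le; apply/andP; split.
    by apply: nsum_le => s _; rewrite big1 // => i _; rewrite mulNr subrr.
  by apply: nsum_ge0; apply: bounded_sums_le bounded_sums0 => i; rewrite mulNr subrr.
move/eqP: sum0; rewrite addr_eq0 => /eqP ->.
by rewrite pos ?oppr_ge0 ?ltW // mulNr opprK.
Qed.

Lemma lsum_ge0 u : (forall i, 0 <= u i) -> bounded_sums u -> 0 <= lsum u.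
Proof. by move=> u0 bu; rewrite lsum_nsum // nsum_ge0. Qed.

End UnorderedSums.

Section HilbertSum.
Variables (R : realType) (I : choiceType) (H : I -> hilbert (realScalars R)).
Local Notation F := (realScalars R).
Local Notation ip i := (dotp (H i) : H i -> H i -> R).

Record hsum := HSum {
  hsum_fun :> forall i, H i;
  hsum_bounded : bounded_sums (fun i => ip i (hsum_fun i) (hsum_fun i)) }.

Lemma hsum_ext (x y : hsum) : (forall i, x i = y i) -> x = y.
Proof.
case: x y => [x bx] [y by'] /= xy.
have e : x = y by exact: functional_extensionality_dep.
by subst y; congr HSum; exact: Prop_irrelevance.
Qed.

HB.instance Definition _ := gen_eqMixin hsum.
HB.instance Definition _ := gen_choiceMixin hsum.

Let zero_bounded : bounded_sums (fun i => ip i (0 : H i) (0 : H i)).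
Proof. by apply: bounded_sums_le (bounded_sums0 _ _) => i; rewrite ip0l. Qed.

Let add_bounded (x y : hsum) :
  bounded_sums (fun i => ip i (x i + y i) (x i + y i)).
Proof.
have b2 : 0 <= 2 :> R by [].
apply: bounded_sums_le
  (bounded_sumsZ b2 (bounded_sumsD (hsum_bounded x) (hsum_bounded y))) => i.
by rewrite mulr_natl; exact: ip_parallelogram.
Qed.

Let scale_bounded (a : R) (x : hsum) :
  bounded_sums (fun i => ip i (a *: x i) (a *: x i)).
Proof.
apply: bounded_sums_le (bounded_sumsZ (sqr_ge0 a) (hsum_bounded x)) => i.
by rewrite ipZl ipZr mulrA.
Qed.

Let opp_bounded (x : hsum) : bounded_sums (fun i => ip i (- x i) (- x i)).
Proof.
by apply: bounded_sums_le (hsum_bounded x) => i; rewrite ipNl ipNr opprK.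
Qed.

Definition hsum0 := HSum zero_bounded.
Definition hsum_add x y := HSum (add_bounded x y).
Definition hsum_opp x := HSum (opp_bounded x).
Definition hsum_scale (a : R) x := HSum (scale_bounded a x).

Let addA : associative hsum_add.
Proof. by move=> x y z; apply: hsum_ext => i; exact: addrA. Qed.
Let addC : commutative hsum_add.
Proof. by move=> x y; apply: hsum_ext => i; exact: addrC. Qed.
Let add0 : left_id hsum0 hsum_add.
Proof. by move=> x; apply: hsum_ext => i; exact: add0r. Qed.
Let addN : left_inverse hsum0 hsum_opp hsum_add.
Proof. by move=> x; apply: hsum_ext => i; exact: addNr. Qed.
HB.instance Definition _ := GRing.isZmodule.Build hsum addA addC add0 addN.

Let scaleA a b x : hsum_scale a (hsum_scale b x) = hsum_scale (a * b) x.
Proof. by apply: hsum_ext => i; exact: scalerA. Qed.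
Let scale1 x : hsum_scale 1 x = x.
Proof. by apply: hsum_ext => i; exact: scale1r. Qed.
Let scaleDr : right_distributive hsum_scale +%R.
Proof. by move=> a x y; apply: hsum_ext => i; exact: scalerDr. Qed.
Let scaleDl x : {morph hsum_scale^~ x : a b / a + b}.
Proof. by move=> a b; apply: hsum_ext => i; exact: scalerDl. Qed.
HB.instance Definition _ := GRing.Zmodule_isLmodule.Build F hsum
  scaleA scale1 scaleDr scaleDl.

Lemma hsumDE (x y : hsum) i : (x + y) i = x i + y i. Proof. by []. Qed.
Lemma hsumNE (x : hsum) i : (- x) i = - x i. Proof. by []. Qed.
Lemma hsumZE (a : R) (x : hsum) i : (a *: x) i = a *: x i. Proof. by []. Qed.
Definition hsum_dot (x y : hsum) : F := lsum (fun i => ip i (x i) (y i)).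

Lemma hsum_summable (x y : hsum) : summable (fun i => ip i (x i) (y i)).
Proof.
apply: bounded_sums_le (bounded_sumsD (hsum_bounded x) (hsum_bounded y)) => i.
have h0 := ip_ge0 (x i - y i); have h1 := ip_ge0 (x i + y i).
have h2 := ip_ge0 (x i); have h3 := ip_ge0 (y i).
move: h0 h1; rewrite !ipE (ipC (y i)) => h0 h1.
by rewrite ler_norml; apply/andP; split; lra.
Qed.

Let dotDl x y z : hsum_dot (x + y) z = hsum_dot x z + hsum_dot y z.
Proof.
rewrite /hsum_dot -lsumD; try exact: hsum_summable.
by congr lsum; apply/funext => i; rewrite hsumDE ipDl.
Qed.
Let dotZl (a : R) x y : hsum_dot (a *: x) y = a * hsum_dot x y.
Proof.
rewrite /hsum_dot -lsumZ; last exact: hsum_summable.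
by congr lsum; apply/funext => i; rewrite hsumZE ipZl.
Qed.
Let dotC x y : hsum_dot x y = hsum_dot y x.
Proof. by congr lsum; apply/funext => i; rewrite ipC. Qed.
Let dotNl x y : hsum_dot (- x) y = - hsum_dot x y.
Proof. by rewrite -scaleN1r dotZl mulN1r. Qed.

Let zmodl y : zmod_morphism (hsum_dot ^~ y).
Proof. by move=> x z; rewrite dotDl dotNl. Qed.
Let zmodr x : zmod_morphism (hsum_dot x).
Proof. by move=> y z; rewrite !(dotC x) dotDl dotNl. Qed.
Let scalel y : scalable_for *%R (hsum_dot ^~ y).
Proof. by move=> a x; exact: dotZl. Qed.
Let scaler x : scalable_for (scalar_conj F \; *%R) (hsum_dot x).
Proof. by move=> a y; rewrite !(dotC x); exact: dotZl. Qed.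

HB.instance Definition _ :=
  isBilinear.Build F hsum hsum F *%R (scalar_conj F \; *%R) hsum_dot
    zmodl zmodr scalel scaler.

Let herm x y : hsum_dot x y = (-1) ^+ false * scalar_conj F (hsum_dot y x).
Proof. by rewrite expr0 mul1r dotC. Qed.
HB.instance Definition _ :=
  isHermitianSesquilinear.Build F hsum false (scalar_conj F) hsum_dot herm.

Lemma hsum_dotE x : hsum_dot x x = nsum (fun i => ip i (x i) (x i)).
Proof. by apply: lsum_nsum; [move=> i; exact: ip_ge0 | exact: hsum_bounded]. Qed.

Let dot_gt0 x : x != 0 -> 0 < hsum_dot x x.
Proof.
move=> x0; have [i xi] : exists i, x i != 0.
  apply: contrapT => /forallNP h; move/eqP: x0; apply; apply: hsum_ext => i.
  by apply/eqP/negPn/negP/h.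
rewrite hsum_dotE; apply: lt_le_trans (nsum_ge1 i (hsum_bounded x)).
exact: (@neq0_dnorm_gt0 _ _ _ (dotp (H i))).
Qed.
HB.instance Definition _ := isDotProduct.Build F hsum hsum_dot dot_gt0.

(** The limit is taken coordinatewise. A partial sum of its distance to [u n] is bounded by
    comparison with a later [u m], where [m] depends on the finite set but the bound does not; the
    parallelogram inequality doubles two errors of [e / 4]. *)
Lemma hsum_complete (u : nat -> hsum) :
  (forall e, 0 < e -> exists N, forall m n, (N <= m)%N -> (N <= n)%N ->
     hsum_dot (u m - u n) (u m - u n) < e) ->
  exists l, forall e, 0 < e -> exists N, forall n, (N <= n)%N ->
     hsum_dot (u n - l) (u n - l) < e.
Proof.
move=> cu.
have /all_sig[l hl] i : {l : H i | forall e : R, 0 < e -> exists N,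
    forall n, (N <= n)%N -> ip i (u n i - l) (u n i - l) < e}.
  apply: cid; apply: (@hilbert_complete F (H i)) => e e0; have [N hN] := cu e e0.
  exists N => m n Nm Nn; apply: le_lt_trans (hN m n Nm Nn).
  rewrite hsum_dotE; exact: (nsum_ge1 i (hsum_bounded (u m - u n))).
have fin (e : R) : 0 < e -> exists N, forall n, (N <= n)%N -> forall s, uniq s ->
    \sum_(i <- s) ip i (u n i - l i) (u n i - l i) <= e.
  move=> e0; have e40 : 0 < e / 4 by rewrite divr_gt0.
  have [N hN] := cu _ e40; exists N => n Nn s us.
  have [M hM] : exists M, forall m, (M <= m)%N ->
      \sum_(i <- s) ip i (u m i - l i) (u m i - l i) <= e / 4.
    elim: s {us} (e / 4) e40 => [|i s ih] d d0; first by exists 0 => m _; rewrite big_nil ltW.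
    have d20 : 0 < d / 2 by rewrite divr_gt0.
    have [M1 h1] := ih _ d20; have [M2 h2] := hl i _ d20.
    exists (maxn M1 M2) => m; rewrite geq_max => /andP[/h1 k1 /h2 k2].
    by rewrite big_cons [d]splitr lerD // ltW.
  have {}hN := hN n (maxn N M) Nn (leq_maxl _ _).
  have {}hM := hM (maxn N M) (leq_maxr _ _).
  set m := maxn N M in hN hM.
  have k1 : \sum_(i <- s) ip i ((u n - u m) i) ((u n - u m) i) <= e / 4.
    apply: le_trans (nsum_ge (hsum_bounded (u n - u m)) us) _.
    by rewrite -hsum_dotE ltW.
  have -> : e = (e / 4 + e / 4) *+ 2 by rewrite mulr2n; field.
  apply: le_trans (_ : _ <= (\sum_(i <- s) (ip i ((u n - u m) i) ((u n - u m) i) +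
       ip i (u m i - l i) (u m i - l i))) *+ 2) _; last first.
    by rewrite big_split lerMn2r lerD.
  rewrite -sumrMnl; apply: ler_sum => i _.
  by apply: le_trans (ip_parallelogram _ _); rewrite hsumDE hsumNE subrKA.
have bl : bounded_sums (fun i => ip i (l i) (l i)).
  have [N hN] := fin 1 ltr01.
  have b2 : 0 <= 2 :> R by [].
  have bd : bounded_sums (fun i => ip i (u N i - l i) (u N i - l i)) by exists 1 => s; exact: hN.
  apply: bounded_sums_le (bounded_sumsZ b2 (bounded_sumsD bd (hsum_bounded (u N)))) => i.
  rewrite mulr_natl; apply: le_trans (_ : _ <= ip i (- (u N i - l i) + u N i) (- (u N i - l i) + u N i)) _.
    by rewrite opprB subrK.
  by apply: le_trans (ip_parallelogram _ _) _; rewrite ipNl ipNr opprK.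
exists (HSum bl) => e e0; have e20 : 0 < e / 2 by rewrite divr_gt0.
have [N hN] := fin _ e20; exists N => n Nn.
apply: (@le_lt_trans _ _ (e / 2)); last by rewrite ltr_pdivrMr // mulr_natr mulr2n ltrDl.
by rewrite hsum_dotE; apply: nsum_le => s us; exact: hN.
Qed.

Definition hsum_hilbert : hilbert F := @Hilbert F hsum hsum_dot hsum_complete.

End HilbertSum.

(** * The dual of a finite-dimensional subsystem *)

Section Biorthogonal.
Variables (R : realType) (V : opsys (realScalars R)).
Local Notation F := (realScalars R).
Local Notation H := (opsys_space V).
Local Notation ip := (dotp H : H -> H -> R).
Local Notation op := (opsys_op V : V -> H -> H).
Local Notation star := (@opsys_star _ V : V -> V).
Local Notation unit := (opsys_unit V : V).

(** An unnormalized vector state, positive by construction; restricted to a subsystem it becomes the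
    unit of the dual. *)
Definition vstate (hs : seq H) (x : V) : R := \sum_(h <- hs) ip (op x h) h.

Lemma vstateP hs (a : R) x y : vstate hs (a *: x + y) = a * vstate hs x + vstate hs y.
Proof.
rewrite /vstate mulr_sumr -big_split; apply: eq_bigr => h _.
by rewrite !opE !ipE.
Qed.

Lemma vstate_form hs k (X : 'I_k -> 'I_k -> V) (y : 'I_k -> R) :
  \sum_p \sum_q vstate hs (X p q) * y q * y p =
  \sum_(h <- hs) \sum_p \sum_q ip (op (X p q) (y q *: h)) (y p *: h).
Proof.
rewrite [RHS]exchange_big; apply: eq_bigr => p _; rewrite [RHS]exchange_big.
apply: eq_bigr => q _; rewrite /vstate !mulr_suml; apply: eq_bigr => h _.
by rewrite opZr ipZl ipZr; ring.
Qed.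

Lemma vstate_form_ge0 hs k (X : 'I_k -> 'I_k -> V) (y : 'I_k -> R) :
  pos_kernel X -> 0 <= \sum_p \sum_q vstate hs (X p q) * y q * y p.
Proof.
by move=> pX; rewrite vstate_form; apply: sumr_ge0 => h _; exact: pX.2.
Qed.

(** A matrix Cauchy-Schwarz inequality: if [vstate hs] takes [X] to the identity matrix, the matrix
    of values of [f] on [X] has squared norm at most [C]. This bounds the operators of the dual
    system uniformly. *)
Definition dominated (hs : seq H) (f : V -> R) : Prop :=
  exists2 C, 0 <= C & forall k (X : 'I_k -> 'I_k -> V), pos_kernel X ->
    forall y z : 'I_k -> R,
    (\sum_p \sum_q f (X p q) * y q * z p) ^+ 2 <=
    C * ((\sum_p \sum_q vstate hs (X p q) * y q * y p) *
         (\sum_p \sum_q vstate hs (X p q) * z q * z p)).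

(** At the vectors [(s * y p) *: h + (t * z p) *: k] the form of [X] is a nonnegative quadratic form
    in [s] and [t]; its discriminant gives the bound. *)
Lemma dominated_vector hs h k : h \in hs -> k \in hs ->
  dominated hs (fun x => ip (op x h) k).
Proof.
move=> hhs khs; exists 1 => // n X pX y z; rewrite mul1r.
pose form g (u : 'I_n -> R) := \sum_p \sum_q ip (op (X p q) (u q *: g)) (u p *: g).
have form0 g u : 0 <= form g u by exact: pX.2.
apply: (@le_trans _ _ (form h y * form k z)); last first.
  have le_form g u : g \in hs -> form g u <= \sum_p \sum_q vstate hs (X p q) * u q * u p.
    move=> ghs; rewrite vstate_form (big_rem g ghs) /= lerDl.
    by apply: sumr_ge0 => ? _; exact: pX.2.
  by apply: ler_pM; rewrite ?form0 ?le_form.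
pose mix := \sum_p \sum_q ip (op (X p q) h) k * y q * z p.
have mixC : \sum_p \sum_q ip (op (X p q) k) h * z q * y p = mix.
  rewrite /mix exchange_big; apply: eq_bigr => p _; apply: eq_bigr => q _ /=.
  by rewrite ip_star pX.1 ipC mulrAC.
apply: quad_discr => s t.
have := pX.2 (fun p => (s * y p) *: h + (t * z p) *: k); congr (_ <= _).
transitivity (s ^+ 2 * form h y + s * t * mix +
    s * t * (\sum_p \sum_q ip (op (X p q) k) h * z q * y p) + t ^+ 2 * form k z).
  rewrite /form /mix !mulr_sumr -!big_split; apply: eq_bigr => p _.
  rewrite !mulr_sumr -!big_split; apply: eq_bigr => q _ /=.
  by rewrite !opE !ipE; ring.
by rewrite mixC -/mix; ring.
Qed.

Lemma dominated_lin hs (a : R) f g : dominated hs f -> dominated hs g ->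
  dominated hs (fun x => a * f x + g x).
Proof.
move=> [C C0 hf] [D D0 hg]; exists ((a ^+ 2 * C + D) *+ 2) => [|k X pX y z].
  by rewrite mulrn_wge0 // addr_ge0 // mulr_ge0 // sqr_ge0.
have hu := hf k X pX y z; have hv := hg k X pX y z.
have -> : \sum_p \sum_q (a * f (X p q) + g (X p q)) * y q * z p =
    a * (\sum_p \sum_q f (X p q) * y q * z p) + \sum_p \sum_q g (X p q) * y q * z p.
  rewrite mulr_sumr -big_split; apply: eq_bigr => p _.
  by rewrite mulr_sumr -big_split; apply: eq_bigr => q _ /=; ring.
move: hu hv; set u := (\sum_p \sum_q f _ * _ * _); set v := (\sum_p \sum_q g _ * _ * _).
set P := (\sum_p \sum_q vstate hs _ * _ * _) * (\sum_p \sum_q vstate hs _ * _ * _).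
move: u v P => u v P hu hv.
have h1 := sqr_ge0 (a * u - v).
have h2 : a ^+ 2 * u ^+ 2 <= a ^+ 2 * (C * P) by rewrite ler_wpM2l ?sqr_ge0.
by nra.
Qed.

Lemma dominated0 hs : dominated hs (fun=> 0).
Proof.
exists 0 => // k X pX y z; rewrite mul0r big1 ?expr0n // => p _.
by rewrite big1 // => q _; rewrite !mul0r.
Qed.

Lemma dominated_sum hs d (a : 'I_d -> R) (f : 'I_d -> V -> R) :
  (forall i, dominated hs (f i)) -> dominated hs (fun x => \sum_i a i * f i x).
Proof.
elim: d a f => [|d ih] a f hf.
  by under [X in dominated hs X]funext do rewrite big_ord0; exact: dominated0.
under [X in dominated hs X]funext do rewrite big_ord_recl.
by apply: dominated_lin => //; exact: ih.
Qed.

Lemma dominated_cat hs1 hs2 f : dominated hs2 f -> dominated (hs1 ++ hs2) f.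
Proof.
move=> [C C0 hf]; exists C => // k X pX y z; apply: le_trans (hf k X pX y z) _.
have le_form u : \sum_p \sum_q vstate hs2 (X p q) * u q * u p <=
    \sum_p \sum_q vstate (hs1 ++ hs2) (X p q) * u q * u p.
  rewrite !vstate_form big_cat /= lerDr; apply: sumr_ge0 => h _; exact: pX.2.
by rewrite ler_wpM2l // ler_pM ?vstate_form_ge0.
Qed.

(** The residual [x'] of a new element is killed by the old coordinates. If it is nonzero, a vector
    functional [f] with [f x' = 1], corrected to vanish on the old basis, is its coordinate. The
    last clause says that the basis lies in the span of [L]. *)
Lemma biorthogonal (L : seq V) : exists hs d (b : 'I_d -> V) (w : 'I_d -> V -> R),
  [/\ forall i (a : R) x y, w i (a *: x + y) = a * w i x + w i y,
      forall i, dominated hs (w i),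
      forall i j, w i (b j) = (i == j)%:R,
      {in L, forall x, x = \sum_i w i x *: b i}
    & forall P : V -> Prop, P 0 -> (forall (a : R) x y, P x -> P y -> P (a *: x + y)) ->
        {in L, forall x, P x} -> forall i, P (b i)].
Proof.
elim: L => [|x L [hs [d [b [w [lw dw wb bL PL]]]]]].
  exists [::], 0, (fun=> 0), (fun _ _ => 0); split=> //; try by case.
pose x' := x - \sum_i w i x *: b i.
have w0 i : w i 0 = 0.
  by have := lw i (-1) 0 0; rewrite scaleN1r addNr mulN1r addNr.
have wD i y z : w i (y + z) = w i y + w i z.
  by have := lw i 1 y z; rewrite scale1r mul1r.
have wZ i (a : R) y : w i (a *: y) = a * w i y.
  by have := lw i a y 0; rewrite w0 !addr0.
have wsum i n (G : 'I_n -> V) : w i (\sum_j G j) = \sum_j w i (G j).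
  by elim/big_rec2: _ => [|j y z _ <-]; rewrite ?w0 ?wD.
have wx' i : w i x' = 0.
  rewrite /x' -scaleN1r wD wZ wsum (bigD1 i) //= big1 => [|j /negbTE ij].
    by rewrite wZ wb eqxx mulr1 addr0 mulN1r subrr.
  by rewrite wZ wb eq_sym ij mulr0.
have [x0|x0] := eqVneq x' 0.
  exists hs, d, b, w; split=> // [y|P P0 PD Px].
    rewrite in_cons => /orP[/eqP ->|/bL //].
    by apply/eqP; rewrite -subr_eq0; apply/eqP.
  by apply: PL => // y yL; apply: Px; rewrite in_cons yL orbT.
have [h [k n0]] : exists h k, ip (op x' h) k != 0.
  apply: contrapT => nx; move/eqP: x0; apply; apply: op_form_inj => h k.
  rewrite op0l ip0l; apply/eqP/negPn/negP => n0; apply: nx; by exists h, k.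
pose f y := (ip (op x' h) k)^-1 * ip (op y h) k.
have fP (a : R) y z : f (a *: y + z) = a * f y + f z.
  by rewrite /f !opE !ipE; ring.
have f1 : f x' = 1 by rewrite /f mulVf.
pose g y := f y - \sum_i f (b i) * w i y.
have gP (a : R) y z : g (a *: y + z) = a * g y + g z.
  rewrite /g fP mulrBr mulr_sumr [RHS]addrACA -opprD -big_split; congr (_ - _).
  apply: eq_bigr => i _ /=.
  by rewrite lw; ring.
have gb j : g (b j) = 0.
  rewrite /g (bigD1 j) //= big1 => [|i /negbTE ij]; last by rewrite wb ij mulr0.
  by rewrite wb eqxx mulr1 addr0 subrr.
have gx' : g x' = 1.
  by rewrite /g f1 big1 ?subr0 // => i _; rewrite wx' mulr0.
exists ([:: h; k] ++ hs), d.+1,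
  (fun i => if unlift ord0 i is Some j then b j else x'),
  (fun i => if unlift ord0 i is Some j then w j else g); split.
- by move=> i a y z; case: unliftP => [j|] _; rewrite ?lw ?gP.
- have df : dominated ([:: h; k] ++ hs) f.
    have := dominated_lin (ip (op x' h) k)^-1
      (@dominated_vector ([:: h; k] ++ hs) h k _ _) (dominated0 _).
    rewrite !inE !eqxx !orbT /= => /(_ isT isT).
    by under [X in dominated _ X]funext do rewrite addr0.
  move=> i; case: unliftP => [j|] _; first exact: dominated_cat.
  have := dominated_lin (-1) (dominated_sum (fun i => f (b i))
    (fun i => dominated_cat [:: h; k] (dw i))) df.
  by under [X in dominated _ X]funext do rewrite mulN1r addrC.
- move=> i j; case: unliftP => [i' ->|->]; case: unliftP => [j' ->|->].
  + by rewrite wb (inj_eq lift_inj).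
  + by rewrite wx'.
  + by rewrite gb.
  + by rewrite gx' eqxx.
- move=> y; rewrite big_ord_recl unlift_none => yL.
  under eq_bigr do rewrite liftK.
  move: yL; rewrite in_cons => /orP[/eqP ->|yL].
    have -> : g x = 1.
      have xE : x = 1 *: x' + \sum_i w i x *: b i by rewrite scale1r subrK.
      rewrite [in LHS]xE gP gx' mulr1.
      suff -> : g (\sum_i w i x *: b i) = 0 by rewrite addr0.
      have g0 : g 0 = 0 by have := gP (-1) 0 0; rewrite scaleN1r addNr mulN1r addNr.
      elim/big_rec: _ => // i z _ gz; by rewrite gP gb gz mulr0 addr0.
    by rewrite scale1r subrK.
  have -> : g y = 0.
    rewrite (bL y yL).
    have g0 : g 0 = 0 by have := gP (-1) 0 0; rewrite scaleN1r addNr mulN1r addNr.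
    elim/big_rec: _ => // i z _ gz; by rewrite gP gb gz mulr0 addr0.
  by rewrite scale0r add0r -bL.
- move=> P P0 PD Px.
  have Pb i : P (b i) by apply: PL => // y yL; apply: Px; rewrite in_cons yL orbT.
  move=> i; case: unliftP => [j|] _ //.
  have -> : x' = (-1) *: (\sum_i w i x *: b i) + x by rewrite scaleN1r addrC.
  apply: (PD); last by apply: Px; rewrite in_cons eqxx.
  by elim/big_rec: _ => // j z _ Pz; apply: PD.
Qed.

End Biorthogonal.

(** * Vectors supported on one summand of a Hilbert sum *)

Section SumsSingle.
Variables (R : realType) (I : choiceType).

Lemma nsum_single (u : I -> R) i : (forall j, 0 <= u j) -> (forall j, j != i -> u j = 0) ->
  nsum u = u i.
Proof.
move=> u0 ui; have le s : uniq s -> \sum_(j <- s) u j <= u i.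
  move=> us; case: (boolP (i \in s)) => [is_|nis].
    by rewrite (bigD1_seq i) //= big1 ?addr0.
  rewrite big_seq big1 // => j js; apply: ui; apply: contra nis => /eqP <- //.
apply/eqP; rewrite eq_le nsum_le //=; apply: nsum_ge1; by exists (u i).
Qed.

Lemma lsum_single (u : I -> R) i : (forall j, j != i -> u j = 0) -> lsum u = u i.
Proof.
move=> ui; rewrite /lsum (@nsum_single _ i); first rewrite (@nsum_single _ i) ?addrK //.
- by move=> j /ui ->; rewrite normr0.
- exact: add_norm_ge0.
- by move=> j /ui ->; rewrite normr0 addr0.
Qed.

Lemma lsum_sum (J : Type) (r : seq J) (u : J -> I -> R) :
  (forall j, summable (u j)) ->
  summable (fun i => \sum_(j <- r) u j i) /\
  lsum (fun i => \sum_(j <- r) u j i) = \sum_(j <- r) lsum (u j).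
Proof.
move=> su; elim: r => [|j r [ih1 ih2]].
  have -> : (fun i => \sum_(j <- [::]) u j i) = (fun=> 0).
    by apply/funext => i; rewrite big_nil.
  have s0 := bounded_sums0 R I.
  split; first by apply: bounded_sums_le s0 => i; rewrite normr0.
  rewrite big_nil lsum_nsum //; apply/eqP; rewrite eq_le nsum_ge0 ?andbT //.
  by apply: nsum_le => s _; rewrite big1.
have -> : (fun i => \sum_(k <- j :: r) u k i) = (fun i => u j i + \sum_(k <- r) u k i).
  by apply/funext => i; rewrite big_cons.
by split; [exact: summableD | rewrite lsumD // ih2 big_cons].
Qed.

Variable H : I -> hilbert (realScalars R).
Local Notation ip i := (dotp (H i) : H i -> H i -> R).

Definition hsingle_fun (i : I) (x : H i) (j : I) : H j :=
  if pselect (i = j) is left e then eq_rect i (fun k => H k : Type) x j e else 0.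

Lemma hsingle_same i (x : H i) : hsingle_fun x i = x.
Proof.
rewrite /hsingle_fun; case: pselect => // e.
by rewrite (Prop_irrelevance e (erefl i)).
Qed.

Lemma hsingle_other i (x : H i) j : j != i -> hsingle_fun x j = 0.
Proof.
by move=> /eqP ji; rewrite /hsingle_fun; case: pselect => // e; case: ji.
Qed.

Lemma hsingle_bounded i (x : H i) :
  bounded_sums (fun j => ip j (hsingle_fun x j) (hsingle_fun x j)).
Proof.
exists (ip i x x) => s us.
case: (boolP (i \in s)) => [is_|nis].
  rewrite (bigD1_seq i) //= big1 ?addr0 ?hsingle_same // => j ji.
  by rewrite hsingle_other // ip0l.
rewrite big_seq big1 ?ip_ge0 // => j js; rewrite hsingle_other ?ip0l //.
by apply: contra nis => /eqP <-.
Qed.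

Definition hsingle i (x : H i) : hsum H := HSum (hsingle_bounded x).

End SumsSingle.

(** * Finite-dimensional subsystems and the operators representing their functionals *)

Section Frames.
Variables (R : realType) (V : opsys (realScalars R)).
Local Notation F := (realScalars R).
Local Notation H := (opsys_space V).
Local Notation ip := (dotp H : H -> H -> R).
Local Notation op := (opsys_op V : V -> H -> H).
Local Notation star := (@opsys_star _ V : V -> V).
Local Notation unit := (opsys_unit V : V).

(* A finite-dimensional operator subsystem, given by a basis and a dual family  *)
(* of functionals dominated by a positive functional.                           *)
Record frame := Frame {
  frame_vecs : seq H;
  frame_dim : nat;
  frame_basis : 'I_frame_dim -> V;
  frame_coord : 'I_frame_dim -> V -> R;
  frame_coordP : forall i (a : R) x y,
    frame_coord i (a *: x + y) = a * frame_coord i x + frame_coord i y;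
  frame_dominated : forall i, dominated frame_vecs (frame_coord i);
  frame_coordb : forall i j, frame_coord i (frame_basis j) = (i == j)%:R;
  frame_unit : unit = \sum_i frame_coord i unit *: frame_basis i;
  frame_star : forall i, star (frame_basis i) =
    \sum_j frame_coord j (star (frame_basis i)) *: frame_basis j;
  frame_state_gt0 : 0 < vstate frame_vecs unit }.

Definition in_frame (E : frame) (x : V) : Prop :=
  x = \sum_i @frame_coord E i x *: @frame_basis E i.

(** Adjoining the unit and the adjoints of [L] makes the span a subsystem; adjoining [h0] to the
    vectors makes the functional strictly positive at the unit. *)
Lemma frame_exists (h0 : H) (L : seq V) : h0 != 0 ->
  exists E : frame, {in L, forall x, in_frame E x}.
Proof.
move=> h00; have [hs [d [b [w [lw dw wb bL PL]]]]] :=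
  biorthogonal (unit :: L ++ [seq star x | x <- L]).
pose E x := x = \sum_i w i x *: b i.
have w0 i : w i 0 = 0.
  by have := lw i (-1) 0 0; rewrite scaleN1r addNr mulN1r addNr.
have E0 : E 0 by rewrite /E big1 // => i _; rewrite w0 scale0r.
have ED (a : R) x y : E x -> E y -> E (a *: x + y).
  rewrite /E => xE yE; rewrite {1}xE {1}yE scaler_sumr -big_split.
  by apply: eq_bigr => i _ /=; rewrite lw scalerDl scalerA.
have Eb i : E (star (b i)).
  apply: (PL (fun x => E (star x))) => [|a x y ex ey|x xL].
  - by rewrite star0.
  - by rewrite starP; exact: ED.
  - apply: bL; move: xL; rewrite !in_cons !mem_cat => /or3P[/eqP ->|xL|/mapP[y yL ->]].
    + by rewrite star_unit eqxx.
    + by rewrite [X in [|| _, _ | X]](map_f star xL) !orbT.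
    + by rewrite starK yL orbT.
have st0 : 0 < vstate (h0 :: hs) unit.
  rewrite /vstate big_cons !opsys_unitE ltr_wpDr //.
    by apply: sumr_ge0 => h _; rewrite opsys_unitE ip_ge0.
  exact: (@neq0_dnorm_gt0 _ _ _ (dotp H)).
have uE : E unit by apply: bL; rewrite in_cons eqxx.
exists (@Frame (h0 :: hs) d b w lw (fun i => dominated_cat [:: h0] (dw i)) wb uE Eb st0).
by move=> x xL; apply: bL; rewrite in_cons mem_cat xL orbT.
Qed.

Variable E : frame.
Local Notation d := (frame_dim E).
Local Notation b := (@frame_basis E).
Local Notation w := (@frame_coord E).

Lemma coord0 i : w i 0 = 0.
Proof.
by have := frame_coordP i (-1) 0 0; rewrite scaleN1r addNr mulN1r addNr.
Qed.

Lemma in_frame0 : in_frame E 0.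
Proof. by rewrite /in_frame big1 // => i _; rewrite coord0 scale0r. Qed.

Lemma in_frameP (a : R) x y : in_frame E x -> in_frame E y -> in_frame E (a *: x + y).
Proof.
rewrite /in_frame => xE yE; rewrite {1}xE {1}yE scaler_sumr -big_split.
by apply: eq_bigr => i _ /=; rewrite frame_coordP scalerDl scalerA.
Qed.

Lemma in_frameD x y : in_frame E x -> in_frame E y -> in_frame E (x + y).
Proof. by move=> ex ey; rewrite -[x]scale1r; exact: in_frameP. Qed.

Lemma in_frameZ (a : R) x : in_frame E x -> in_frame E (a *: x).
Proof. by move=> ex; rewrite -[_ *: _]addr0; apply: in_frameP => //; exact: in_frame0. Qed.

Lemma in_frame_sum (J : Type) (r : seq J) (G : J -> V) :
  (forall j, in_frame E (G j)) -> in_frame E (\sum_(j <- r) G j).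
Proof.
by move=> hG; elim/big_rec: _ => [|j x _]; [exact: in_frame0 | exact: in_frameD].
Qed.

Lemma in_frame_basis i : in_frame E (b i).
Proof.
rewrite /in_frame -[LHS](sum_delta i b); apply: eq_bigr => j _.
by rewrite frame_coordb.
Qed.

Lemma in_frame_star x : in_frame E x -> in_frame E (star x).
Proof.
rewrite {1}/in_frame => ->; rewrite star_sum; apply: in_frame_sum => i.
by rewrite starZ; apply: in_frameZ; exact: frame_star.
Qed.

(** A functional on the subsystem is the row vector of its values on the basis; the formula extends
    it to all of [V], but it is meant for elements satisfying [in_frame] (see [ev_eq]). *)
Definition ev (f : 'rV[R]_d) (x : V) : R := \sum_i f 0 i * w i x.

Lemma evP f (a : R) x y : ev f (a *: x + y) = a * ev f x + ev f y.
Proof.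
rewrite /ev mulr_sumr -big_split; apply: eq_bigr => i _ /=.
by rewrite frame_coordP; ring.
Qed.

Lemma ev0 f : ev f 0 = 0.
Proof. by rewrite /ev big1 // => i _; rewrite coord0 mulr0. Qed.
Lemma evD f x y : ev f (x + y) = ev f x + ev f y.
Proof. by have := evP f 1 x y; rewrite scale1r mul1r. Qed.
Lemma evZ f (a : R) x : ev f (a *: x) = a * ev f x.
Proof. by have := evP f a x 0; rewrite ev0 !addr0. Qed.
Lemma ev_sum f J (r : seq J) (G : J -> V) :
  ev f (\sum_(j <- r) G j) = \sum_(j <- r) ev f (G j).
Proof. by elim/big_rec2: _ => [|j x y _ <-]; rewrite ?ev0 ?evD. Qed.

Lemma ev_linl (a : R) f g x : ev (a *: f + g) x = a * ev f x + ev g x.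
Proof.
rewrite /ev mulr_sumr -big_split; apply: eq_bigr => i _ /=.
by rewrite !mxE; ring.
Qed.

Lemma ev_basis f i : ev f (b i) = f 0 i.
Proof.
rewrite /ev (bigD1 i) //= frame_coordb eqxx mulr1 big1 ?addr0 // => j /negbTE ji.
by rewrite frame_coordb ji mulr0.
Qed.

Lemma ev_eq (f : 'rV[R]_d) (g : V -> R) : (forall (a : R) x y, g (a *: x + y) = a * g x + g y) ->
  (forall i, g (b i) = f 0 i) -> forall x, in_frame E x -> ev f x = g x.
Proof.
move=> gP gb x ->; have g0 : g 0 = 0.
  by have := gP (-1) 0 0; rewrite scaleN1r addNr mulN1r addNr.
rewrite ev_sum; elim/big_rec2: _ => [|i y z _ ->]; first by rewrite g0.
by rewrite gP evZ ev_basis gb.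
Qed.

Lemma ev_dominated f : dominated (frame_vecs E) (ev f).
Proof. exact: dominated_sum (@frame_dominated E). Qed.

Definition normalized k (X : 'I_k -> 'I_k -> V) : Prop :=
  [/\ pos_kernel X, forall p q, in_frame E (X p q)
    & forall p q, vstate (frame_vecs E) (X p q) = (p == q)%:R].

(** These index the summands of the Hilbert space of the dual: on the summand of [X], the functional
    [f] acts as the matrix of its values on the entries of [X]. *)
Record component := Component {
  comp_size : nat;
  comp_kernel : 'I_comp_size -> 'I_comp_size -> V;
  comp_normalized : normalized comp_kernel }.

Definition component_space (c : {classic component}) : hilbert F :=
  cV_hilbert F (comp_size c).
Local Notation HT := (hsum component_space).
Local Notation HTh := (hsum_hilbert component_space).

Definition comp_mx (f : 'rV[R]_d) (c : component) : 'M[R]_(comp_size c) :=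
  \matrix_(p, q) ev f (comp_kernel p q).

(** Domination at [y] and at the image [z] of [y] bounds the fourth power of the length of [z] by
    [C] times the squared lengths of [y] and [z]. *)
Lemma comp_mx_bounded f : exists2 C, 0 <= C & forall c (y : 'cV[R]_(comp_size c)),
  @cV_dot F _ (comp_mx f c *m y) (comp_mx f c *m y) <= C * @cV_dot F _ y y.
Proof.
have [C C0 hC] := ev_dominated f; exists C => // c y.
have [pX _ nX] := comp_normalized c.
have st (u : 'I_(comp_size c) -> R) :
    \sum_p \sum_q vstate (frame_vecs E) (comp_kernel p q) * u q * u p = \sum_p u p * u p.
  apply: eq_bigr => p _; rewrite (bigD1 p) //= nX eqxx mul1r big1 ?addr0 // => q qp.
  by rewrite nX eq_sym (negbTE qp) !mul0r.
pose z := comp_mx f c *m y.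
have := hC _ _ pX (fun p => y p 0) (fun p => z p 0); rewrite !st.
have -> : \sum_p \sum_q ev f (comp_kernel p q) * y q 0 * z p 0 = \sum_p z p 0 * z p 0.
  apply: eq_bigr => p _; rewrite -mulr_suml; congr (_ * _).
  by rewrite /z mxE; apply: eq_bigr => q _; rewrite mxE.
rewrite -/z /cV_dot /=.
have : 0 <= \sum_p z p 0 * z p 0 by apply: sumr_ge0 => p _; rewrite -expr2 sqr_ge0.
have : 0 <= \sum_p y p 0 * y p 0 by apply: sumr_ge0 => p _; rewrite -expr2 sqr_ge0.
move: (\sum_p y p 0 * _) (\sum_p z p 0 * _) => Y Z Y0 Z0.
have [->|Zn0] := eqVneq Z 0; first by rewrite mulr_ge0.
by rewrite expr2 mulrA ler_pM2r // lt_neqAle eq_sym Zn0.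
Qed.

Let dual_op_bounded_sums f (h : HT) : bounded_sums (fun c =>
  (dotp (component_space c) : _ -> _ -> R)
    (comp_mx f c *m (h c : 'cV[R]__)) (comp_mx f c *m (h c : 'cV[R]__))).
Proof.
have [C C0 hC] := comp_mx_bounded f.
by apply: bounded_sums_le (bounded_sumsZ C0 (hsum_bounded h)) => c; exact: hC.
Qed.

Definition dual_op f (h : HT) : HT := HSum (dual_op_bounded_sums f h).

Lemma dual_opE f h c : dual_op f h c = comp_mx f c *m (h c : 'cV[R]__).
Proof. by []. Qed.

Let dual_op_bilinear : bilinear_for *:%R *:%R dual_op.
Proof.
split=> [h a f g|f a h k]; apply: hsum_ext => c; rewrite hsumDE hsumZE !dual_opE.
  rewrite [in RHS]scalemxAl -mulmxDl; congr (_ *m _).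
  by apply/matrixP => p q; rewrite !mxE ev_linl.
by rewrite hsumDE hsumZE mulmxDr scalemxAr.
Qed.

HB.instance Definition _ := bilinear_isBilinear.Build F 'rV[F]_d HTh HTh
  *:%R *:%R dual_op dual_op_bilinear.

Lemma dual_op_bounded f : exists2 c, 0 <= c & @opnorm_le F HTh (dual_op f) c.
Proof.
have [C C0 hC] := comp_mx_bounded f; exists (1 + C); first by rewrite addr_ge0.
move=> h; rewrite /= !hsum_dotE.
have C1 : 0 <= (1 + C) ^+ 2 by rewrite sqr_ge0.
rewrite -nsumZ //; last exact: hsum_bounded.
apply: nsum_le => s us; apply: le_trans (nsum_ge (bounded_sumsZ C1 (hsum_bounded h)) us).
apply: ler_sum => c _; apply: le_trans (hC c (h c)) _.
by apply: ler_wpM2r; [exact: (@ip_ge0 R (component_space c)) | nra].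
Qed.

End Frames.

Lemma sandwich_comp (R : comNzRingType) (U : lmodType R) (I J K : finType)
    (C : I -> J -> R) (G : J -> K -> R) (Y : I -> I -> U) i j :
  \sum_p \sum_q (G p i * G q j) *: (\sum_k \sum_l (C k p * C l q) *: Y k l) =
  \sum_k \sum_l ((\sum_p C k p * G p i) * (\sum_q C l q * G q j)) *: Y k l.
Proof.
under eq_bigr do under eq_bigr do
  (rewrite scaler_sumr; under eq_bigr do rewrite scaler_sumr).
under eq_bigr do rewrite exchange_big /=.
rewrite exchange_big; apply: eq_bigr => k _ /=.
under eq_bigr do rewrite exchange_big /=.
rewrite exchange_big; apply: eq_bigr => l _ /=.
rewrite mulr_suml scaler_suml; apply: eq_bigr => p _.
rewrite mulr_sumr scaler_suml; apply: eq_bigr => q _.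
by rewrite scalerA; congr (_ *: _); ring.
Qed.

Lemma sandwich_id (R : pzRingType) (U : lmodType R) (I : finType) (Y : I -> I -> U) i j :
  \sum_k \sum_l ((k == i)%:R * (l == j)%:R) *: Y k l = Y i j.
Proof.
rewrite -[RHS](sum_delta i (fun k => Y k j)); apply: eq_bigr => k _.
rewrite -(sum_delta j (Y k)) scaler_sumr; apply: eq_bigr => l _.
by rewrite scalerA.
Qed.

(** * The dual operator system *)

Section DualSystem.
Variables (R : realType) (V : opsys (realScalars R)) (E : frame V).
Local Notation F := (realScalars R).
Local Notation H := (opsys_space V).
Local Notation ip := (dotp H : H -> H -> R).
Local Notation op := (opsys_op V : V -> H -> H).
Local Notation star := (@opsys_star _ V : V -> V).
Local Notation unit := (opsys_unit V : V).
Local Notation d := (frame_dim E).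
Local Notation b := (@frame_basis _ _ E).
Local Notation w := (@frame_coord _ _ E).
Local Notation delta := (vstate (frame_vecs E)).
Local Notation HT := (hsum (@component_space _ _ E)).
Local Notation HTh := (hsum_hilbert (@component_space _ _ E)).

Lemma vstate_sum J (r : seq J) (G : J -> V) :
  delta (\sum_(j <- r) G j) = \sum_(j <- r) delta (G j).
Proof.
have d0 : delta 0 = 0 by rewrite /vstate big1 // => h _; rewrite op0l ip0l.
elim/big_rec2: _ => [|j x y _ <-] //.
by have := vstateP (frame_vecs E) 1 (G j) y; rewrite scale1r mul1r.
Qed.

Lemma vstateZ (a : R) x : delta (a *: x) = a * delta x.
Proof. by rewrite /vstate mulr_sumr; apply: eq_bigr => h _; rewrite opZl ipZl. Qed.

Lemma vstateD x y : delta (x + y) = delta x + delta y.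
Proof. by have := vstateP (frame_vecs E) 1 x y; rewrite scale1r mul1r. Qed.

Lemma vstate_star x : delta (star x) = delta x.
Proof. by apply: eq_bigr => h _; rewrite [RHS]ip_star ipC. Qed.

(** Adding [t] times the unit makes the matrix [Q] of values of [delta] positive definite;
    compressing by the inverse of its factor [G] normalizes. Hence every positive matrix is a limit
    of compressions of normalized ones. *)
Lemma normalize k (X : 'I_k -> 'I_k -> V) (t : R) : 0 < t -> pos_kernel X ->
  (forall p q, in_frame E (X p q)) ->
  exists2 X', @normalized _ _ E k X' & exists G : 'I_k -> 'I_k -> R,
    forall p q, X p q + ((p == q)%:R * t) *: unit =
      \sum_r \sum_s (G r p * G s q) *: X' r s.
Proof.
move=> t0 pX eX.
pose Y p q := X p q + ((p == q)%:R * t) *: unit.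
have pt : psd (fun p q : 'I_k => (p == q)%:R * t) by apply: psd_diag => _; exact: ltW.
have pY : pos_kernel Y by apply: pos_kernelD => //; exact: pos_kernel_unit.
have eY p q : in_frame E (Y p q).
  by apply: in_frameD => //; apply: in_frameZ; exact: frame_unit.
pose Q : 'M[R]_k := \matrix_(p, q) delta (Y p q).
have [|G QG] := @psd_mx_factor _ _ Q.
  split=> [p q|y]; first by rewrite !mxE -vstate_star pY.1.
  have := vstate_form_ge0 (frame_vecs E) y pY; congr (_ <= _).
  by apply: eq_bigr => p _; apply: eq_bigr => q _; rewrite mxE.
(* A vector killed by the factor would annihilate the form of [Q], which is at least
   [t * delta unit] times its squared length. *)
have uG : G \in unitmx.
  rewrite -unitmx_tr unitmxE unitfE; apply/det0P => -[v v0 vG].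
  have: \sum_p \sum_q Q p q * v 0 q * v 0 p = 0.
    have /matrixP/(_ 0 0) : v *m Q *m v^T = 0 by rewrite QG mulmxA vG !mul0mx.
    rewrite !mxE => vQv; rewrite -[RHS]vQv; apply: eq_bigr => q _.
    rewrite !mxE mulr_suml; apply: eq_bigr => p _.
    have -> : Q p q = Q q p by rewrite !mxE -vstate_star pY.1.
    by ring.
  apply/eqP; rewrite gt_eqF //.
  have -> : \sum_p \sum_q Q p q * v 0 q * v 0 p =
      \sum_p \sum_q delta (X p q) * v 0 q * v 0 p + t * delta unit * \sum_p v 0 p ^+ 2.
    rewrite mulr_sumr -big_split; apply: eq_bigr => p _ /=.
    rewrite -[X in _ = _ + X](sum_delta (U := R^o) p
      (fun q => t * delta unit * (v 0 q * v 0 p))) -big_split.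
    apply: eq_bigr => q _ /=; rewrite mxE vstateD vstateZ -[_ *: _]/(_ * _).
    by rewrite [q == p]eq_sym; ring.
  rewrite ltr_wpDl ?vstate_form_ge0 // !mulr_gt0 ?frame_state_gt0 //.
  rewrite lt_neqAle sumr_ge0 ?andbT => [|p _]; last exact: sqr_ge0.
  apply: contra v0; rewrite eq_sym psumr_eq0 => [/allP h|p _]; last exact: sqr_ge0.
  apply/eqP/matrixP => i p; rewrite ord1 mxE.
  by have := h p (mem_index_enum _); rewrite sqrf_eq0 => /eqP.
pose C := invmx G.
exists (fun p q => \sum_k \sum_l (C k p * C l q) *: Y k l).
  split; first exact: pos_kernel_compress.
    by move=> p q; apply: in_frame_sum => r; apply: in_frame_sum => s; exact: in_frameZ.
  move=> p q; rewrite vstate_sum.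
  have -> : \sum_j delta (\sum_l (C j p * C l q) *: Y j l) = (C^T *m Q *m C) p q.
    rewrite mxE; under [RHS]eq_bigr do rewrite mxE mulr_suml.
    rewrite [RHS]exchange_big; apply: eq_bigr => r _ /=.
    rewrite vstate_sum; apply: eq_bigr => s _.
    by rewrite vstateZ !mxE; ring.
  rewrite QG mulmxA -mulmxA mulmxV // mulmx1 -trmx_mul mulmxV // trmx1 mxE.
  by [].
exists G => p q; rewrite sandwich_comp.
have CG r s : \sum_j C r j * G j s = (r == s)%:R.
  by have /matrixP/(_ r s) := mulVmx uG; rewrite !mxE.
under [RHS]eq_bigr do under eq_bigr do rewrite !CG.
by rewrite sandwich_id.
Qed.

Definition csingle (c : {classic component E}) (y : 'cV[R]_(comp_size c)) : HT :=
  @hsingle R _ (@component_space _ _ E) c y.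

Lemma dual_op_single (f : 'rV[R]_d) (c : {classic component E}) (y : 'cV[R]_(comp_size c)) :
  dual_op f (csingle y) c = comp_mx f c *m y.
Proof. by rewrite dual_opE /= hsingle_same. Qed.

(** Each basis vector is an off-diagonal corner of a positive matrix over the subsystem. The
    multiple of the unit added by [normalize] leaves that corner unchanged, so it is a combination
    of entries of a normalized matrix, where [f] and [g] agree. *)
Lemma dual_op_inj f g : @dual_op _ _ E f =1 dual_op g -> f = g.
Proof.
move=> fg; have evE c p q : ev f (@comp_kernel _ _ E c p q) = ev g (comp_kernel p q).
  have := fg (csingle (c := c) (delta_mx q 0)).
  move=> /(congr1 (fun h : HT => h c)); rewrite !dual_op_single => /matrixP/(_ p 0).
  by rewrite -!colE !mxE.
have evP2 k (X : 'I_k -> 'I_k -> V) : pos_kernel X ->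
    (forall p q, in_frame E (X p q)) -> forall p q, p != q -> ev f (X p q) = ev g (X p q).
  move=> pX eX p q /negbTE pq.
  have [X' nX' [G /(_ p q)]] := normalize ltr01 pX eX.
  rewrite pq mul0r scale0r addr0 => ->; rewrite !ev_sum.
  apply: eq_bigr => r _; rewrite !ev_sum; apply: eq_bigr => s _; rewrite !evZ.
  by rewrite (evE (Component nX')).
apply/rowP => i; rewrite -!ev_basis.
have [c /pos_kernel_norm pc] := opn_ex (b i).
pose bb (p : 'I_2) := p == ord0.
have := evP2 2 _ (pos_kernel_reindex bb pc) _ ord0 ord_max isT; apply.
have eu := in_frameZ c (frame_unit E); have eb := in_frame_basis (E := E) i.
by move=> p q; case: (bb p); case: (bb q) => //; exact: in_frame_star.
Qed.

Definition dual_unit : 'rV[R]_d := \row_i delta (b i).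
Definition dual_star (f : 'rV[R]_d) : 'rV[R]_d := \row_i ev f (star (b i)).

Lemma ev_dual_unit x : in_frame E x -> ev dual_unit x = delta x.
Proof. by apply: (ev_eq (g := delta)) => [a y z|i]; [exact: vstateP | rewrite mxE]. Qed.

Lemma ev_dual_star f x : in_frame E x -> ev (dual_star f) x = ev f (star x).
Proof. by apply: (ev_eq (g := fun x => ev f (star x))) => [a y z|i]; [rewrite starP evP | rewrite mxE]. Qed.

Lemma dual_unitE h : dual_op dual_unit h = h.
Proof.
apply: hsum_ext => c; rewrite dual_opE; have [_ eX nX] := comp_normalized c.
rewrite [comp_mx _ _](_ : _ = 1%:M) ?mul1mx //.
by apply/matrixP => p q; rewrite !mxE ev_dual_unit.
Qed.

Lemma dual_starE (f : 'rV[R]_d) (h k : HT) :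
  hsum_dot (dual_op f h) k = hsum_dot h (dual_op (dual_star f) k).
Proof.
congr lsum; apply/funext => c; rewrite !dual_opE.
have [pX eX _] := comp_normalized c.
have -> : comp_mx (dual_star f) c = map_mx (scalar_conj F) (comp_mx f c)^T.
  by apply/matrixP => p q; rewrite !mxE ev_dual_star //= pX.1.
exact: (@mx_op_star F _ (comp_mx f c) (h c) (k c)).
Qed.

Definition dual_opsys : opsys F :=
  @OpSys F 'rV[F]_d HTh (@dual_op _ _ E) dual_op_inj (@dual_op_bounded _ _ E)
    dual_unit dual_unitE dual_star dual_starE.

Lemma dual_finite_dim : finite_dim dual_opsys.
Proof.
exists d, (fun i => delta_mx 0 i : 'rV[R]_d) => f; exists (fun i => (f : 'rV[R]_d) 0 i).
exact: row_sum_delta.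
Qed.

Lemma hsum_dot_single (c : {classic component E}) (y z : 'cV[R]_(comp_size c)) f :
  hsum_dot (dual_op f (csingle y)) (csingle z) =
  @cV_dot F _ (comp_mx f c *m y) z.
Proof.
rewrite /hsum_dot (lsum_single (i := c)) => [|j jc].
  by rewrite dual_op_single /= hsingle_same.
have -> : csingle z j = 0 by exact: hsingle_other.
exact: ip0r.
Qed.

Lemma dual_kernel_component (J : finType) (B : J -> J -> dual_opsys) k (X : 'I_k -> 'I_k -> V) :
  pos_kernel B -> @normalized _ _ E k X ->
  psd (fun a c : J * 'I_k => ev (B a.1 c.1) (X a.2 c.2)).
Proof.
move=> pB nX; pose c : {classic component E} := Component nX.
have := psd_reindex (fun a : J * 'I_k => (a.1, a.2)) (@pos_kernel_form R dual_opsys J _ B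
  (fun p => csingle (c := c) (delta_mx p 0 : 'cV[R]_k)) pB).
apply: eq_psd => a a'.
rewrite [LHS]hsum_dot_single [LHS]/cV_dot (bigD1 a.2) //= big1 ?addr0 => [|p /negbTE pa].
  by rewrite -colE !mxE !eqxx mulr1.
by rewrite [X in _ * X]mxE pa mulr0.
Qed.

(** On the summand of [X] the form of this kernel is the form of [X] at combinations of the [h p],
    hence nonnegative; the rest interchanges the Hilbert sum with finite sums. *)
Lemma vector_kernel_dual (J : finType) (h : J -> H) :
  pos_kernel (V := dual_opsys)
    (fun p q => (\row_i ip (op (b i) (h q)) (h p) : 'rV[R]_d)).
Proof.
have evE p q x : in_frame E x ->
    ev (\row_i ip (op (b i) (h q)) (h p) : 'rV[R]_d) x = ip (op x (h q)) (h p).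
  by apply: (ev_eq (g := fun x => ip (op x (h q)) (h p))) => [a y z|i];
      [rewrite !opE !ipE | rewrite mxE].
split=> [p q|k].
  apply/rowP => i; rewrite !mxE evE; last by apply: in_frame_star; exact: in_frame_basis.
  by rewrite [RHS]ip_star ipC.
pose u p q (c : {classic component E}) : R :=
  (dotp (component_space c) : _ -> _ -> R)
    (comp_mx (\row_i ip (op (b i) (h q)) (h p)) c *m (k q c : 'cV[R]__)) (k p c).
have su p q : summable (u p q).
  exact: (hsum_summable (dual_op (\row_i ip (op (b i) (h q)) (h p)) (k q)) (k p)).
have -> : \sum_p \sum_q hsum_dot (dual_op (\row_i ip (op (b i) (h q)) (h p)) (k q)) (k p) =
    lsum (fun c => \sum_p \sum_q u p q c).
  have su2 p := (lsum_sum (index_enum J) (su p)).1.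
  rewrite (lsum_sum (index_enum J) su2).2; apply: eq_bigr => p _.
  by rewrite (lsum_sum (index_enum J) (su p)).2.
have s2 : summable (fun c => \sum_p \sum_q u p q c).
  exact: (lsum_sum (index_enum J) (fun p => (lsum_sum (index_enum J) (su p)).1)).1.
have u0 c : 0 <= \sum_p \sum_q u p q c.
  have [pX eX _] := comp_normalized c.
  have := (pos_kernel_form h pX).2 (fun a => (k a.2 c : 'cV[R]_(comp_size c)) a.1 0).
  congr (_ <= _).
  rewrite sum_pair exchange_big; apply: eq_bigr => p _ /=.
  under eq_bigr do rewrite sum_pair exchange_big /=.
  rewrite exchange_big; apply: eq_bigr => q _ /=.
  rewrite /u /= /cV_dot; apply: eq_bigr => r _.
  rewrite mxE mulr_suml; apply: eq_bigr => s _.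
  by rewrite mxE evE.
by apply: lsum_ge0 => //; apply: bounded_sums_le s2 => c; exact: ler_norm.
Qed.


End DualSystem.

(** * Almost separating a point from a convex cone *)

Section ConeSeparation.
Variables (R : realType) (K : finType).
Implicit Types f g : K -> R.

Definition dotf f g : R := \sum_k f k * g k.

Lemma dotf_ge0 f : 0 <= dotf f f.
Proof. by apply: sumr_ge0 => k _; rewrite -expr2 sqr_ge0. Qed.

(* An almost nearest point of the cone provides an almost separating functional *)
(* [X]; compactness or completeness is not needed.                              *)
Lemma cone_separation (C : (K -> R) -> Prop) (B : K -> R) (e : R) :
  C (fun=> 0) -> (forall f g, C f -> C g -> C (fun k => f k + g k)) ->
  (forall (a : R) f, 0 <= a -> C f -> C (fun k => a * f k)) ->
  (forall f, C f -> e <= dotf (fun k => B k - f k) (fun k => B k - f k)) ->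
  forall nu : R, 0 < nu -> nu <= 1 -> exists X : K -> R,
    (forall g, C g -> - (nu ^+ 2 + dotf g g) / 2 <= dotf X g) /\
    dotf X B <= - e + nu * (3 + 4 * dotf B B) / 2.
Proof.
move=> C0 CD CZ he nu nu0 nu1.
pose N f := dotf f f; pose D0 : set R := fun x => exists2 f, C f & x = N (fun k => B k - f k).
have D0B : D0 (N B).
  by exists (fun=> 0) => //; congr N; apply/funext => k; rewrite subr0.
have lb0 : has_lbound D0 by exists 0 => _ [f _ ->]; exact: dotf_ge0.
have hi : has_inf D0 by split; [exists (N B) | ].
have lbD f : C f -> inf D0 <= N (fun k => B k - f k).
  by move=> Cf; apply: ge_inf => //; exists f.
have eD : e <= inf D0.
  by apply: lb_le_inf => [|_ [f Cf ->]]; [exists (N B) | exact: he].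
have nu20 : 0 < nu ^+ 2 by rewrite exprn_gt0.
have [_ [c Cc ->] cD] := inf_adherent nu20 hi.
pose u k := B k - c k.
have N2 f g (s : R) : N (fun k => f k + s * g k) = N f + (s * dotf f g) *+ 2 + s ^+ 2 * N g.
  rewrite /N /dotf !mulr_sumr -sumrMnl -!big_split; apply: eq_bigr => k _ /=.
  by rewrite mulr2n; ring.
have DB : inf D0 <= N B by apply: ge_inf.
exists (fun k => - u k); split=> [g Cg|].
  (* [c + g] stays in the cone, so it is hardly closer to [B] than the almost nearest point [c]. *)
  have := lbD _ (CD _ _ Cc Cg).
  have -> : N (fun k => B k - (c k + g k)) = N (fun k => u k + (-1) * g k).
    by congr N; apply/funext => k; rewrite /u; ring.
  rewrite N2; have -> : dotf (fun k => - u k) g = - dotf u g.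
    by rewrite /dotf -sumrN; apply: eq_bigr => k _; rewrite mulNr.
  have : N u < inf D0 + nu ^+ 2 by [].
  rewrite /N; move: (dotf u u) (dotf u g) (dotf g g) (inf D0) (nu ^+ 2) => *.
  lra.
(* Shrinking [c] also stays in the cone; this bounds the pairing of [u] with [c] from below, and
   with it the pairing of [X = - u] with [B = u + c] from above. *)
have := lbD _ (CZ (1 - nu) c _ Cc); rewrite subr_ge0 => /(_ nu1).
have -> : N (fun k => B k - (1 - nu) * c k) = N (fun k => u k + nu * c k).
  by congr N; apply/funext => k; rewrite /u; ring.
rewrite N2.
have -> : dotf (fun k => - u k) B = - (N u + dotf u c).
  rewrite /N /dotf -big_split -sumrN; apply: eq_bigr => k _ /=.
  by rewrite /u; ring.
have Nu : N u < inf D0 + nu ^+ 2 by [].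
have Nc : N c <= N B *+ 2 + N u *+ 2.
  have := dotf_ge0 (fun k => B k + u k).
  have -> : dotf (fun k => B k + u k) (fun k => B k + u k) =
      N B *+ 2 + N u *+ 2 - N c.
    rewrite /N /dotf -!sumrMnl -big_split -sumrB; apply: eq_bigr => k _ /=.
    by rewrite /u !mulr2n; ring.
  by rewrite subr_ge0.
have Du := lbD _ Cc; rewrite -/u in Du.
move: DB Nu Nc eD Du; rewrite -/(N B); move: (N u) (N c) (dotf u c) (inf D0) (N B).
move=> x y z D b DB Nu Nc eD Du H.
have h1 : nu ^+ 2 <= 1 by rewrite expr_le1 // ltW.
have h2 : nu * - (nu + nu * y) <= nu * (z *+ 2).
  have -> : nu * - (nu + nu * y) = - nu ^+ 2 - nu ^+ 2 * y by ring.
  lra.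
rewrite ler_pM2l // in h2.
have h3 : nu * y <= nu * (b *+ 4 + 2) by rewrite ler_pM2l //; lra.
by nra.
Qed.

End ConeSeparation.

(** * Density of vector functionals among positive matrices over the dual *)

Section Density.
Variables (R : realType) (V : opsys (realScalars R)) (E : frame V).
Local Notation F := (realScalars R).
Local Notation H := (opsys_space V).
Local Notation ip := (dotp H : H -> H -> R).
Local Notation op := (opsys_op V : V -> H -> H).
Local Notation star := (@opsys_star _ V : V -> V).
Local Notation unit := (opsys_unit V : V).
Local Notation d := (frame_dim E).
Local Notation b := (@frame_basis _ _ E).
Local Notation w := (@frame_coord _ _ E).

(** For [Y] plus [t] times the unit, [normalize] turns the pairing into a value of the form in
    [dual_kernel_component], at the vector given by [G]; then [t] tends to 0. *)
Lemma dual_pairing_ge0 q (B : 'I_q -> 'I_q -> dual_opsys E) (Y : 'I_q -> 'I_q -> V) :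
  pos_kernel B -> pos_kernel Y -> (forall p r, in_frame E (Y p r)) ->
  0 <= \sum_p \sum_r ev (B p r) (Y p r).
Proof.
move=> pB pY eY; rewrite leNgt; apply/negP => lt0.
pose c := \sum_p ev (B p p) unit.
have ge t : 0 < t -> 0 <= \sum_p \sum_r ev (B p r) (Y p r) + t * c.
  move=> t0; have [X' nX' [G GE]] := normalize t0 pY eY.
  have := (dual_kernel_component pB nX').2 (fun a => G a.2 a.1); congr (_ <= _).
  have -> : t * c = \sum_p \sum_r ((p == r)%:R * t) * ev (B p r) unit.
    rewrite mulr_sumr; apply: eq_bigr => p _.
    rewrite -(sum_delta (U := R^o) p (fun r => t * ev (B p r) unit)).
    by apply: eq_bigr => r _; rewrite -[_ *: _]/(_ * _) mulrA eq_sym.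
  rewrite -big_split sum_pair; apply: eq_bigr => p _ /=.
  under eq_bigr do rewrite sum_pair.
  rewrite exchange_big -big_split; apply: eq_bigr => r _ /=.
  rewrite -evZ -evD GE ev_sum; apply: eq_bigr => p' _.
  rewrite ev_sum; apply: eq_bigr => r' _.
  by rewrite evZ; ring.
move: lt0 ge; move: (\sum_p \sum_r _) => S S0 ge.
have c1 : 0 < `|c| + 1 by rewrite ltr_wpDl.
have := ge (- S / (`|c| + 1) / 2); rewrite !divr_gt0 ?oppr_gt0 // => /(_ isT).
have -> : - S / (`|c| + 1) / 2 * c = - S * (c / (`|c| + 1)) / 2 by ring.
have : c / (`|c| + 1) <= 1.
  rewrite ler_pdivrMr // mul1r; apply: le_trans (ler_norm _) _.
  by rewrite lerDl.
by move: (c / _) => t t1; nra.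
Qed.

(** Sums of vector kernels form a convex cone. If [B] were at positive distance, some [X] would
    almost separate it. Read as a matrix over the subsystem, [X] is almost nonnegative on vectors,
    so its symmetrization with a small shift is a positive [Y] whose pairing with [B] is negative,
    against [dual_pairing_ge0]. *)
Lemma dual_kernel_approx q (B : 'I_q -> 'I_q -> dual_opsys E) (e : R) :
  pos_kernel B -> 0 < e ->
  exists m (h : 'I_m -> 'I_q -> H),
    \sum_p \sum_r \sum_i ((B p r : 'rV[R]_d) 0 i -
       \sum_t ip (op (b i) (h t r)) (h t p)) ^+ 2 < e.
Proof.
move=> pB e0; apply: contrapT => nh.
pose K : finType := ('I_q * ('I_q * 'I_d))%type.
pose B0 (k : K) : R := (B k.1 k.2.1 : 'rV[R]_d) 0 k.2.2.
pose vec m (h : 'I_m -> 'I_q -> H) (k : K) : R :=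
  \sum_t ip (op (b k.2.2) (h t k.2.1)) (h t k.1).
pose C (f : K -> R) := exists m (h : 'I_m -> 'I_q -> H), f = vec m h.
have C0 : C (fun=> 0).
  by exists 0, (fun _ _ => 0); apply/funext => k; rewrite /vec big_ord0.
have CD f g : C f -> C g -> C (fun k => f k + g k).
  move=> [m [h ->]] [n [l ->]].
  exists (m + n)%N, (fun t => match split t with inl t => h t | inr t => l t end).
  apply/funext => k; rewrite /vec big_split_ord /=; congr (_ + _); apply: eq_bigr => t _.
    by rewrite (unsplitK (inl t)).
  by rewrite (unsplitK (inr t)).
have CZ (a : R) f : 0 <= a -> C f -> C (fun k => a * f k).
  move=> a0 [m [h ->]]; exists m, (fun t p => Num.sqrt a *: h t p).
  apply/funext => k; rewrite /vec mulr_sumr; apply: eq_bigr => t _.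
  by rewrite opZr ipZl ipZr mulrA -expr2 sqr_sqrtr.
have Ce f : C f -> e <= dotf (fun k => B0 k - f k) (fun k => B0 k - f k).
  move=> [m [h ->]]; rewrite leNgt; apply/negP => lt; apply: nh; exists m, h.
  move: lt; rewrite /dotf sum_pair; congr (_ < _); apply: eq_bigr => p _.
  by rewrite sum_pair; apply: eq_bigr => r _; apply: eq_bigr => i _; rewrite expr2.
have /choice[nb hnb] i : exists c, opn (b i) c := opn_ex (b i).
pose kap := \sum_i nb i ^+ 2.
have kap0 : 0 <= kap by apply: sumr_ge0 => i _; exact: sqr_ge0.
pose M (h : 'I_q -> H) := \sum_p ip (h p) (h p).
have M0 h : 0 <= M h by apply: sumr_ge0 => p _; exact: ip_ge0.
pose v (h : 'I_q -> H) (k : K) : R := ip (op (b k.2.2) (h k.2.1)) (h k.1).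
have Cv h : C (v h).
  by exists 1, (fun _ => h); apply/funext => k; rewrite /vec big_ord1.
have vM h : dotf (v h) (v h) <= kap * M h ^+ 2.
  have -> : kap * M h ^+ 2 = \sum_p \sum_r \sum_i
      nb i ^+ 2 * ip (h r) (h r) * ip (h p) (h p).
    rewrite expr2 mulrA mulr_sumr; apply: eq_bigr => p _.
    rewrite mulr_sumr mulr_suml; apply: eq_bigr => r _.
    by rewrite !mulr_suml.
  rewrite /dotf sum_pair; apply: ler_sum => p _; rewrite sum_pair.
  apply: ler_sum => r _; apply: ler_sum => i _.
  by rewrite -expr2; exact: opn_form.
pose c0 := `|\sum_p ev (B p p) unit|.
have c00 : 0 <= c0 by exact: normr_ge0.
(* The two errors linear in [nu]: the one of [cone_separation], and the shift by [tau] paired with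
   [B]. *)
pose k0 := (3 + 4 * dotf B0 B0) / 2 + c0 * (1 + kap) / 2.
have k00 : 0 < k0.
  rewrite /k0; have := dotf_ge0 B0; have : 0 <= c0 * (1 + kap) by rewrite mulr_ge0 // addr_ge0.
  by move: (dotf B0 B0) (c0 * _) => *; lra.
pose nu := Num.min 1 (e / k0 / 2).
have nu0 : 0 < nu by rewrite lt_min ltr01 !divr_gt0.
have nu1 : nu <= 1 by rewrite ge_min lexx.
have nuk : nu * k0 < e.
  apply: (@le_lt_trans _ _ (e / 2)); last by rewrite ltr_pdivrMr // mulr_natr mulr2n ltrDl.
  rewrite -ler_pdivlMr //; have -> : e / 2 / k0 = e / k0 / 2 by rewrite mulrAC.
  by rewrite ge_min lexx orbT.
have [X [Xge XB]] := cone_separation C0 CD CZ Ce nu0 nu1.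
pose tau := nu * (1 + kap) / 2.
have Xv h : - (tau * M h) <= dotf X (v h).
  have [Mh0|Mn0] := eqVneq (M h) 0.
    rewrite Mh0 mulr0 oppr0.
    have h0 p : h p = 0.
      apply: ip_eq0; apply/eqP; move/eqP: Mh0; rewrite psumr_eq0 => [/allP|q' _]; last exact: ip_ge0.
      by apply; rewrite mem_index_enum.
    by rewrite /dotf big1 // => k _; rewrite /v h0 op0r ip0l mulr0.
  have Mg : 0 < M h by rewrite lt_neqAle eq_sym Mn0 M0.
  (* The separation bound is inhomogeneous; scaling [v h] to length of order [nu] turns it into a
     bound linear in [M h]. *)
  pose s := nu / M h; have s0 : 0 < s by rewrite divr_gt0.
  have := Xge _ (CZ s _ (ltW s0) (Cv h)).
  have -> : dotf (fun k => s * v h k) (fun k => s * v h k) = s ^+ 2 * dotf (v h) (v h).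
    by rewrite /dotf mulr_sumr; apply: eq_bigr => k _; ring.
  have -> : dotf X (fun k => s * v h k) = s * dotf X (v h).
    by rewrite /dotf mulr_sumr; apply: eq_bigr => k _; ring.
  have := vM h; move: (dotf (v h) (v h)) (dotf X (v h)) => g x gM hx.
  have : s ^+ 2 * g <= s ^+ 2 * (kap * M h ^+ 2) by rewrite ler_wpM2l ?sqr_ge0.
  have -> : s ^+ 2 * (kap * M h ^+ 2) = nu ^+ 2 * kap by rewrite /s; field.
  move=> g2; rewrite -(ler_pM2l s0).
  have -> : s * - (tau * M h) = - (nu ^+ 2 * (1 + kap) / 2) by rewrite /s /tau; field.
  by lra.
pose X0 p r : V := \sum_i X (p, (r, i)) *: b i.
pose Y p r : V := 2^-1 *: (X0 p r + star (X0 r p)) + ((p == r)%:R * tau) *: unit.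
have tau0 : 0 <= tau by rewrite /tau !mulr_ge0 ?invr_ge0 ?addr_ge0 // ltW.
have eX0 p r : in_frame E (X0 p r).
  by apply: in_frame_sum => i; apply: in_frameZ; exact: in_frame_basis.
have eY p r : in_frame E (Y p r).
  apply: in_frameD; apply: in_frameZ; last exact: frame_unit.
  by apply: in_frameD => //; exact: in_frame_star.
have form_X0 h : \sum_p \sum_r ip (op (X0 p r) (h r)) (h p) = dotf X (v h).
  rewrite /dotf sum_pair; apply: eq_bigr => p _; rewrite sum_pair; apply: eq_bigr => r _.
  rewrite /X0 op_suml ip_suml; apply: eq_bigr => i _.
  by rewrite opZl ipZl.
have pY : pos_kernel Y.
  split=> [p r|h].
    rewrite /Y starD !starZ starD starK star_unit [X in _ *: X + _]addrC.
    by rewrite [r == p]eq_sym.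
  have := Xv h; rewrite -subr_ge0 opprK; congr (_ <= _).
  have E2 : \sum_p \sum_r ip (op (star (X0 r p)) (h r)) (h p) = dotf X (v h).
    rewrite -form_X0 exchange_big; apply: eq_bigr => p _; apply: eq_bigr => r _ /=.
    by rewrite [RHS]ip_star ipC.
  have -> : dotf X (v h) = 2^-1 * (dotf X (v h) + dotf X (v h)) by field.
  rewrite -{2}E2 -form_X0 -big_split !mulr_sumr -big_split; apply: eq_bigr => p _ /=.
  rewrite -big_split mulr_sumr /=.
  rewrite -(sum_delta (U := R^o) p (fun r => tau * ip (h r) (h p))) -big_split.
  apply: eq_bigr => r _ /=; rewrite /Y !opE !opsys_unitE !ipE -[_ *: _]/(_ * _).
  by rewrite [r == p]eq_sym; ring.
have := dual_pairing_ge0 pB pY eY.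
have -> : \sum_p \sum_r ev (B p r) (Y p r) = dotf X B0 + tau * \sum_p ev (B p p) unit.
  have E1 : \sum_p \sum_r ev (B p r) (X0 p r) = dotf X B0.
    rewrite /dotf sum_pair; apply: eq_bigr => p _; rewrite sum_pair; apply: eq_bigr => r _.
    by rewrite /X0 ev_sum; apply: eq_bigr => i _; rewrite evZ ev_basis.
  have E2 : \sum_p \sum_r ev (B p r) (star (X0 r p)) = dotf X B0.
    rewrite -E1 exchange_big; apply: eq_bigr => p _; apply: eq_bigr => r _ /=.
    rewrite -ev_dual_star //; have -> : dual_star (B r p) = B p r := pB.1 r p.
    by [].
  have -> : dotf X B0 = 2^-1 * (dotf X B0 + dotf X B0) by field.
  rewrite -{1}E1 -{1}E2 -big_split !mulr_sumr -big_split; apply: eq_bigr => p _ /=.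
  rewrite -big_split mulr_sumr /=.
  rewrite -(sum_delta (U := R^o) p (fun r => tau * ev (B p r) unit)) -big_split.
  apply: eq_bigr => r _ /=; rewrite /Y evD !evZ evD -[_ *: _]/(_ * _).
  by rewrite [r == p]eq_sym; ring.
apply/negP; rewrite -ltNge.
have : tau * \sum_p ev (B p p) unit <= tau * c0 by rewrite ler_wpM2l // ler_norm.
have -> : tau * c0 = nu * (c0 * (1 + kap) / 2) by rewrite /tau; ring.
move: XB nuk; rewrite /k0.
move: (dotf X B0) (dotf B0 B0) (tau * _) (c0 * _ / 2) => x y z t XB nuk hz.
by nra.
Qed.

End Density.

(** * Factorization through matrix algebras *)

Section VectorFactorization.
Variables (R : realType) (V : opsys (realScalars R)).
Local Notation F := (realScalars R).
Local Notation H := (opsys_space V).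
Local Notation ip := (dotp H : H -> H -> R).
Local Notation op := (opsys_op V : V -> H -> H).
Local Notation star := (@opsys_star _ V : V -> V).
Local Notation unit := (opsys_unit V : V).

(** For positive [D], the composite of compression to the vectors [h p] and the map with Choi matrix
    [D]: completely positive on all of [V], but not yet unital. *)
Definition vector_map (J : finType) (h : J -> H) (D : J -> J -> V) (x : V) : V :=
  \sum_p \sum_q ip (op x (h q)) (h p) *: D p q.

Definition approximable (L : seq V) (Phi : V -> V) : Prop :=
  forall kap : R, 0 < kap -> exists (J : finType) (h : J -> H) (D : J -> J -> V),
    pos_kernel D /\ {in L, forall x, opn (Phi x - vector_map h D x) kap}.

Lemma approximable0 L : approximable L (fun=> 0).
Proof.
move=> k k0; exists 'I_0, (fun=> 0), (fun _ _ => 0); split.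
  by split=> [|h]; [case | rewrite big_ord0].
move=> x _; rewrite /vector_map big_ord0 subr0; apply: opn_le (opn0 V) _; exact: ltW.
Qed.

Lemma approximableD L Phi Psi : approximable L Phi -> approximable L Psi ->
  approximable L (fun x => Phi x + Psi x).
Proof.
move=> hP hQ k k0; have k20 : 0 < k / 2 by rewrite divr_gt0.
have [I [h [A [pA hA]]]] := hP _ k20; have [J [g [B [pB hB]]]] := hQ _ k20.
pose hg (s : I + J) : H := match s with inl i => h i | inr j => g j end.
pose D (s t : I + J) : V := match s, t with
  | inl i, inl i' => A i i' | inr j, inr j' => B j j' | _, _ => 0 end.
exists (I + J)%type, hg, D; split.
  split=> [[i|j] [i'|j']|u] /=; rewrite ?star0 ?pA.1 ?pB.1 //.
  rewrite big_sumType /=.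
  have := addr_ge0 (pA.2 (fun i => u (inl i))) (pB.2 (fun j => u (inr j))).
  congr (_ <= _); congr (_ + _); apply: eq_bigr => i _; rewrite big_sumType /=.
    by rewrite [X in _ + X]big1 ?addr0 // => j _; rewrite op0l ip0l.
  by rewrite [X in X + _]big1 ?add0r // => j _; rewrite op0l ip0l.
move=> x xL; rewrite [k]splitr.
have -> : vector_map hg D x = vector_map h A x + vector_map g B x.
  rewrite /vector_map big_sumType /=; congr (_ + _); apply: eq_bigr => i _;
    rewrite big_sumType /=.
    by rewrite [X in _ + X]big1 ?addr0 // => j _; rewrite scaler0.
  by rewrite [X in X + _]big1 ?add0r // => j _; rewrite scaler0.
by rewrite opprD addrACA; apply: opnD; [exact: hA | exact: hB].
Qed.

Lemma approximable_sum L T (s : seq T) (Phi : T -> V -> V) :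
  (forall t, approximable L (Phi t)) -> approximable L (fun x => \sum_(t <- s) Phi t x).
Proof.
move=> hP; elim: s => [|t s ih].
  by under [X in approximable L X]funext do rewrite big_nil; exact: approximable0.
under [X in approximable L X]funext do rewrite big_cons.
exact: approximableD.
Qed.

(** [B] consists of functionals on the subsystem; [dual_kernel_approx] replaces them by vector
    functionals on all of [V]. The coordinates of the finitely many elements of [L] and the norms of
    the [D p r] control the error. *)
Lemma approximable_dual (E : frame V) L q (B : 'I_q -> 'I_q -> dual_opsys E)
    (D : 'I_q -> 'I_q -> V) :
  {in L, forall x, in_frame E x} -> pos_kernel B -> pos_kernel D ->
  approximable L (fun x => \sum_p \sum_r ev (B p r) x *: D p r).
Proof.
move=> eL pB pD k k0.
have /choice[nf hnf] (y : V) : exists c, opn y c := opn_ex y.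
pose K1 x := \sum_p \sum_r \sum_i `|frame_coord (f := E) i x| * nf (D p r).
have K10 x : 0 <= K1 x.
  by do 3 ![apply: sumr_ge0 => ? _]; rewrite mulr_ge0 // (hnf _).1.
pose K := \sum_(x <- L) K1 x.
have KL x : x \in L -> K1 x <= K.
  by move=> xL; rewrite /K (big_rem x xL) /= lerDl sumr_ge0.
have K0 : 0 <= K by apply: sumr_ge0.
pose eta := k / (K + 1); have eta0 : 0 < eta by rewrite divr_gt0 // ltr_wpDl.
have [|m [h hh]] := dual_kernel_approx (e := eta ^+ 2) pB; first by rewrite exprn_gt0.
pose del p r i := (B p r : 'rV[R]_(frame_dim E)) 0 i -
       \sum_t ip (op (frame_basis (f := E) i) (h t r)) (h t p).
have dele p r i : `|del p r i| <= eta.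
  rewrite -(@ler_pXn2r _ 2) ?nnegrE ?(ltW eta0) // real_normK ?num_real //.
  apply: le_trans (ltW hh); rewrite (bigD1 p) //= (bigD1 r) //= (bigD1 i) //=.
  rewrite -!addrA -/(del p r i) lerDl !addr_ge0 //; try by
    do ?[apply: sumr_ge0 => ? _]; exact: sqr_ge0.
exists ('I_m * 'I_q)%type, (fun a => h a.1 a.2),
  (fun a c => (a.1 == c.1)%:R *: D a.2 c.2); split.
  have pid : psd (fun a c : 'I_m * 'I_q => (a.1 == c.1)%:R : R).
    apply: eq_psd (psd_gram (fun (t : 'I_m) (a : 'I_m * 'I_q) => (t == a.1)%:R)) => a c.
    rewrite (bigD1 a.1) //= eqxx mul1r big1 ?addr0 // => t /negbTE->.
    by rewrite mul0r.
  exact: pos_kernel_schur pid (pos_kernel_reindex snd pD).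
move=> x xL.
have -> : vector_map (fun a => h a.1 a.2) (fun a c : 'I_m * 'I_q => (a.1 == c.1)%:R *: D a.2 c.2) x
    = \sum_p \sum_r (\sum_t ip (op x (h t r)) (h t p)) *: D p r.
  rewrite /vector_map sum_pair exchange_big; apply: eq_bigr => p _ /=.
  under eq_bigr do rewrite sum_pair exchange_big /=.
  rewrite exchange_big; apply: eq_bigr => r _ /=.
  rewrite scaler_suml; apply: eq_bigr => t _.
  rewrite -[RHS](sum_delta t (fun t' => ip (op x (h t' r)) (h t p) *: D p r)).
  by apply: eq_bigr => t' _; rewrite scalerA mulrC -scalerA eq_sym.
have dE p r : ev (B p r) x - \sum_t ip (op x (h t r)) (h t p) =
    \sum_i del p r i * frame_coord (f := E) i x.
  rewrite [x in op x]eL // /ev /del.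
  under [in RHS]eq_bigr do rewrite mulrBl.
  rewrite sumrB; congr (_ - _).
  under eq_bigr do rewrite op_suml ip_suml.
  rewrite exchange_big; apply: eq_bigr => i _ /=; rewrite mulr_suml.
  by apply: eq_bigr => t _; rewrite opZl ipZl mulrC.
have -> : \sum_p \sum_r ev (B p r) x *: D p r -
    \sum_p \sum_r (\sum_t ip (op x (h t r)) (h t p)) *: D p r =
    \sum_p \sum_r \sum_i (del p r i * frame_coord (f := E) i x) *: D p r.
  rewrite -sumrB; apply: eq_bigr => p _; rewrite -sumrB; apply: eq_bigr => r _.
  by rewrite -scalerBl dE scaler_suml.
apply: (@opn_le _ _ _ (\sum_p \sum_r \sum_i `|del p r i * frame_coord (f := E) i x| * nf (D p r))).
  by apply: opn_sum => p; apply: opn_sum => r; apply: opn_sum => i; exact: opnZ.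
apply: (@le_trans _ _ (eta * K1 x)).
  rewrite /K1 mulr_sumr; apply: ler_sum => p _; rewrite mulr_sumr; apply: ler_sum => r _.
  rewrite mulr_sumr; apply: ler_sum => i _; rewrite normrM -mulrA ler_wpM2r //.
  by rewrite mulr_ge0 // (hnf _).1.
apply: (@le_trans _ _ (eta * K)); first by rewrite ler_pM2l // KL.
rewrite /eta mulrAC -mulrA; apply: ler_piMr; first exact: ltW.
by rewrite ler_pdivrMr ?ltr_wpDl // mul1r lerDl.
Qed.

Lemma vector_map_orthonormal (J : finType) (h : J -> H) (D : J -> J -> V) :
  pos_kernel D -> exists n (e : 'I_n -> H) (D' : 'I_n -> 'I_n -> V),
    [/\ orthonormal e, pos_kernel D' & vector_map h D =1 vector_map e D'].
Proof.
move=> pD; have [n [e [oe [c hc]]]] := gram_schmidt (fun k : 'I_#|J| => h (enum_val k)).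
pose C j := c (enum_rank j).
have {}hc j : h j = \sum_a C j a *: e a by rewrite /C -hc enum_rankK.
exists n, e, (fun a b => \sum_p \sum_q (C p a * C q b) *: D p q); split=> //.
  exact: pos_kernel_compress.
move=> x; rewrite /vector_map.
under [RHS]eq_bigr do under eq_bigr do
  (rewrite scaler_sumr; under eq_bigr do rewrite scaler_sumr).
under [RHS]eq_bigr do rewrite exchange_big /=.
rewrite [RHS]exchange_big; apply: eq_bigr => p _ /=.
under [RHS]eq_bigr do rewrite exchange_big /=.
rewrite [RHS]exchange_big; apply: eq_bigr => q _ /=.
rewrite (hc p) (hc q) op_form_sum scaler_suml; apply: eq_bigr => a _.
rewrite scaler_suml; apply: eq_bigr => b _.
by rewrite scalerA; congr (_ *: _); ring.
Qed.

(** [io] is the tensor of the inclusion. A ucp map [psi] on the dual is a positive matrix [Y] over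
    the subsystem, and the image of [io] under [phi] and [psi] is [phi] applied to [Y]; so [io] is
    min-positive. Equality of the cones writes [io] plus [e] times the unit as a sum of products,
    and evaluating the dual legs at [x] gives the map. *)
Lemma identity_approximable (E : frame V) L (e : R) : min_eq_max V (dual_opsys E) ->
  0 < e -> {in L, forall x, in_frame E x} ->
  approximable L (fun x => x + (e * vstate (frame_vecs E) x) *: unit).
Proof.
move=> mm e0 eL.
pose T := dual_opsys E.
pose io : tensor V T := \sum_i tens (frame_basis i) (delta_mx 0 i : 'rV[R]_(frame_dim E)).
have rowE (f : 'rV[R]_(frame_dim E)) : f = \sum_i f 0 i *: delta_mx 0 i.
  exact: row_sum_delta.
have mio : min_cone (\matrix_(i < 1, j < 1) io).
  move=> m k phi psi uphi upsi.
  have [g gE gt] := tensor_map_linear phi psi.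
  apply/poscone_kernel/mx_kernelP.
  pose Y p r : V := \sum_i
    (psi (delta_mx 0 i : 'rV[R]_(frame_dim E)) : 'M[R]_k) p r *: frame_basis (f := E) i.
  have psiE (f : 'rV[R]_(frame_dim E)) p r : (psi f : 'M[R]_k) p r =
      \sum_i f 0 i * (psi (delta_mx 0 i : 'rV[R]_(frame_dim E)) : 'M[R]_k) p r.
    rewrite [f in LHS]rowE linear_sum summxE; apply: eq_bigr => i _.
    by rewrite linearZ_LR mxE.
  have pY : pos_kernel Y.
    split=> [p r|h].
      rewrite /Y star_sum.
      under eq_bigr do rewrite starZ frame_star scaler_sumr.
      rewrite exchange_big; apply: eq_bigr => j _ /=.
      have := ucp_star (V := dual_opsys E) (delta_mx 0 j : 'rV[R]_(frame_dim E)) upsi.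
      move=> /(congr1 (fun A : 'M_k => A p r)); rewrite [RHS]mxE mxE /= => <-.
      rewrite psiE scaler_suml; apply: eq_bigr => i _.
      rewrite scalerA mulrC; congr ((_ * _) *: _); rewrite mxE /ev (bigD1 j) //=.
      by rewrite mxE !eqxx mul1r big1 ?addr0 // => l /negbTE lj; rewrite mxE lj andbF mul0r.
    (* The image under [psi] of the vector kernel is psd; at the test vector with entries 1 where
       [p = a] and 0 elsewhere its form is that of [Y] at [h]. *)
    have /mx_kernelP[_] := ucp_kernel upsi (@vector_kernel_dual _ _ E _ h).
    move=> /(_ (fun a => (a.1 == a.2)%:R)); congr (_ <= _).
    rewrite sum_pair; apply: eq_bigr => p _.
    under eq_bigr do rewrite sum_pair.
    rewrite exchange_big; apply: eq_bigr => r _ /=.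
    under eq_bigr do under eq_bigr do rewrite -mulrA mulrC.
    have -> : \sum_a \sum_c (r == c)%:R * (p == a)%:R *
       (psi (\row_i ip (op (frame_basis (f := E) i) (h r)) (h p)) : 'M[R]_k) a c =
       (psi (\row_i ip (op (frame_basis (f := E) i) (h r)) (h p)) : 'M[R]_k) p r.
      rewrite -[RHS](sandwich_id (U := R^o) (fun a c : 'I_k =>
        (psi (\row_i ip (op (frame_basis (f := E) i) (h r)) (h p)) : 'M[R]_k) a c)).
      apply: eq_bigr => a _; apply: eq_bigr => c _.
      by rewrite mulrC [r == c]eq_sym [p == a]eq_sym [_%:R * _%:R]mulrC mulrC.
    rewrite psiE /Y op_suml ip_suml; apply: eq_bigr => i _.
    by rewrite opZl ipZl mxE mulrC.
  apply: eq_psd (psd_reindex (fun a : 'I_1 * 'I_(m * k) =>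
     ((mxtens_unindex a.2).2, (mxtens_unindex a.2).1))
     ((mx_kernelP _).1 (ucp_kernel uphi pY))) => -[i a] [j c] /=.
  rewrite !mxE gE linear_sum /Y linear_sum !summxE; apply: eq_bigr => l _.
  by rewrite gt linearZ_LR !mxE mulrC.
have [_ /(_ e e0)] := (max_coneE _).1 ((mm 1 _).1 mio).
move=> [n [p [q [A [B [c [pAB ioE]]]]]]].
pose D l p' q' : V := \sum_a \sum_a' (c l (a, p') ord0 * c l (a', q') ord0) *: A l a a'.
have pD l : pos_kernel (D l).
  exact: (pos_kernel_compress (fun a p' => c l (a, p') ord0) (pAB l).1).
have := approximable_sum (index_enum 'I_n) (fun l => approximable_dual eL (pAB l).2 (pD l)).
move=> ap kap kap0; have [J [h [D' [pD' hD']]]] := ap kap kap0.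
exists J, h, D'; split=> // x xL; have := hD' x xL; congr (opn (_ - _) _).
have [ex exE] : exists ex : {linear tensor V T -> V}, forall s f, ex (tens s f) =
    ev (f : 'rV[R]_(frame_dim E)) x *: s.
  apply: (@tensor_lift_witness _ V T V (fun s f => ev (f : 'rV[R]_(frame_dim E)) x *: s)).
    by move=> f a s s'; rewrite scalerDr !scalerA mulrC.
  by move=> s a f f'; rewrite ev_linl scalerDl scalerA.
have exio : ex io = x.
  rewrite linear_sum [RHS]eL //; apply: eq_bigr => i _; rewrite exE; congr (_ *: _).
  rewrite /ev (bigD1 i) //= mxE !eqxx mul1r big1 ?addr0 // => j /negbTE ji.
  by rewrite mxE ji andbF mul0r.
have := congr1 (fun z : 'M[tensor V T]_1 => ex (z ord0 ord0)) ioE.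
rewrite !mxE eqxx mulr1n linearD linearZ_LR exE ev_dual_unit; last exact: eL.
rewrite exio summxE linear_sum.
rewrite scalerA => ->; apply: eq_bigr => l _; rewrite mxE linear_sum.
rewrite [RHS]sum_pair [RHS]exchange_big; apply: eq_bigr => p' _ /=.
under [RHS]eq_bigr do rewrite linear_sum sum_pair exchange_big /=.
rewrite [RHS]exchange_big; apply: eq_bigr => q' _ /=.
rewrite /D scaler_sumr; apply: eq_bigr => a _; rewrite scaler_sumr; apply: eq_bigr => a' _.
by rewrite [RHS]linearZ_LR exE !scalerA mulrC.
Qed.

End VectorFactorization.

Section NuclearToCPFP.
Variables (R : realType) (V : opsys (realScalars R)).
Local Notation F := (realScalars R).
Local Notation H := (opsys_space V).
Local Notation ip := (dotp H : H -> H -> R).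
Local Notation op := (opsys_op V : V -> H -> H).
Local Notation star := (@opsys_star _ V : V -> V).
Local Notation unit := (opsys_unit V : V).

Lemma opn_form_ge x (c : R) h : opn x c -> - (c * ip h h) <= ip (op x h) h.
Proof.
move=> xc; have := opn_form h h xc; have := xc.1; have := ip_ge0 h.
move: (ip (op x h) h) (ip h h) => t n n0 c0 tn.
rewrite lerNl leNgt; apply/negP => lt.
have cn : 0 <= c * n by rewrite mulr_ge0.
have : (c * n) ^+ 2 < (- t) ^+ 2 by rewrite ltr_sqr ?nnegrE // (le_trans cn) // ltW.
apply/negP; rewrite -leNgt sqrrN; apply: le_trans tn _.
by rewrite exprMn [n ^+ 2]expr2 mulrA.
Qed.

Lemma opn_form_norm x (c : R) h : opn x c -> ip h h = 1 -> `|ip (op x h) h| <= c.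
Proof.
move=> xc h1; have := opn_form h h xc; rewrite h1 !mulr1.
by rewrite -[ip _ _ ^+ 2]real_normK ?num_real // ler_pXn2r ?nnegrE ?xc.1.
Qed.

(** The value at the unit is within [kap] of [c] times the unit, so the deficit [P] up to [c + kap]
    is positive. Adding [P] at the diagonal entry [ord0] of the Choi matrix and dividing by
    [c + kap] makes the trace equal to the unit. *)
Lemma sub_state_ucp n (e : 'I_n.+1 -> H) (D : 'I_n.+1 -> 'I_n.+1 -> V) (c kap : R) :
  orthonormal e -> pos_kernel D -> 0 < c -> 0 <= kap ->
  opn (c *: unit - vector_map e D unit) kap ->
  exists (u : {linear V -> mx_opsys F n.+1}) (v : {linear mx_opsys F n.+1 -> V}),
  [/\ ucp u, ucp v & forall x, v (u x) = (c + kap)^-1 *: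
    (vector_map e D x + ip (op x (e ord0)) (e ord0) *:
      ((c + kap) *: unit - vector_map e D unit))].
Proof.
move=> oe pD c0 k0 hc; pose v0 := vector_map e D unit.
have v0E : v0 = \sum_a D a a.
  rewrite /v0 /vector_map; apply: eq_bigr => a _.
  rewrite -[RHS](sum_delta a (D a)); apply: eq_bigr => q _.
  by rewrite opsys_unitE oe.
pose P := (c + kap) *: unit - v0.
have sP : star P = P.
  rewrite /P -[v0]opprK opprK -scaleN1r addrC starP starZ star_unit v0E star_sum.
  by under eq_bigr do rewrite pD.1.
have pP : pos_kernel (fun _ _ : 'I_1 => P).
  apply/pos_kernel1; split=> // h; have := opn_form_ge h hc.
  have -> : P = kap *: unit + (c *: unit - v0).
    by rewrite /P scalerDl addrA; congr (_ - _); exact: addrC.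
  rewrite (opDl (kap *: unit)) opZl opsys_unitE ipDl ipZl -/v0.
  by move: (ip (op (_ - v0) h) h) (ip h h) => y n' hy; lra.
have ck0 : 0 < c + kap by rewrite ltr_wpDr.
have ci0 : 0 <= (c + kap)^-1 by rewrite invr_ge0 ltW.
pose D' a b := (c + kap)^-1 *: (D a b + ((a == ord0)%:R * (b == ord0)%:R) *: P).
have pD' : pos_kernel D'.
  have pc : psd (fun _ _ : 'I_n.+1 => (c + kap)^-1).
    apply: eq_psd (psd_gram (fun (t : 'I_1) (_ : 'I_n.+1) => Num.sqrt (c + kap)^-1)) => i j.
    by rewrite big_ord1 -expr2 sqr_sqrtr.
  apply: (pos_kernel_schur pc); apply: pos_kernelD => //.
  apply: eq_pos_kernel (pos_kernel_compress (fun (_ : 'I_1) i => (i == ord0)%:R) pP) => i j.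
  by rewrite !big_ord1.
have D'1 : \sum_a D' a a = unit.
  rewrite /D' -scaler_sumr big_split /= -v0E.
  under eq_bigr do rewrite -scalerA; rewrite sum_delta eqxx scale1r.
  by rewrite /P addrC subrK scalerA mulVf ?scale1r // gt_eqF.
have [u uu uE] := vector_ucp oe; have [v uv vE] := choi_ucp pD' D'1.
exists u, v; split=> // x; rewrite vE.
have sw (a b : R) (y : V) : a *: (b *: y) = b *: (a *: y) by rewrite !scalerA mulrC.
transitivity (\sum_a \sum_b (c + kap)^-1 *: (ip (op x (e b)) (e a) *: D a b +
    ((a == ord0)%:R * (b == ord0)%:R) *: (ip (op x (e b)) (e a) *: P))).
  apply: eq_bigr => a _; apply: eq_bigr => b _; rewrite uE /D' (sw _ (c + kap)^-1).
  by congr (_ *: _); rewrite scalerDr; congr (_ + _); exact: sw.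
under eq_bigr do rewrite -scaler_sumr big_split /=.
rewrite -scaler_sumr big_split /=; congr (_ *: (_ + _)).
exact: (sandwich_id (fun a b => ip (op x (e b)) (e a) *: P)).
Qed.

Lemma ucp_approximation (h0 : H) (L : seq V) (e : R) : h0 != 0 ->
  (forall T : opsys F, finite_dim T -> min_eq_max V T) -> 0 < e ->
  exists n (u : {linear V -> mx_opsys F n}) (v : {linear mx_opsys F n -> V}),
    [/\ ucp u, ucp v & {in L, forall x, opn (v (u x) - x) e}].
Proof.
move=> h00 mm e0; have [E EL] := frame_exists (unit :: L) h00.
pose de := vstate (frame_vecs E).
have /choice[nf hnf] (y : V) : exists c, opn y c := opn_ex y.
have nf0 y : 0 <= nf y := (hnf y).1.
pose d1 := de unit; have d10 : 0 < d1 := frame_state_gt0 E.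
pose K := \sum_(x <- L) (nf x + `|de x|).
have Kx x : x \in L -> nf x + `|de x| <= K.
  move=> xL; rewrite /K (big_rem x xL) /= lerDl sumr_ge0 // => y _.
  by rewrite addr_ge0.
have K0 : 0 <= K by apply: sumr_ge0 => y _; rewrite addr_ge0.
(* [C] bounds the total error divided by [kap]: 1 from the approximation, [(d1 + 1) * K] from the
   rescaling, at most [3 * K] from the multiple of the unit and from [P]. *)
pose C := 1 + (d1 + 5) * K; have C1 : 1 <= C by rewrite lerDl mulr_ge0 // addr_ge0 // ltW.
have C0 : 0 < C by exact: lt_le_trans C1.
pose kap := Num.min (2^-1) (e / C).
have k0 : 0 < kap by rewrite lt_min invr_gt0 ltr0n divr_gt0.
have k1 : kap < 1 by rewrite gt_min invf_lt1 ?ltr0n // ltr1n.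
have kC : kap * C <= e by rewrite -ler_pdivlMr // ge_min lexx orbT.
have ap := identity_approximable (mm _ (dual_finite_dim E)) k0 EL.
have [J [h [D [pD hD]]]] := ap kap k0.
have [n [f [D' [orf pD' DE]]]] := vector_map_orthonormal h pD.
have {}hD x : x \in unit :: L ->
    opn (x + (kap * de x) *: unit - vector_map f D' x) kap.
  by move=> xL; rewrite -DE; exact: hD.
have h1 : opn ((1 + kap * d1) *: unit - vector_map f D' unit) kap.
  by rewrite scalerDl scale1r; apply: hD; rewrite in_cons eqxx.
have c0 : 0 < 1 + kap * d1 by rewrite addr_gt0 // mulr_gt0.
(* Without vectors the map is 0, and [(1 + kap * d1) *: unit] would have norm at most [kap < 1],
   impossible at [h0]. *)
case: n f D' orf pD' DE hD h1 => [|n] f D' orf pD' DE hD h1.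
  have := h1.2 h0; rewrite /vector_map big_ord0 subr0 opZl opsys_unitE ipZl ipZr mulrA -expr2.
  rewrite ler_pM2r; last exact: (@neq0_dnorm_gt0 _ _ _ (dotp H)).
  have : 0 < kap * d1 by rewrite mulr_gt0.
  by move: (kap * d1) => t t0; nra.
have [u [v [uu uv uvE]]] := sub_state_ucp orf pD' c0 (ltW k0) h1.
exists n.+1, u, v; split=> // x xL; rewrite uvE.
have xuL : x \in unit :: L by rewrite in_cons xL orbT.
set c := 1 + kap * d1 + kap in uvE *.
have c1 : 1 <= c by rewrite /c -addrA lerDl addr_ge0 ?ltW // mulr_gt0.
have cg0 : 0 < c by exact: lt_le_trans c1.
set P := c *: unit - _; set t := ip _ _.
have hP : opn P (kap + kap).
  have -> : P = kap *: unit + ((1 + kap * d1) *: unit - vector_map f D' unit).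
    by rewrite /P /c [in LHS]scalerDl addrA; congr (_ - _); exact: addrC.
  apply: opnD => //; have := opnZ kap (opn_unit V).
  by rewrite ger0_norm ?mulr1 // ltW.
have ht : `|t| <= nf x by apply: opn_form_norm (hnf x) _; rewrite orf eqxx.
clearbody P t.
have -> : c^-1 *: (vector_map f D' x + t *: P) - x =
  (- c^-1) *: (x + (kap * de x) *: unit - vector_map f D' x) + (c^-1 - 1) *: x +
  (c^-1 * (kap * de x)) *: unit + (c^-1 * t) *: P.
  have E0 (A Y Z Q : V) : - (A + Y - Z) + (A - x) + Y + Q = Z + Q - x.
    by rewrite opprB -[_ + (A - x) + Y]addrA [A - x + Y]addrAC subrKA addrAC.
  rewrite scalerDr scaleNr -(E0 (c^-1 *: x) ((c^-1 * (kap * de x)) *: unit)).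
  rewrite scalerBr scalerDr scalerBl scale1r !scalerA.
  by congr (- (_ + _ - _) + _ + _ + _).
have ci0 : 0 <= c^-1 by rewrite invr_ge0 ltW.
have ci1 : c^-1 <= 1 by rewrite invf_le1.
have cx : `|c^-1 - 1| <= kap * d1 + kap.
  rewrite distrC ger0_norm ?subr_ge0 //.
  have -> : 1 - c^-1 = (c - 1) * c^-1 by field; rewrite gt_eqF.
  have ck : c - 1 = kap * d1 + kap by rewrite /c; ring.
  by rewrite ck ler_piMr // addr_ge0 ?ltW // mulr_gt0.
have hs := opnD (opnD (opnD (opnZ (- c^-1) (hD x xuL)) (opnZ (c^-1 - 1) (hnf x)))
  (opnZ (c^-1 * (kap * de x)) (opn_unit V))) (opnZ (c^-1 * t) hP).
apply: opn_le hs _; apply: le_trans _ kC.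
have := Kx x xL; have := nf0 x; have := normr_ge0 (de x).
rewrite normrN !normrM (ger0_norm ci0) (ger0_norm (ltW k0)) mulr1.
have e1 : c^-1 * kap <= kap by rewrite ler_piMl // ltW.
have e2 : `|c^-1 - 1| * nf x <= (kap * d1 + kap) * nf x by rewrite ler_wpM2r.
have e3 : c^-1 * (kap * `|de x|) <= kap * `|de x| by rewrite ler_piMl // mulr_ge0 // ltW.
have e4 : c^-1 * `|t| * (kap + kap) <= nf x * (kap + kap).
  rewrite ler_wpM2r ?addr_ge0 ?(ltW k0) //; apply: le_trans ht.
  by rewrite ler_piMl.
move=> a0 b0 abK; rewrite /C.
have e5 : kap * (nf x + `|de x|) <= kap * K by rewrite ler_pM2l.
have e6 : kap * d1 * nf x <= kap * d1 * K.
  rewrite ler_wpM2l ?mulr_ge0 ?(ltW k0) ?(ltW d10) //.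
  by apply: le_trans abK; rewrite lerDl.
have e7 : 0 <= kap * nf x by rewrite mulr_ge0 // ltW.
have e8 : 0 <= kap * `|de x| by rewrite mulr_ge0 // ltW.
have e9 : 0 <= kap * K by rewrite mulr_ge0 // ltW.
move: e1 e2 e3 e4 e5 e6 e7 e8 e9.
move: (c^-1 * kap) (`|c^-1 - 1| * nf x) (c^-1 * (kap * `|de x|)) (c^-1 * `|t| * _).
move=> u1 u2 u3 u4 e1 e2 e3 e4 e5 e6 e7 e8 e9.
by lra.
Qed.

Lemma ucp_approximation_trivial : (forall h : H, h = 0) ->
  exists (u : {linear V -> mx_opsys F 0}) (v : {linear mx_opsys F 0 -> V}),
    ucp u /\ ucp v.
Proof.
move=> H0; have V0 (x y : V) : x = y.
  by apply: op_form_inj => h k; rewrite (H0 h) !op0r.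
have [|u uu _] := @vector_ucp _ V 0 (fun=> 0); first by case.
have [| |v uv _] := @choi_ucp _ V 0 (fun _ _ => 0); last by exists u, v.
  by split=> [|h]; [case | rewrite big_ord0].
exact: V0.
Qed.

(** The net is indexed by a finite list and an integer [n] with tolerance [1 / (n + 1)], directed by
    concatenation and maximum. *)
Lemma CPFP_of_min_eq_max :
  (forall T : opsys F, finite_dim T -> min_eq_max V T) -> CPFP V.
Proof.
move=> mm.
have ap (L : seq V) (e : R) : 0 < e ->
    exists n (u : {linear V -> mx_opsys F n}) (v : {linear mx_opsys F n -> V}),
    [/\ ucp u, ucp v & {in L, forall x, opn (v (u x) - x) e}].
  move=> e0; have [[h0 h00]|H0] := pselect (exists h : H, h != 0).
    exact: ucp_approximation h00 mm e0.
  have {}H0 (h : H) : h = 0.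
    by apply/eqP/negPn/negP => h0; apply: H0; exists h.
  have [u [v [uu uv]]] := ucp_approximation_trivial H0.
  exists 0, u, v; split=> // x _; split=> [|h]; first exact: ltW.
  by rewrite (H0 (op _ _)) ip0l mulr_ge0 ?sqr_ge0 ?ip_ge0.
have n0 (n : nat) : 0 < n.+1%:R^-1 :> R by rewrite invr_gt0 ltr0n.
have W (t : seq V * nat) : {n : nat & {uv : {linear V -> mx_opsys F n} *
    {linear mx_opsys F n -> V} | [/\ ucp uv.1, ucp uv.2 &
    {in t.1, forall x, opn (uv.2 (uv.1 x) - x) t.2.+1%:R^-1}]}}.
  have [n hn] := cid (ap t.1 _ (n0 t.2)); exists n; apply: cid.
  by have [u [v uv]] := hn; exists (u, v).
exists (seq V * nat)%type,
  (fun s t => {subset s.1 <= t.1} /\ (s.2 <= t.2)%N),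
  (fun t => projT1 (W t)), (fun t => (sval (projT2 (W t))).1),
  (fun t => (sval (projT2 (W t))).2); split.
- split=> [|s|s t r [st st'] [tr tr']|s t].
  + exact: inhabits ([::], 0%N).
  + by split.
  + by split=> [x /st/tr //|]; exact: leq_trans tr'.
  + exists (s.1 ++ t.1, maxn s.2 t.2); split; rewrite ?leq_maxl ?leq_maxr //;
      by move=> x xs; rewrite mem_cat xs ?orbT.
- by move=> t; have [] := svalP (projT2 (W t)).
- by move=> t; have [] := svalP (projT2 (W t)).
move=> x e e0; exists ([:: x], Num.truncn (e^-1 : R)) => t [xt nt].
have [_ _ /(_ x)] := svalP (projT2 (W t)).
rewrite xt ?mem_seq1 ?eqxx // => /(_ isT) hx.
apply/opnP; first exact: ltW.
apply: opn_le hx _; rewrite invf_ple ?posrE ?ltr0n //.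
apply: le_trans (ltW (truncnS_gt _)) _.
by rewrite ler_nat ltnS.
Qed.

End NuclearToCPFP.

Theorem theorem11p1 (R : realType) (S : opsys (realScalars R)) :
  [<-> CPFP S;
       CPFP (complexification S);
       forall T : opsys (realScalars R), min_eq_max S T;
       forall T : opsys (realScalars R), finite_dim T -> min_eq_max S T].
Proof.
tfae.
- exact: CPFP_complexification.
(* The passage from the complex factorization to real tensor products goes through the real
   factorization. *)
- by move=> /CPFP_of_complexification h T; exact: CPFP_min_eq_max.
- by move=> h T _.
- exact: CPFP_of_min_eq_max.
Qed.
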